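(* Let $A\subset\mathbb{C}$ be a compact set without isolated points, $V$ a connected (open) neighborhood of $A$, and $U$ an open set such that $A\subset\overline{U}\subset V$ and $A\cap U\neq\emptyset$. Assume that $A$ is not laminar relative to at least one component of $U$ meeting $A$. Let $\mathcal{G}$ be a collection of holomorphic IFS $(G,\Omega_G)$ such that $\sup\{\#G: G\in\mathcal{G}\}<\infty$ and: (1) for every $G\in\mathcal{G}$, $A_G=A$ and $V\subset\Omega_G$; (2) for every $G\in\mathcal{G}$, the sets $g(U)$, $g\in G$, are pairwise disjoint; (3) there exists $G_*\in\mathcal{G}$ such that either $G_*$ satisfies the strong separation condition or $\bigcup_{g\in G_*}g(U)\subset U$. Then the collection $\{g|_V: g\in G \text{ for some } G\in\mathcal{G}\}$ contains at most finitely many different functions.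
   Context: A holomorphic IFS is a pair $(G,\Omega)$ where $\Omega$ is a bounded domain in $\mathbb{C}$ and $G=\{g_i:\Omega\to\Omega\}_{i\in\Lambda}$ is a finite collection of univalent (holomorphic injective) maps with $\overline{g_i(\Omega)}\subset\Omega$ for all $i$; $\#G$ is the number of its maps. (Each $g_i$ is then a strict contraction of $\Omega$ in its hyperbolic metric.) Its attractor $A_G$ is the unique non-empty compact set $A\subset\Omega$ with $A=\bigcup_{i\in\Lambda}g_i(A)$; it is always assumed that $\#A_G\ge 2$. The strong separation condition (SSC) means $g_i(A_G)\cap g_j(A_G)=\emptyset$ for all $i\neq j$. A compact $K\subset\mathbb{C}$ is laminar relative to a domain $D$ (with $D\cap K\neq\emptyset$) if every open subset of $D$ intersecting $K$ contains a simply connected domain $W$ for which there are a non-empty compact set $L\subset i\mathbb{R}$ and a univalent map $\psi$ defined in a neighborhood of $\overline{W}$ with $\psi(\overline{W}\cap K)=[0,1]\times L=\{x+y:x\in[0,1],y\in L\}$. *)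

(* Defs.v *)
From HB Require Import structures.
From mathcomp Require Import all_boot all_order all_algebra.
From mathcomp Require Import all_classical all_reals all_analysis.
From mathcomp Require Import complex.
Set Implicit Arguments.
Unset Strict Implicit.
Unset Printing Implicit Defensive.
Import Order.TTheory GRing.Theory Num.Theory.
Import numFieldNormedType.Exports.
Local Open Scope classical_set_scope.
Local Open Scope ring_scope.
Local Open Scope complex_scope.

(* The library attaches its topology and norm to an abstract numFieldType;
   transport them to R[i], whose norm is the modulus. *)
HB.instance Definition _ (R : rcfType) := NormedModule.copy R[i] R[i]^o.

Section ComplexPlane.
Context {R : realType}.
Implicit Types (D K W : set R[i]) (f : R[i] -> R[i]).

Definition domain D := [/\ open D, connected D & D !=set0].

(* Limits are taken in R[i], so [derivable f z 1] is complex
   differentiability at z.  It depends only on the germ of f at z, so for open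
   D the values of f off D are irrelevant. *)
Definition holomorphic_on D f := forall z, D z -> derivable f z 1.

Definition univalent_on D f := holomorphic_on D f /\ set_inj D f.

Definition components D := [set connected_component D z | z in D].

(* A loop at gamma 0 = gamma 1 in W, contracted in W with fixed base point; the
   first argument of H is the homotopy parameter. *)
Definition null_homotopic W (gamma : R -> R[i]) :=
  exists H : R * R -> R[i],
    [/\ {within `[0, 1] `*` `[0, 1], continuous H},
        forall s t : R, 0 <= s <= 1 -> 0 <= t <= 1 -> W (H (s, t)),
        forall t : R, 0 <= t <= 1 -> H (0, t) = gamma t,
        forall t : R, 0 <= t <= 1 -> H (1, t) = gamma 0 &
        forall s : R, 0 <= s <= 1 -> H (s, 0) = gamma 0 /\ H (s, 1) = gamma 0].

(* Path-connectedness is automatic for a connected open subset of the plane. *)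
Definition simply_connected_domain W :=
  domain W /\
  forall gamma : R -> R[i],
    {within `[0, 1], continuous gamma} ->
    (forall t : R, 0 <= t <= 1 -> W (gamma t)) -> gamma 0 = gamma 1 ->
    null_homotopic W gamma.

(* Meant for K compact and D a domain that meets K. *)
Definition laminar K D :=
  forall O : set R[i], open O -> O `<=` D -> O `&` K !=set0 ->
    exists2 W : set R[i], W `<=` O /\ simply_connected_domain W &
      exists (L : set R[i]) (psi : R[i] -> R[i]),
        [/\ L !=set0, compact L, L `<=` [set z | complex.Re z = 0],
            exists N : set R[i],
              [/\ open N, closure W `<=` N & univalent_on N psi] &
            psi @` (closure W `&` K) =
              [set x%:C + y | x in `[0, 1]%classic & y in L]].

Definition invariant_compact (Omega : set R[i]) n (g : 'I_n -> R[i] -> R[i])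
    K :=
  [/\ K !=set0, compact K, K `<=` Omega & K = \bigcup_i (g i @` K)].

(* For a holomorphic IFS with at least one map the invariant compact set exists
   and is unique.  The default value set0 is never an invariant compact set. *)
Definition attractor (Omega : set R[i]) n (g : 'I_n -> R[i] -> R[i]) :
    set R[i] :=
  xget set0 (invariant_compact Omega g).

End ComplexPlane.

(* Each map is a total function on R[i]; only its restriction to ifs_dom is
   constrained or used. *)
Record holo_ifs (R : realType) := HoloIFS {
  ifs_dom : set R[i];
  ifs_card : nat;
  ifs_map :> 'I_ifs_card -> R[i] -> R[i];
  ifs_dom_domain : domain ifs_dom;
  ifs_dom_bounded : bounded_set ifs_dom;
  ifs_map_univalent : forall i, univalent_on ifs_dom (ifs_map i);
  ifs_map_dom : forall i, set_fun ifs_dom ifs_dom (ifs_map i);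
  ifs_map_closure : forall i, closure (ifs_map i @` ifs_dom) `<=` ifs_dom;
  ifs_attractor_nontrivial : exists z w,
    [/\ attractor ifs_dom ifs_map z, attractor ifs_dom ifs_map w & z <> w]
}.

Arguments ifs_map {R} h.

Definition ifs_attractor (R : realType) (G : holo_ifs R) : set R[i] :=
  attractor (ifs_dom G) (ifs_map G).

Definition strong_separation (R : realType) (G : holo_ifs R) :=
  trivIset setT (fun i => G i @` ifs_attractor G).

(* Main.v *)
(* By the distortion theorem the maps g of the systems in GG form a normal family.
   Fix a in A and U and d > 0, and suppose that infinitely many different g
   satisfied |g'(a)| >= d.  Then two of them, g1 <> g2, would be arbitrarily close,
   and g2^-1 g1 would be a germ close to, but different from, the identity that
   preserves A; here the disjointness of the sets g(U) is used to see that x in U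
   lies in A as soon as g x does.  Conjugating such germs by the maps of G_*
   renormalises them to a disc of fixed size, where the displacement near the
   centre is comparable to its maximum.  Rescaled displacements accumulate at a
   nonzero holomorphic vector field whose local flow preserves A; straightening it
   gives a flow box, the maps of G_* carry it into every open set meeting A, and A
   is laminar everywhere.  Hence only finitely many restrictions to V have
   derivative at least d at a, for every d > 0.  Systems with arbitrarily small
   derivatives are excluded because their remaining finitely many maps would have
   to cover the perfect set A. *)
Require Import Defs.
From HB Require Import structures.
From mathcomp Require Import all_boot all_order all_algebra.
From mathcomp Require Import all_classical all_reals all_analysis.
From mathcomp Require Import complex ring lra.
Set Implicit Arguments.
Unset Strict Implicit.
Unset Printing Implicit Defensive.
Import Order.TTheory GRing.Theory Num.Theory.
Import numFieldNormedType.Exports.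
Local Open Scope classical_set_scope.
Local Open Scope ring_scope.
Local Open Scope complex_scope.

(** * Complex differentiability *)

Section Modulus.
Context {R : realType}.
Local Notation C := R[i].
Implicit Types x y z w : C.

(** A symmetry of A can be carried around by the maps of G_* only at points where membership in A is
    detected by their images: x must lie in A as soon as some word applied to x does. Germs are
    therefore tested on [faithful_set] alone. Hypothesis (3) gives this set an interior point in A,
    and words of G_* copy that interior near every point of A. The germs g2^-1 g1 live on discs
    whose size is unrelated to G_*; because r in [star_family] is fixed before rho, long words bring
    all of them to the same radius. No sharp constant matters, so the analysis runs on squares and
    segments, with Landau's form of Bloch's theorem as the source of distortion bounds, and
    contraction of words comes from the Earle-Hamilton trick instead of a metric. Limits are taken
    along ultrafilters: one of them handles centres, maps and finitely many cases at once, without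
    subsequences. *)

Definition cmod (z : C) : R := Normc.normc z.

Lemma normcmodE z : `|z| = (cmod z)%:C. Proof. by []. Qed.
Lemma cmod0 : cmod 0 = 0. Proof. exact: Normc.normc0. Qed.
Lemma cmod1 : cmod 1 = 1. Proof. exact: Normc.normc1. Qed.
Lemma cmod_ge0 z : 0 <= cmod z.
Proof. by rewrite -lecR -normcmodE normr_ge0. Qed.
Lemma cmod_eq0 z : (cmod z == 0) = (z == 0).
Proof. by rewrite -(inj_eq (@complexI R)) -normcmodE normr_eq0. Qed.
Lemma cmod_gt0 z : (0 < cmod z) = (z != 0).
Proof. by rewrite lt_def cmod_eq0 cmod_ge0 andbT. Qed.
Lemma cmodM z w : cmod (z * w) = cmod z * cmod w.
Proof. exact: Normc.normcM. Qed.
Lemma cmodV z : cmod z^-1 = (cmod z)^-1.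
Proof. exact: Normc.normcV. Qed.
Lemma cmod_div z w : cmod (z / w) = cmod z / cmod w.
Proof. by rewrite cmodM cmodV. Qed.
Lemma cmodX z n : cmod (z ^+ n) = cmod z ^+ n.
Proof. by elim: n => [|n IH]; rewrite ?expr0 ?cmod1// !exprS cmodM IH. Qed.
Lemma cmodN z : cmod (- z) = cmod z. Proof. exact: normcN. Qed.
Lemma cmodC z w : cmod (z - w) = cmod (w - z).
Proof. by rewrite -cmodN opprB. Qed.
Lemma cmodD z w : cmod (z + w) <= cmod z + cmod w.
Proof. exact: le_normcD. Qed.
Lemma cmodB z w : cmod (z - w) <= cmod z + cmod w.
Proof. by rewrite -(cmodN w) cmodD. Qed.
Lemma cmod_tri y z w : cmod (z - w) <= cmod (z - y) + cmod (y - w).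
Proof. by have := cmodD (z - y) (y - w); rewrite addrA subrK. Qed.
Lemma cmod_rtri z w : cmod z - cmod w <= cmod (z - w).
Proof. by have := cmodD (z - w) w; rewrite subrK; lra. Qed.
Lemma cmodR (a : R) : cmod a%:C = `|a|.
Proof. by rewrite /cmod /= expr0n /= addr0 sqrtr_sqr. Qed.
Lemma cmodI : cmod 'i%C = 1.
Proof. by rewrite /cmod /= expr0n /= add0r expr1n sqrtr1. Qed.
Lemma cmod_Re z : `|complex.Re z| <= cmod z.
Proof. by rewrite -lecR; exact: normc_ge_Re. Qed.
Lemma cmod_Im z : `|complex.Im z| <= cmod z.
Proof.
have := cmod_Re (z * 'i%C); rewrite cmodM cmodI mulr1.
by case: z => a b /=; rewrite mulr0 mulr1 add0r normrN.
Qed.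
Lemma cmod_ReIm z : cmod z <= `|complex.Re z| + `|complex.Im z|.
Proof.
rewrite {1}[z]complexE; apply: (le_trans (cmodD _ _)).
by rewrite cmodM cmodI mul1r !cmodR.
Qed.
End Modulus.
Arguments cmod : simpl never.

Section DerivEps.
Context {K : numFieldType}.

Lemma derivable_eps (f : K -> K) (x : K) : derivable f x 1 ->
  forall e, 0 < e -> exists2 d, 0 < d & forall h, `|h| < d ->
    `|f (h + x) - f x - h * 'D_1 f x| <= e * `|h|.
Proof.
move=> df e e0.
have /cvgrPdist_le /(_ e e0) := df.
rewrite /dnbhs /= => -[d /= d0 H]; exists d => // h hd.
have [->|h0] := eqVneq h 0.
  by rewrite add0r subrr mul0r subrr normr0 mulr0.
have := H h; rewrite /= sub0r normrN => /(_ hd h0).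
rewrite /derive /= => Hh.
have -> : f (h + x) - f x - h * 'D_1 f x =
   - h * ('D_1 f x - h^-1 *: (f (h *: 1 + x) - f x)).
  rewrite /GRing.scale /= mulr1; field. by [].
by rewrite normrM normrN mulrC ler_wpM2r.
Qed.

Lemma eps_derivable (f : K -> K) (x l : K) :
  (forall e, 0 < e -> exists2 d, 0 < d & forall h, `|h| < d ->
    `|f (h + x) - f x - h * l| <= e * `|h|) -> is_derive x 1 f l.
Proof.
move=> H.
have cv : h^-1 *: (f (h *: 1 + x) - f x) @[h --> 0^'] --> l.
  apply/cvgrPdist_le => e e0; have [d d0 Hd] := H e e0.
  rewrite /dnbhs; exists d => //= h; rewrite /= sub0r normrN => hd h0.
  have -> : l - h^-1 *: (f (h *: 1 + x) - f x) =
     - h^-1 * (f (h + x) - f x - h * l).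
    by rewrite /GRing.scale /= mulr1; field.
  rewrite normrM normrN normfV mulrC ler_pdivrMr ?normr_gt0//.
  exact: Hd.
apply: DeriveDef; first by apply/cvg_ex; exists l.
exact/cvg_lim.
Qed.
End DerivEps.

(** * Curves in the plane: primitives on an interval and the mean value inequality *)

Section RealPrimitives.
Context {R : realType}.
Local Notation C := R[i].
Implicit Types (a b c t s : R) (F G : R -> C).

(** The infimum of the counterexamples cannot be a (first hypothesis), cannot be a counterexample
    itself (third) and cannot be followed closely by others (second). This replaces compactness of
    the interval in [prim_bound]. *)
Lemma real_induction (P : R -> Prop) a b :
  P a ->
  (forall t, a <= t < b -> (forall s, a <= s <= t -> P s) ->
     exists2 d, 0 < d & forall s, t < s < t + d -> s <= b -> P s) ->
  (forall t, a < t <= b -> (forall s, a <= s < t -> P s) -> P t) ->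
  forall t, a <= t <= b -> P t.
Proof.
move=> Pa Pr Pl t0 /andP[at0 t0b]; apply: contrapT => nP0.
pose S := [set t | a <= t <= b /\ ~ P t].
have S0 : S t0 by rewrite /S /= at0 t0b.
have infS : has_inf S by split; [exists t0|exists a => t [/andP[]]].
pose c := inf S.
have ac : a <= c by apply: lb_le_inf => [|t [/andP[]]//]; exists t0.
have cb : c <= b by apply: le_trans t0b; apply: ge_inf => //; case: infS.
have lt_c s : a <= s < c -> P s.
  move=> /andP[as' sc]; apply: contrapT => nPs.
  have : c <= s.
    apply: ge_inf; first by case: infS.
    by split=> //; rewrite as' /= (le_trans (ltW sc) cb).
  by rewrite leNgt sc.
have le_c s : a <= s <= c -> P s.
  move=> /andP[as']; rewrite le_eqVlt => /predU1P[->|sc]; last by apply: lt_c; rewrite as'.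
  have [ca|ca] := eqVneq c a; first by rewrite ca.
  by apply: Pl => //; rewrite lt_def ca ac.
have [cb'|cb'] := eqVneq c b.
  by apply: nP0; apply: le_c; rewrite at0 cb'.
have [||d d0 Hd] := Pr c; first by rewrite ac lt_def eq_sym cb' cb.
  exact: le_c.
have : c + d <= c; last by rewrite leNgt ltrDl d0.
apply: lb_le_inf; first by exists t0.
move=> s [/andP[as' sb] nPs]; rewrite leNgt; apply/negP => scd; apply: nPs.
have [sc|cs] := lerP s c; first by apply: le_c; rewrite as'.
by apply: Hd => //; rewrite cs.
Qed.

(** Differentiation within [a, b], one-sided at the ends: F and g need no extension outside, and
    restriction to a subinterval is immediate. *)
Definition isprim a b (g F : R -> C) := forall t, a <= t <= b ->
  forall e, 0 < e -> exists2 d, 0 < d & forall s, a <= s <= b -> `|s - t| < d ->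
    cmod (F s - F t - (s - t)%:C * g t) <= e * `|s - t|.

(** For curves in the plane the mean value theorem fails and only the inequality survives. It is
    proved with a slack, by real induction. *)
Lemma prim_bound a b (g F : R -> C) M : a <= b -> isprim a b g F ->
  (forall t, a <= t <= b -> cmod (g t) <= M) ->
  cmod (F b - F a) <= M * (b - a).
Proof.
move=> ab pF gM; apply/ler_addgt0Pr => e e0.
have [->|ab'] := eqVneq a b; first by rewrite !subrr mulr0 cmod0; lra.
have ba : 0 < b - a by rewrite subr_gt0 lt_def eq_sym ab' ab.
have e'0 : 0 < e / (b - a) by rewrite divr_gt0.
(* The slack absorbs the errors of the difference quotients and adds up to e over the whole
   interval. *)
pose N := M + e / (b - a).
suff H : forall t, a <= t <= b -> cmod (F t - F a) <= N * (t - a).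
  have := H b; rewrite ab lexx => /(_ isT); rewrite /N mulrDl mulfVK ?gt_eqF//.
have step t s : a <= t <= b -> a <= s <= b ->
    cmod (F s - F t - (s - t)%:C * g t) <= e / (b - a) * `|s - t| ->
    cmod (F s - F t) <= N * `|s - t|.
  move=> tab sab; have := cmod_rtri (F s - F t) ((s - t)%:C * g t).
  rewrite cmodM cmodR /N mulrDl; have := gM _ tab.
  move=> /(ler_wpM2r (normr_ge0 (s - t))); rewrite [cmod _ * _]mulrC; lra.
apply: real_induction; first by rewrite !subrr mulr0 cmod0.
- move=> t /andP[at' tb] H.
  have tab : a <= t <= b by rewrite at' ltW.
  have [d d0 Hd] := pF t tab _ e'0; exists d => // s /andP[ts std] sb.
  have sab : a <= s <= b by rewrite sb (le_trans at' (ltW ts)).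
  have := step t s tab sab; have := Hd s sab.
  rewrite ger0_norm ?subr_ge0 ?(ltW ts)// => H2 st.
  have /H2/st : s - t < d by lra.
  have := H t; rewrite at' lexx => /(_ isT).
  by have := cmod_tri (F t) (F s) (F a); lra.
- move=> t /andP[at' tb] H.
  have tab : a <= t <= b by rewrite tb (ltW at').
  have [d d0 Hd] := pF t tab _ e'0.
  pose s := Num.max a (t - d / 2).
  have st : s < t by rewrite /s gt_max at' /=; lra.
  have as' : a <= s by rewrite /s le_max lexx.
  have sab : a <= s <= b by rewrite as' (le_trans (ltW st)).
  have := step t s tab sab; have := Hd s sab.
  rewrite ler0_norm ?subr_le0 ?(ltW st)// => H2 st'.
  have /H2/st' : - (s - t) < d.
    by have : t - d / 2 <= s by [rewrite /s le_max lexx orbT]; lra.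
  have := H s; rewrite as' st => /(_ isT).
  by have := cmod_tri (F s) (F t) (F a); rewrite (cmodC (F s) (F t)); lra.
Qed.

Lemma primD a b g1 F1 g2 F2 : isprim a b g1 F1 -> isprim a b g2 F2 ->
  isprim a b (fun t => g1 t + g2 t) (fun t => F1 t + F2 t).
Proof.
move=> p1 p2 t tab e e0; have e20 : 0 < e / 2 by lra.
have [d1 d10 H1] := p1 t tab _ e20; have [d2 d20 H2] := p2 t tab _ e20.
exists (Num.min d1 d2); first by rewrite lt_min d10.
move=> s sab; rewrite lt_min => /andP[/(H1 s sab) h1 /(H2 s sab) h2].
have -> : F1 s + F2 s - (F1 t + F2 t) - (s - t)%:C * (g1 t + g2 t) =
  (F1 s - F1 t - (s - t)%:C * g1 t) + (F2 s - F2 t - (s - t)%:C * g2 t) by ring.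
by apply: (le_trans (cmodD _ _)); lra.
Qed.

Lemma primZ a b g F k : isprim a b g F ->
  isprim a b (fun t => k * g t) (fun t => k * F t).
Proof.
move=> p t tab e e0; have k1 : 0 < cmod k + 1 by have := cmod_ge0 k; lra.
have [d d0 H] := p t tab _ (divr_gt0 e0 k1); exists d => // s sab /(H s sab) h.
have -> : k * F s - k * F t - (s - t)%:C * (k * g t) =
  k * (F s - F t - (s - t)%:C * g t) by ring.
rewrite cmodM; apply: le_trans (ler_wpM2l (cmod_ge0 k) h) _.
rewrite mulrA; apply: ler_wpM2r => //.
rewrite mulrCA ler_piMr ?(ltW e0)// ler_pdivrMr//; lra.
Qed.

Lemma prim_eq a b g1 g2 F1 F2 : (forall t, a <= t <= b -> g1 t = g2 t) ->
  (forall t, a <= t <= b -> F1 t = F2 t) -> isprim a b g1 F1 -> isprim a b g2 F2.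
Proof.
move=> gE FE p t tab e e0; have [d d0 H] := p t tab e e0; exists d => // s sab.
by rewrite -gE// -!FE//; exact: H.
Qed.

Lemma prim_sub a b a' b' g F : a <= a' -> b' <= b -> isprim a b g F -> isprim a' b' g F.
Proof.
move=> aa bb p t /andP[ta tb] e e0.
have [|d d0 H] := p t _ e e0; first by rewrite (le_trans aa ta) (le_trans tb bb).
exists d => // s /andP[sa sb]; apply: H.
by rewrite (le_trans aa sa) (le_trans sb bb).
Qed.

Lemma prim_unique a b g F1 F2 : a <= b -> isprim a b g F1 -> isprim a b g F2 ->
  F1 b - F1 a = F2 b - F2 a.
Proof.
move=> ab p1 p2.
have := primD p1 (primZ (-1) p2) => p.
have /(prim_bound ab p) : forall t, a <= t <= b -> cmod (g t + -1 * g t) <= 0.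
  by move=> t _; rewrite mulN1r subrr cmod0.
rewrite mul0r => H.
have : cmod (F1 b + -1 * F2 b - (F1 a + -1 * F2 a)) == 0 by rewrite eq_le H cmod_ge0.
rewrite cmod_eq0 => /eqP H'.
by apply/eqP; rewrite -subr_eq0; apply/eqP; rewrite -H'; ring.
Qed.

Definition rcont a b (g : R -> C) := forall t, a <= t <= b -> forall e, 0 < e ->
  exists2 d, 0 < d & forall s, a <= s <= b -> `|s - t| < d -> cmod (g s - g t) <= e.

Lemma real_prim_exists a b (g : R -> R) : continuous g ->
  exists F : R -> R, forall t, a <= t <= b -> is_derive t 1 F (g t).
Proof.
move=> cg.
(* One unit is added on each side so that a and b become interior points, where the fundamental
   theorem of calculus gives a two-sided derivative. *)
have ig : (@lebesgue_measure R).-integrable `[a - 1, b + 1] (EFin \o g).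
  apply: continuous_compact_integrable; first exact: segment_compact.
  exact: continuous_subspaceT.
exists (fun x => (\int[@lebesgue_measure R]_(t in [set` `[a - 1, x]]) (g t))%R).
move=> t /andP[at' tb].
have tb1 : t < b + 1 by lra.
have at1 : a - 1 < t by lra.
have [d1 d2] := continuous_FTC1_closed tb1 ig at1 (cg t).
split; [exact: d1|by rewrite -derive1E].
Qed.

Lemma prim_exists a b g : a <= b -> rcont a b g -> exists F, isprim a b g F.
Proof.
(* Clamping to [a, b] makes g continuous on the whole line; its real and imaginary parts are then
   integrated separately. *)
move=> ab cg; pose k t := Num.max a (Num.min b t).
have kab t : a <= k t <= b.
  by rewrite /k le_max lexx /= ge_max ab ge_min lexx.
have kid t : a <= t <= b -> k t = t.
  by move=> /andP[ta tb]; rewrite /k (min_idPr tb) (max_idPr ta).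
have klip s t : `|k s - k t| <= `|s - t|.
  have h1 := ler_norm (s - t); have h2 := ler_norm (t - s); rewrite distrC in h2.
  rewrite /k /Num.max /Num.min ler_norml; move: `|s - t| h1 h2 ab => u; clear.
  by do ?case: ifPn; rewrite -?leNgt => *; apply/andP; split; lra.
have cpart (p : C -> R) : (forall z w, `|p z - p w| <= cmod (z - w)) ->
    continuous (fun t => p (g (k t))).
  move=> pl t; apply/cvgrPdist_le => e e0.
  have [d d0 H] := cg _ (kab t) _ e0; exists d => //= s std.
  apply: le_trans (pl _ _) _; rewrite cmodC; apply: H => //.
  by apply: le_lt_trans (klip _ _) _; rewrite distrC.
have cRe : continuous (fun t => complex.Re (g (k t))).
  apply: cpart => z w; have := cmod_Re (z - w).
  by case: z w => ? ? [].
have cIm : continuous (fun t => complex.Im (g (k t))).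
  apply: cpart => z w; have := cmod_Im (z - w).
  by case: z w => ? ? [].
have [F1 H1] := real_prim_exists a b cRe; have [F2 H2] := real_prim_exists a b cIm.
exists (fun t => F1 t +i* F2 t) => t tab e e0.
have e20 : 0 < e / 2 by lra.
have [D1 E1] := H1 t tab; have [D2 E2] := H2 t tab.
have [d1 d10 Hd1] := derivable_eps D1 e20; have [d2 d20 Hd2] := derivable_eps D2 e20.
exists (Num.min d1 d2); first by rewrite lt_min d10.
move=> s sab; rewrite lt_min => /andP[/Hd1 h1 /Hd2 h2].
apply: (le_trans (cmod_ReIm _)).
move: h1 h2; rewrite !subrK E1 E2 kid//.
case: (g t) => x y /=; rewrite !mul0r subr0 addr0; lra.
Qed.

End RealPrimitives.

Section ComplexDiff.
Context {R : realType}.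
Local Notation C := R[i].
Implicit Types (z w l k : C) (f g : C -> C).

(** Continuity and differentiability in terms of the real modulus: the norm of R[i] takes values in
    R[i], whereas real inequalities can be left to [lra]. [ccontP] and [cdiff_is_derive] are the
    dictionary. *)
Definition ccont f z := forall e : R, 0 < e ->
  exists2 d : R, 0 < d & forall w, cmod (w - z) < d -> cmod (f w - f z) <= e.

Definition cdiff f z l := forall e : R, 0 < e ->
  exists2 d : R, 0 < d & forall w, cmod (w - z) < d ->
    cmod (f w - f z - (w - z) * l) <= e * cmod (w - z).

Lemma gt0_complex (e : C) : 0 < e -> e = (complex.Re e)%:C /\ 0 < complex.Re e.
Proof. by case: e => a b; rewrite ltcE /= => /andP[/eqP -> ?]. Qed.

Lemma nbhs_cmod z (P : set C) :
  nbhs z P <-> exists2 d : R, 0 < d & forall w, cmod (w - z) < d -> P w.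
Proof.
split.
  move=> /nbhs_ballP [e /= e0 H]; have [ee e0'] := gt0_complex e0.
  exists (complex.Re e) => // w wz; apply: H; rewrite -ball_normE /=.
  by rewrite ee normcmodE ltcR cmodC.
move=> [d d0 H]; apply/nbhs_ballP; exists d%:C; first by rewrite /= ltcR.
by move=> w; rewrite -ball_normE /= normcmodE ltcR cmodC; exact: H.
Qed.

Lemma ccontP f z : ccont f z <-> {for z, continuous f}.
Proof.
split=> [cf|cf].
  apply/(@cvgrPdist_le C C C (nbhs z) _ f (f z)) => e e0.
  have [-> e0'] := gt0_complex e0.
  have [d d0 H] := cf _ e0'; apply/nbhs_cmod; exists d => // w /H.
  by rewrite normcmodE lecR cmodC.
move=> e e0; have /(@cvgrPdist_le C C C (nbhs z) _ f (f z)) /(_ e%:C) := cf.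
rewrite ltcR => /(_ e0) /nbhs_cmod[d d0 H].
by exists d => // w /H; rewrite normcmodE lecR cmodC.
Qed.

Lemma cdiff_is_derive f z l : cdiff f z l <-> is_derive z 1 f l.
Proof.
split=> [df|[df <-]].
  apply: eps_derivable => e e0; have [-> e0'] := gt0_complex e0.
  have [d d0 H] := df _ e0'; exists d%:C; first by rewrite ltcR.
  move=> h; rewrite !normcmodE ltcR => hd; have := H (h + z).
  by rewrite addrK => /(_ hd); rewrite -rmorphM /= lecR.
move=> e e0; have := @derivable_eps _ f z df e%:C; rewrite ltcR => /(_ e0)[d d0 H].
have [ed d0'] := gt0_complex d0; exists (complex.Re d) => // w wz.
have := H (w - z); rewrite subrK !normcmodE ed ltcR => /(_ wz).
by rewrite -rmorphM /= lecR.
Qed.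

(** Caratheodory's criterion. It reduces the rules for sums, products, inverses and compositions to
    those for continuous functions. *)
Lemma cdiff_factor f z l : cdiff f z l <->
  exists q : C -> C, [/\ ccont q z, q z = l & forall w, f w = f z + (w - z) * q w].
Proof.
split=> [df|[q [cq ql fE]]].
  exists (fun w => if w == z then l else (f w - f z) / (w - z)); split.
  - move=> e e0; have [d d0 H] := df _ e0; exists d => // w /H; rewrite eqxx.
    have [->|wz] := eqVneq w z; first by move=> _ /=; rewrite subrr cmod0 ltW.
    have wz0 : w - z != 0 by rewrite subr_eq0.
    rewrite -ler_pdivrMr ?cmod_gt0// -cmod_div.
    by rewrite mulrBl (mulrC (w - z) l) mulfK.
  - by rewrite eqxx.
  - move=> w; have [->|wz] := eqVneq w z; first by rewrite subrr mul0r addr0.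
    by rewrite mulrC divfK ?subr_eq0// addrC subrK.
move=> e e0; have [d d0 H] := cq _ e0; exists d => // w /H; rewrite ql => h.
rewrite fE (_ : _ - _ - _ = (q w - l) * (w - z)); last by ring.
by rewrite cmodM ler_wpM2r ?cmod_ge0.
Qed.

Lemma ccont_cst k z : ccont (fun=> k) z.
Proof. by move=> e e0; exists 1 => // w _; rewrite subrr cmod0 ltW. Qed.
Lemma ccont_id z : ccont id z.
Proof. by move=> e e0; exists e => // w /ltW. Qed.
Lemma ccontD f g z : ccont f z -> ccont g z -> ccont (fun w => f w + g w) z.
Proof.
move=> cf cg e e0; have e20 : 0 < e / 2 by lra.
have [d1 d10 H1] := cf _ e20; have [d2 d20 H2] := cg _ e20.
exists (Num.min d1 d2); first by rewrite lt_min d10.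
move=> w; rewrite lt_min => /andP[/H1 h1 /H2 h2].
rewrite (_ : _ - _ = (f w - f z) + (g w - g z)); last by ring.
by apply: le_trans (cmodD _ _) _; lra.
Qed.
Lemma ccontM f g z : ccont f z -> ccont g z -> ccont (fun w => f w * g w) z.
Proof.
move=> cf cg e e0; pose A := cmod (f z) + 1; pose B := cmod (g z) + 1.
have A0 : 0 < A by have := cmod_ge0 (f z); rewrite /A; lra.
have B0 : 0 < B by have := cmod_ge0 (g z); rewrite /B; lra.
have eA : 0 < e / 2 / A by rewrite !divr_gt0.
have eB : 0 < e / 2 / B by rewrite !divr_gt0.
have [d1 d10 H1] := cf _ eB; have [d2 d20 H2] := cg _ eA; have [d3 d30 H3] := cg _ ltr01.
exists (Num.min d1 (Num.min d2 d3)); first by rewrite !lt_min d10 d20.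
move=> w; rewrite !lt_min => /and3P[/H1 h1 /H2 h2 /H3 h3].
have gB : cmod (g w) <= B by have := cmod_rtri (g w) (g z); rewrite /B; lra.
rewrite (_ : _ - _ = (f w - f z) * g w + f z * (g w - g z)); last by ring.
apply: le_trans (cmodD _ _) _; rewrite !cmodM (splitr e); apply: lerD.
  apply: le_trans (ler_pM (cmod_ge0 _) (cmod_ge0 _) h1 gB) _.
  by rewrite divfK ?gt_eqF.
have fA : cmod (f z) <= A by rewrite /A; lra.
apply: le_trans (ler_pM (cmod_ge0 _) (cmod_ge0 _) fA h2) _.
by rewrite mulrC divfK ?gt_eqF.
Qed.
Lemma ccont_neq0 f z : f z != 0 -> ccont f z -> exists2 d : R, 0 < d &
  forall w, cmod (w - z) < d -> cmod (f z) / 2 <= cmod (f w) /\ f w != 0.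
Proof.
move=> f0 cf; have [|d d0 H] := cf (cmod (f z) / 2); first by rewrite divr_gt0 ?cmod_gt0 ?ltr0n.
exists d => // w /H h; have := cmod_rtri (f z) (f w); rewrite cmodC => h2.
have h3 : cmod (f z) / 2 <= cmod (f w) by lra.
by split=> //; rewrite -cmod_gt0; move: f0; rewrite -cmod_gt0; lra.
Qed.
Lemma ccontV f z : f z != 0 -> ccont f z -> ccont (fun w => (f w)^-1) z.
Proof.
move=> f0 cf e e0; have [d1 d10 H1] := ccont_neq0 f0 cf.
have fz0 : 0 < cmod (f z) by rewrite cmod_gt0.
have [|d2 d20 H2] := cf (e * (cmod (f z) / 2 * cmod (f z))).
  by rewrite !mulr_gt0 ?invr_gt0 ?ltr0n.
exists (Num.min d1 d2); first by rewrite lt_min d10.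
move=> w; rewrite lt_min => /andP[/H1[h1 fw] /H2 h2].
rewrite (_ : _ - _ = (f z - f w) / (f w * f z)); last by field; rewrite ?f0 ?fw.
rewrite cmod_div ler_pdivrMr ?cmod_gt0 ?mulf_neq0// cmodC.
apply: le_trans h2 _; apply: ler_wpM2l; first exact: ltW.
by rewrite cmodM ler_pM2r.
Qed.
Lemma ccont_comp f g z : ccont f z -> ccont g (f z) -> ccont (fun w => g (f w)) z.
Proof.
move=> cf cg e e0; have [d1 d10 H1] := cg _ e0.
have [|d d0 H] := cf (d1 / 2); first by lra.
by exists d => // w /H h; apply: H1; lra.
Qed.

Lemma ccont_near f g z : (exists2 d : R, 0 < d & forall w, cmod (w - z) < d -> f w = g w) ->
  ccont f z -> ccont g z.
Proof.
move=> [d d0 fg] cf e e0; have [d' d'0 H] := cf _ e0.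
exists (Num.min d d'); first by rewrite lt_min d0.
move=> w; rewrite lt_min => /andP[/fg <- /H].
by have := fg z; rewrite subrr cmod0 => ->.
Qed.

Lemma cdiff_near f g z l : (exists2 d : R, 0 < d & forall w, cmod (w - z) < d -> f w = g w) ->
  cdiff f z l -> cdiff g z l.
Proof.
move=> [d d0 fg] cf e e0; have [d' d'0 H] := cf _ e0.
exists (Num.min d d'); first by rewrite lt_min d0.
move=> w; rewrite lt_min => /andP[/fg <- /H].
by have := fg z; rewrite subrr cmod0 => ->.
Qed.

Lemma cdiff_ext f g z l : f =1 g -> cdiff f z l -> cdiff g z l.
Proof. by move=> fg; apply: cdiff_near; exists 1. Qed.

Lemma cdiff_ccont f z l : cdiff f z l -> ccont f z.
Proof.
move=> /cdiff_factor[q [cq _ fE]].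
apply: (@ccont_near (fun w => f z + (w + - z) * q w)); first by exists 1.
apply: ccontD; first exact: ccont_cst.
by apply: ccontM => //; apply: ccontD; [exact: ccont_id|exact: ccont_cst].
Qed.

Lemma cdiff_cst k z : cdiff (fun=> k) z 0.
Proof. by apply/cdiff_factor; exists (fun=> 0); split=> // [|w]; [exact: ccont_cst|ring]. Qed.
Lemma cdiff_id z : cdiff id z 1.
Proof. by apply/cdiff_factor; exists (fun=> 1); split=> // [|w]; [exact: ccont_cst|ring]. Qed.
Lemma cdiffD f g z l k : cdiff f z l -> cdiff g z k -> cdiff (fun w => f w + g w) z (l + k).
Proof.
move=> /cdiff_factor[p [cp <- fE]] /cdiff_factor[q [cq <- gE]]; apply/cdiff_factor.
exists (fun w => p w + q w); split=> //; first exact: ccontD.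
by move=> w; rewrite [in LHS]fE [in LHS]gE; ring.
Qed.
Lemma cdiffM f g z l k : cdiff f z l -> cdiff g z k ->
  cdiff (fun w => f w * g w) z (l * g z + f z * k).
Proof.
move=> df dg; have cg := cdiff_ccont dg; move: df dg.
move=> /cdiff_factor[p [cp <- fE]] /cdiff_factor[q [cq <- gE]]; apply/cdiff_factor.
exists (fun w => p w * g w + f z * q w); split=> //.
  by apply: ccontD; apply: ccontM => //; exact: ccont_cst.
by move=> w; rewrite [in LHS]fE [in LHS]gE [in RHS](gE w); ring.
Qed.
Lemma cdiffZ f z l k : cdiff f z l -> cdiff (fun w => k * f w) z (k * l).
Proof. by move=> df; have := cdiffM (cdiff_cst k z) df; rewrite mul0r add0r. Qed.
Lemma cdiffN f z l : cdiff f z l -> cdiff (fun w => - f w) z (- l).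
Proof.
by move=> /(cdiffZ (-1)); rewrite mulN1r; apply: cdiff_ext => w; rewrite mulN1r.
Qed.
Lemma cdiffB f g z l k : cdiff f z l -> cdiff g z k -> cdiff (fun w => f w - g w) z (l - k).
Proof. by move=> df dg; exact: cdiffD df (cdiffN dg). Qed.
Lemma cdiffV f z l : f z != 0 -> cdiff f z l ->
  cdiff (fun w => (f w)^-1) z (- l / (f z) ^+ 2).
Proof.
move=> f0 df; have cf := cdiff_ccont df; move: df.
move=> /cdiff_factor[p [cp <- fE]].
have [d d0 Hd] := ccont_neq0 f0 cf.
apply: (@cdiff_near (fun w => (f z)^-1 + (w - z) * (- p w * ((f w)^-1 * (f z)^-1)))).
  exists d => // w /Hd[_ fw].
  have E : (w - z) * p w = f w - f z by rewrite [in RHS]fE; ring.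
  by rewrite mulNr mulrN mulrA E; field; rewrite ?f0 ?fw.
apply/cdiff_factor; exists (fun w => - p w * ((f w)^-1 * (f z)^-1)); split=> //.
- apply: ccontM; last by apply: ccontM; [exact: ccontV|exact: ccont_cst].
  apply: (@ccont_near (fun w => -1 * p w)); first by exists 1 => // w _; rewrite mulN1r.
  by apply: ccontM => //; exact: ccont_cst.
- by rewrite expr2 invfM.
- by move=> w; rewrite subrr mul0r addr0.
Qed.
Lemma cdiff_comp f g z l k : cdiff f z l -> cdiff g (f z) k ->
  cdiff (fun w => g (f w)) z (k * l).
Proof.
move=> df dg; have cf := cdiff_ccont df; move: df dg.
move=> /cdiff_factor[p [cp <- fE]] /cdiff_factor[q [cq <- gE]]; apply/cdiff_factor.
exists (fun w => q (f w) * p w); split=> //.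
  by apply: ccontM => //; exact: ccont_comp.
by move=> w; rewrite gE; congr (_ + _); rewrite {1}fE; ring.
Qed.
Lemma cdiffXn z n : cdiff (fun w => w ^+ n.+1) z (n.+1%:R * z ^+ n).
Proof.
elim: n => [|n IH]; first by rewrite expr0 mulr1; exact: cdiff_id.
have := cdiffM (cdiff_id z) IH; rewrite mul1r.
rewrite (_ : _ + _ = n.+2%:R * z ^+ n.+1); last by rewrite [z ^+ n.+1]exprS -!nat1r; ring.
by apply: cdiff_ext => w; rewrite [RHS]exprS.
Qed.
Lemma cdiff_affine z (p q : C) : cdiff (fun w => p + q * w) z q.
Proof.
by have := cdiffD (cdiff_cst p z) (cdiffZ q (cdiff_id z)); rewrite add0r mulr1.
Qed.

End ComplexDiff.

(** * Line integrals and Taylor expansion *)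

Section LineIntegral.
Context {R : realType}.
Local Notation C := R[i].
Implicit Types (a b c d t s : R) (f g : R -> C).

(* Junk value 0 when g has no primitive on [a, b]. *)
Definition cint a b g : C :=
  xget 0 [set v | exists F, isprim a b g F /\ v = F b - F a].

Lemma cintE a b g F : a <= b -> isprim a b g F -> cint a b g = F b - F a.
Proof.
move=> ab p; rewrite /cint; case: xgetP => [v -> [G [pG ->]]|/(_ (F b - F a))].
  exact: prim_unique ab pG p.
by case; exists F.
Qed.

Lemma rcont_prim a b g : a <= b -> rcont a b g ->
  exists2 F, isprim a b g F & cint a b g = F b - F a.
Proof.
by move=> ab cg; have [F p] := prim_exists ab cg; exists F => //; exact: cintE.
Qed.

Lemma cint_bound a b g M : a <= b -> rcont a b g ->
  (forall t, a <= t <= b -> cmod (g t) <= M) -> cmod (cint a b g) <= M * (b - a).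
Proof. by move=> ab cg; have [F p ->] := rcont_prim ab cg; exact: prim_bound. Qed.

Lemma cintD a b f g : a <= b -> rcont a b f -> rcont a b g ->
  cint a b (fun t => f t + g t) = cint a b f + cint a b g.
Proof.
move=> ab cf cg; have [F p ->] := rcont_prim ab cf; have [G q ->] := rcont_prim ab cg.
by rewrite (cintE ab (primD p q)); ring.
Qed.

Lemma cintZ a b g k : a <= b -> rcont a b g ->
  cint a b (fun t => k * g t) = k * cint a b g.
Proof.
by move=> ab cg; have [G q ->] := rcont_prim ab cg; rewrite (cintE ab (primZ k q)); ring.
Qed.

Lemma eq_cint a b f g : a <= b -> rcont a b f ->
  (forall t, a <= t <= b -> f t = g t) -> cint a b f = cint a b g.
Proof.
move=> ab cf fg; have [F p ->] := rcont_prim ab cf.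
by rewrite (@cintE a b g F)//; apply: prim_eq p.
Qed.

Lemma cint_cat a b c f : a <= c <= b -> rcont a b f ->
  cint a b f = cint a c f + cint c b f.
Proof.
move=> /andP[ac cb] cf; have ab := le_trans ac cb.
have [F p ->] := rcont_prim ab cf.
rewrite (@cintE a c f F)//; last exact: prim_sub p.
by rewrite (@cintE c b f F)//; [ring|exact: prim_sub p].
Qed.

End LineIntegral.

Section Paths.
Context {R : realType}.
Local Notation C := R[i].
Implicit Types (a b c d t s : R) (z v w : C) (f g F : C -> C).

Lemma ccont_line a b z v f :
  (forall t, a <= t <= b -> ccont f (z + t%:C * v)) ->
  rcont a b (fun t => f (z + t%:C * v)).
Proof.
move=> cf t tab e e0; have [d d0 H] := cf t tab e e0.
have v0 : 0 < cmod v + 1 by have := cmod_ge0 v; lra.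
exists (d / (cmod v + 1)); first by rewrite divr_gt0.
move=> s sab; rewrite ltr_pdivlMr// => st; apply: H.
rewrite (_ : _ - _ = (s - t)%:C * v); last by rewrite rmorphB /=; ring.
rewrite cmodM cmodR; apply: le_lt_trans st; apply: ler_wpM2l => //; lra.
Qed.

Lemma prim_line a b z v F g :
  (forall t, a <= t <= b -> cdiff F (z + t%:C * v) (g (z + t%:C * v))) ->
  isprim a b (fun t => v * g (z + t%:C * v)) (fun t => F (z + t%:C * v)).
Proof.
move=> dF t tab e e0.
have v0 : 0 < cmod v + 1 by have := cmod_ge0 v; lra.
have [d d0 H] := dF t tab _ (divr_gt0 e0 v0).
exists (d / (cmod v + 1)); first by rewrite divr_gt0.
move=> s sab; rewrite ltr_pdivlMr// => st; have := H (z + s%:C * v).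
rewrite (_ : (_ + _) - (_ + _) = (s - t)%:C * v); last by rewrite rmorphB /=; ring.
rewrite cmodM cmodR => /(_ _) H2.
rewrite mulrA; apply: le_trans (H2 _) _.
  by apply: le_lt_trans st; apply: ler_wpM2l => //; lra.
rewrite mulrCA mulrC; apply: ler_wpM2r => //.
by rewrite -mulrA ler_piMr ?(ltW e0)// mulrC ler_pdivrMr//; lra.
Qed.

Lemma mean_value_seg z w F (g : C -> C) M :
  (forall t : R, 0 <= t <= 1 ->
    cdiff F (z + t%:C * (w - z)) (g (z + t%:C * (w - z))) /\
    cmod (g (z + t%:C * (w - z))) <= M) ->
  cmod (F w - F z) <= M * cmod (w - z).
Proof.
move=> H; have := @prim_line 0 1 z (w - z) F g (fun t t01 => (H t t01).1).
move=> /(@prim_bound R 0 1 _ _ (M * cmod (w - z)) ler01) HH.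
have := HH _; rewrite subr0 mulr1 mul1r mul0r addr0 addrCA subrr addr0; apply.
move=> t t01; rewrite cmodM mulrC; apply: ler_wpM2r; [exact: cmod_ge0|exact: (H t t01).2].
Qed.

End Paths.

(** * Integrals along the boundary of a rectangle *)

Section Rectangles.
Context {R : realType}.
Local Notation C := R[i].
Implicit Types (a b c d t s x y : R) (z w : C) (f g F : C -> C).

(** Sides are parametrised as base point plus real parameter times direction, the form of
    [ccont_line] and [prim_line]. The factor 'i of dz on vertical sides is supplied by [rint]. *)
Definition hseg f c a b : C := cint a b (fun x => f ('i%C * c%:C + x%:C * 1)).
Definition vseg f a c d : C := cint c d (fun y => f (a%:C + y%:C * 'i%C)).
(* Counterclockwise along the boundary of [a, b] x [c, d]. *)
Definition rint f a b c d : C :=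
  hseg f c a b + 'i%C * vseg f b c d - hseg f d a b - 'i%C * vseg f a c d.

Definition rect a b c d : set C :=
  [set z | a <= complex.Re z <= b /\ c <= complex.Im z <= d].

Lemma ReIm_h x y : complex.Re ('i%C * y%:C + x%:C * 1) = x /\ complex.Im ('i%C * y%:C + x%:C * 1) = y.
Proof. by rewrite /=; split; ring. Qed.
Lemma ReIm_v x y : complex.Re (x%:C + y%:C * 'i%C) = x /\ complex.Im (x%:C + y%:C * 'i%C) = y.
Proof. by rewrite /=; split; ring. Qed.

Lemma rect_h a b c d x y : a <= x <= b -> c <= y <= d ->
  rect a b c d ('i%C * y%:C + x%:C * 1).
Proof. by move=> hx hy; have [E1 E2] := ReIm_h x y; split; rewrite ?E1 ?E2. Qed.
Lemma rect_v a b c d x y : a <= x <= b -> c <= y <= d ->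
  rect a b c d (x%:C + y%:C * 'i%C).
Proof. by move=> hx hy; have [E1 E2] := ReIm_v x y; split; rewrite ?E1 ?E2. Qed.

Lemma rect_split_x a b c d f m : a <= m <= b -> c <= d ->
  (forall z, rect a b c d z -> ccont f z) ->
  rint f a b c d = rint f a m c d + rint f m b c d.
Proof.
move=> /[dup] amb /andP[am mb] cd cf; rewrite /rint.
have E y : c <= y <= d -> hseg f y a b = hseg f y a m + hseg f y m b.
  move=> ycd; apply: cint_cat => //; apply: ccont_line => t tab.
  by apply: cf; exact: rect_h.
by rewrite !E ?lexx ?cd//; ring.
Qed.

Lemma rect_split_y a b c d f m : a <= b -> c <= m <= d ->
  (forall z, rect a b c d z -> ccont f z) ->
  rint f a b c d = rint f a b c m + rint f a b m d.
Proof.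
move=> ab /[dup] cmd /andP[cm md] cf; rewrite /rint.
have E x : a <= x <= b -> vseg f x c d = vseg f x c m + vseg f x m d.
  move=> xab; apply: cint_cat => //; apply: ccont_line => t tab.
  by apply: cf; exact: rect_v.
by rewrite !E ?lexx ?ab//; ring.
Qed.

(** Bounds and linearity ask for continuity here only, which allows integrands with a pole inside
    the rectangle. *)
Definition frame a b c d : set C := [set z | rect a b c d z /\
  [\/ complex.Re z = a, complex.Re z = b, complex.Im z = c | complex.Im z = d]].

Lemma frame_h a b c d x y : a <= x <= b -> c <= d -> y = c \/ y = d ->
  frame a b c d ('i%C * y%:C + x%:C * 1).
Proof.
move=> xab cd yE; split; first by apply: rect_h => //; case: yE => ->; rewrite lexx cd.
by have [_ ->] := ReIm_h x y; case: yE => ->; [apply: Or43|apply: Or44].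
Qed.
Lemma frame_v a b c d x y : c <= y <= d -> a <= b -> x = a \/ x = b ->
  frame a b c d (x%:C + y%:C * 'i%C).
Proof.
move=> ycd ab xE; split; first by apply: rect_v => //; case: xE => ->; rewrite lexx ab.
by have [-> _] := ReIm_v x y; case: xE => ->; [apply: Or41|apply: Or42].
Qed.

Section Frame.
Variables (a b c d : R) (f : C -> C).
Hypotheses (ab : a <= b) (cd : c <= d) (cf : forall z, frame a b c d z -> ccont f z).

Lemma rcont_h y : y = c \/ y = d -> rcont a b (fun x => f ('i%C * y%:C + x%:C * 1)).
Proof. by move=> yE; apply: ccont_line => t tab; apply: cf; exact: frame_h. Qed.
Lemma rcont_v x : x = a \/ x = b -> rcont c d (fun y => f (x%:C + y%:C * 'i%C)).
Proof. by move=> xE; apply: ccont_line => t tcd; apply: cf; exact: frame_v. Qed.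

Lemma rint_prim F : (forall z, frame a b c d z -> cdiff F z (f z)) -> rint f a b c d = 0.
Proof.
move=> dF; rewrite /rint.
have H y : y = c \/ y = d -> hseg f y a b = F ('i%C * y%:C + b%:C * 1) - F ('i%C * y%:C + a%:C * 1).
  move=> yE; apply: (@cintE _ a b _ (fun t => F ('i%C * y%:C + t%:C * 1)) ab).
  apply: prim_eq (prim_line _) => //.
    by move=> t _; rewrite mul1r.
  by move=> t tab; apply: dF; exact: frame_h.
have V x : x = a \/ x = b -> 'i%C * vseg f x c d = F (x%:C + d%:C * 'i%C) - F (x%:C + c%:C * 'i%C).
  move=> xE; rewrite /vseg -cintZ//; last exact: rcont_v.
  apply: (@cintE _ c d _ (fun t => F (x%:C + t%:C * 'i%C)) cd).
  by apply: prim_line => t tcd; apply: dF; exact: frame_v.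
rewrite !H ?V; auto.
have E (x y : R) : 'i%C * y%:C + x%:C * 1 = x%:C + y%:C * 'i%C :> C by ring.
by rewrite !E; ring.
Qed.

Lemma rintZ (k : C) : rint (fun z => k * f z) a b c d = k * rint f a b c d.
Proof.
rewrite /rint /hseg /vseg !cintZ//; try (apply: rcont_h); try (apply: rcont_v); auto.
ring.
Qed.

Lemma eq_rint g : (forall z, frame a b c d z -> f z = g z) ->
  rint f a b c d = rint g a b c d.
Proof.
move=> fg; rewrite /rint.
have H y : y = c \/ y = d -> hseg f y a b = hseg g y a b.
  move=> yE; apply: eq_cint => //; first exact: rcont_h.
  by move=> t tab; apply: fg; exact: frame_h.
have V x : x = a \/ x = b -> vseg f x c d = vseg g x c d.
  move=> xE; apply: eq_cint => //; first exact: rcont_v.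
  by move=> t tab; apply: fg; exact: frame_v.
by rewrite !H ?V; auto.
Qed.

Lemma rint_bound (M : R) : (forall z, frame a b c d z -> cmod (f z) <= M) ->
  cmod (rint f a b c d) <= M * (2 * ((b - a) + (d - c))).
Proof.
move=> fM; rewrite /rint.
have H y : y = c \/ y = d -> cmod (hseg f y a b) <= M * (b - a).
  move=> yE; apply: cint_bound => //; first exact: rcont_h.
  by move=> t tab; apply: fM; exact: frame_h.
have V x : x = a \/ x = b -> cmod (vseg f x c d) <= M * (d - c).
  move=> xE; apply: cint_bound => //; first exact: rcont_v.
  by move=> t tab; apply: fM; exact: frame_v.
have h1 : cmod (hseg f c a b) <= M * (b - a) by apply: H; auto.
have h2 : cmod (hseg f d a b) <= M * (b - a) by apply: H; auto.
have h3 : cmod (vseg f a c d) <= M * (d - c) by apply: V; auto.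
have h4 : cmod (vseg f b c d) <= M * (d - c) by apply: V; auto.
apply: le_trans (cmodB _ _) _; rewrite cmodM cmodI mul1r.
have := cmodB (hseg f c a b + 'i%C * vseg f b c d) (hseg f d a b).
have := cmodD (hseg f c a b) ('i%C * vseg f b c d).
by rewrite cmodM cmodI mul1r; lra.
Qed.
End Frame.

Lemma rintD a b c d f g : a <= b -> c <= d ->
  (forall z, frame a b c d z -> ccont f z) -> (forall z, frame a b c d z -> ccont g z) ->
  rint (fun z => f z + g z) a b c d = rint f a b c d + rint g a b c d.
Proof.
move=> ab cd cf cg; rewrite /rint /hseg /vseg.
have hh y yE := cintD ab (rcont_h cd cf (y := y) yE) (rcont_h cd cg yE).
have vv x xE := cintD cd (rcont_v ab cf (x := x) xE) (rcont_v ab cg xE).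
rewrite (hh c (or_introl erefl)) (hh d (or_intror erefl)).
rewrite (vv a (or_introl erefl)) (vv b (or_intror erefl)).
ring.
Qed.

Lemma cint_near a b (g : R -> C) (k : C) (M : R) : a <= b -> rcont a b g ->
  (forall t, a <= t <= b -> cmod (g t - k) <= M) ->
  cmod (cint a b g - (b - a)%:C * k) <= M * (b - a).
Proof.
move=> ab cg gM.
have pk : isprim a b (fun=> - k) (fun t : R => t%:C * - k).
  move=> t _ e e0; exists 1 => // s _ _.
  rewrite rmorphB /= -mulrBl subrr cmod0.
  by rewrite mulr_ge0 // ltW.
have [F pF E] := rcont_prim ab cg.
have := prim_bound ab (primD pF pk) gM.
by rewrite E rmorphB /=; congr (cmod _ <= _); ring.
Qed.

End Rectangles.

(** * Goursat's theorem *)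

Section Goursat.
Context {R : realType}.
Local Notation C := R[i].
Implicit Types (a b c d t s x y : R) (z w : C) (f g F : C -> C).

Lemma half_pow_lt (L e : R) : 0 < e -> exists n, L * 2^-1 ^+ n < e.
Proof.
move=> e0; have [n Hn] : exists n : nat, L / e < n%:R.
  by exists (Num.trunc `|L / e|).+1; apply: le_lt_trans (ler_norm _) (Num.Theory.truncnS_gt _).
exists n; rewrite exprVn ltr_pdivrMr ?exprn_gt0//.
move: Hn; rewrite ltr_pdivrMr// => Hn; apply: lt_le_trans Hn _.
by rewrite mulrC ler_pM2l// -natrX ler_nat ltnW// ltn_expl.
Qed.

Definition subrect (r r' : R * R * R * R) := let '(a, b, c, d) := r in let '(a', b', c', d') := r' in
  [/\ a <= a', a' <= b', b' <= b & [/\ c <= c', c' <= d' & d' <= d]].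

Lemma subrect_trans r1 r2 r3 : subrect r1 r2 -> subrect r2 r3 -> subrect r1 r3.
Proof.
case: r1 r2 r3 => [[[? ?] ?] ?] [[[? ?] ?] ?] [[[? ?] ?] ?].
by move=> [? ? ? [? ? ?]] [? ? ? [? ? ?]]; split; [lra..|split; lra].
Qed.

Lemma subrect_rect r a b c d z : subrect r (a, b, c, d) -> rect a b c d z ->
  let '(p, q, u, v) := r in rect p q u v z.
Proof.
case: r => [[[p q] u] v] [? ? ? [? ? ?]] [/andP[? ?] /andP[? ?]].
by split; apply/andP; split; lra.
Qed.

(** Bisection. A rectangle is bad if its integral exceeds e times the square of its half perimeter.
    One of the quarters of a bad rectangle is bad, since the four squares add up to the original
    one. At the common point of the nested rectangles, differentiability contradicts badness. *)
Lemma goursat a b c d f : a <= b -> c <= d ->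
  (forall z, rect a b c d z -> exists l, cdiff f z l) -> rint f a b c d = 0.
Proof.
move=> ab cd df.
have cf z : rect a b c d z -> ccont f z by move=> /df[l]; exact: cdiff_ccont.
apply/eqP; rewrite -cmod_eq0 eq_le cmod_ge0 andbT; apply/negPn/negP; rewrite -ltNge => I0.
pose L := (b - a) + (d - c) + 1.
have L0 : 0 < L by rewrite /L; lra.
(* With this e the initial rectangle is bad; the 1 in L keeps the division safe for degenerate
   rectangles. *)
pose e := cmod (rint f a b c d) / 2 / L ^+ 2.
have e0 : 0 < e by rewrite /e !divr_gt0// ?exprn_gt0.
pose per (r : R * R * R * R) := let '(a, b, c, d) := r in (b - a) + (d - c).
pose sub := subrect.
pose bad (r : R * R * R * R) := e * (per r) ^+ 2 < cmod (let '(a, b, c, d) := r in rint f a b c d).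
pose r0 := (a, b, c, d).
pose good r := sub r0 r /\ bad r.
(* The guard makes the relation total, as dependent choice requires. *)
pose rel r r' := good r -> [/\ good r', sub r r' & per r' = per r / 2].
have step r : exists r', rel r r'.
  have [gr|ngr] := pselect (good r); last by exists r.
  move: r gr => [[[p q] u] v] [/[dup] S0 [ap pq qb [cu uv vd]] br].
  have cf' z : rect p q u v z -> ccont f z.
    by move=> /(subrect_rect S0); exact: cf.
  pose m := (p + q) / 2; pose n := (u + v) / 2.
  have pm : p <= m <= q by rewrite /m; lra.
  have un : u <= n <= v by rewrite /n; lra.
  have [pm' mq'] := andP pm; have [un' nv'] := andP un.
  have S : rint f p q u v = (rint f p m u n + rint f p m n v) + (rint f m q u n + rint f m q n v).
    rewrite (rect_split_x pm uv cf'); congr (_ + _); apply: rect_split_y => //.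
      by move=> z [/andP[? ?] ?]; apply: cf'; split=> //; apply/andP; split; lra.
    by move=> z [/andP[? ?] ?]; apply: cf'; split=> //; apply/andP; split; lra.
  have [//|nex] := pselect (exists r', rel (p, q, u, v) r').
  have small p' q' u' v' : p <= p' -> p' <= q' -> q' <= q -> u <= u' -> u' <= v' -> v' <= v ->
      q' - p' = (q - p) / 2 -> v' - u' = (v - u) / 2 ->
      cmod (rint f p' q' u' v') <= e * (((q - p) + (v - u)) / 2) ^+ 2.
    move=> pp pq' qq uu uv' vv E1 E2; rewrite leNgt; apply/negP => B; apply: nex; exists (p', q', u', v') => _.
    have E : per (p', q', u', v') = per (p, q, u, v) / 2 by rewrite /per E1 E2; clear; lra.
    split=> //; split; first by apply: subrect_trans S0 _; split=> //; split.
    by rewrite /bad E.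
  pose T := e * (((q - p) + (v - u)) / 2) ^+ 2.
  exfalso; have h1 : cmod (rint f p m u n) <= T by apply: small; rewrite /m /n; clear -pq uv; lra.
  have h2 : cmod (rint f p m n v) <= T by apply: small; rewrite /m /n; clear -pq uv; lra.
  have h3 : cmod (rint f m q u n) <= T by apply: small; rewrite /m /n; clear -pq uv; lra.
  have h4 : cmod (rint f m q n v) <= T by apply: small; rewrite /m /n; clear -pq uv; lra.
  move: br; rewrite /bad S /per.
  have := cmodD (rint f p m u n + rint f p m n v) (rint f m q u n + rint f m q n v).
  have := cmodD (rint f p m u n) (rint f p m n v).
  have := cmodD (rint f m q u n) (rint f m q n v).
  move: h1 h2 h3 h4; rewrite /T exprMn; set X := (_ ^+ 2); rewrite exprVn.
  by rewrite (_ : (2 : R) ^+ 2 = 4) ?expr2; [lra|ring].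
have [|h [h0 hS]] := @dependent_choice _ rel _ r0; first by move=> r; apply: cid; exact: step.
have gh n : good (h n).
  elim: n => [|n /(hS n)[]//]; rewrite h0; split; first by split=> //; split.
  rewrite /bad /= /e mulrAC ltr_pdivrMr ?exprn_gt0//.
  rewrite -mulrA ltr_pM2l// mulrC.
  have : (b - a + (d - c)) ^+ 2 <= L ^+ 2.
    rewrite ler_pXn2r ?nnegrE /L//; lra.
  have : 0 < L ^+ 2 by rewrite exprn_gt0.
  lra.
pose pa n := (h n).1.1.1; pose pb n := (h n).1.1.2; pose pc n := (h n).1.2; pose pd n := (h n).2.
have hE n : h n = (pa n, pb n, pc n, pd n) by rewrite /pa /pb /pc /pd; case: (h n) => [[[]]].
have hsub n : sub (h n) (h n.+1) by have [] := hS n (gh n).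
have mono n k : sub (h n) (h (n + k)%N).
  elim: k => [|k IH]; first by rewrite addn0; have [+ _] := gh n; rewrite hE => -[? ? ? [? ? ?]]; do 2?split.
  by rewrite addnS; exact: subrect_trans IH (hsub _).
have cross n m : pa n <= pb m /\ pc n <= pd m.
  have := mono n m; have := mono m n; rewrite (addnC m n) !hE => -[? ? ? [? ? ?]] [? ? ? [? ? ?]].
  by split; lra.
pose X := sup (range pa); pose Y := sup (range pc).
have supX n : pa n <= X <= pb n.
  apply/andP; split; last by apply: ge_sup; [exists (pa 0), 0|move=> _ [m _ <-]; exact: (cross m n).1].
  by apply: ub_le_sup; [exists (pb 0) => _ [m _ <-]; exact: (cross m 0).1|exists n].
have supY n : pc n <= Y <= pd n.
  apply/andP; split; last by apply: ge_sup; [exists (pc 0), 0|move=> _ [m _ <-]; exact: (cross m n).2].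
  by apply: ub_le_sup; [exists (pd 0) => _ [m _ <-]; exact: (cross m 0).2|exists n].
have [l dl] : exists l, cdiff f (X +i* Y) l.
  apply: df; split=> /=; have := supX 0; have := supY 0; rewrite /pa /pb /pc /pd h0//.
(* The boundary has length twice [per], so an error of e / 4 times [per] on it integrates to at most
   half of the bad threshold. *)
have e40 : 0 < e / 4 by lra.
have [r rp Hr] := dl _ e40.
have perE n : per (h n) = per r0 * 2^-1 ^+ n.
  elim: n => [|n IH]; first by rewrite h0 mulr1.
  by have [_ _ ->] := hS n (gh n); rewrite IH exprSr mulrA.
have [n Hn] := half_pow_lt (per r0) rp; rewrite -perE in Hn.
have [[_ pab _ [_ pcd _]] bd] : sub r0 (pa n, pb n, pc n, pd n) /\ bad (h n).
  by have [? ?] := gh n; rewrite -hE.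
have cfn z : rect (pa n) (pb n) (pc n) (pd n) z -> ccont f z.
  by have [+ _] := gh n; rewrite hE => S /(subrect_rect S); exact: cf.
(* The affine approximation of f at the common point has a primitive, so subtracting it leaves the
   integral unchanged. *)
pose g z := f (X +i* Y) - (X +i* Y) * l + l * z.
have cg z : ccont g z by apply: cdiff_ccont; exact: cdiff_affine.
have I0' : rint g (pa n) (pb n) (pc n) (pd n) = 0.
  pose G z := (f (X +i* Y) - (X +i* Y) * l) * z + l / 2 * z ^+ 2.
  apply: (@rint_prim _ _ _ _ _ g pab pcd (fun z _ => cg z) G) => z _.
  have := cdiffD (cdiffZ (f (X +i* Y) - (X +i* Y) * l) (cdiff_id z)) (cdiffZ (l / 2) (cdiffXn z 1)).
  by congr cdiff; rewrite /g; field.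
have cfg z : frame (pa n) (pb n) (pc n) (pd n) z -> ccont (fun z => f z + (-1) * g z) z.
  by move=> [zr _]; apply: ccontD; [exact: cfn|apply: ccontM => //; exact: ccont_cst].
have E : rint (fun z => f z + (-1) * g z) (pa n) (pb n) (pc n) (pd n) =
    rint f (pa n) (pb n) (pc n) (pd n).
  have cfn' z : frame (pa n) (pb n) (pc n) (pd n) z -> ccont f z by move=> [/cfn].
  have cg1 z : frame (pa n) (pb n) (pc n) (pd n) z -> ccont (fun z => -1 * g z) z.
    by move=> _; apply: ccontM => //; exact: ccont_cst.
  by rewrite (rintD pab pcd cfn' cg1) (rintZ pab pcd (fun z _ => cg z)) I0' mulr0 addr0.
move: bd; rewrite /bad hE -E; apply/negP; rewrite -leNgt.
have P0 : 0 <= per (h n) by rewrite hE /=; lra.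
apply: le_trans (rint_bound pab pcd cfg (M := e / 4 * per (h n)) _) _.
  move=> z [[z1 z2] _].
  have zl : cmod (z - (X +i* Y)) <= per (h n).
    apply: le_trans (cmod_ReIm _) _; rewrite hE /=; case: z z1 z2 => zx zy /= z1 z2.
    have := supX n; have := supY n; move: z1 z2.
    by clear; do 4! [move=> /andP[? ?]]; apply: lerD; rewrite ler_norml; lra.
  have := Hr z (le_lt_trans zl Hn).
  rewrite (_ : f z + -1 * g z = f z - f (X +i* Y) - (z - (X +i* Y)) * l); last by rewrite /g; ring.
  by move=> h1; apply: le_trans h1 _; rewrite ler_pM2l.
have -> : pb n - pa n + (pd n - pc n) = per (h n) by rewrite hE.
rewrite -?hE.
have : 0 <= e * per (h n) ^+ 2 by rewrite mulr_ge0 ?exprn_ge0// ltW.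
rewrite (_ : _ * (2 * _) = e * per (h n) ^+ 2 / 2); last by field.
by move: (e * _) => q q0; clear -q0; lra.
Qed.

End Goursat.

(** * Removable singularities; squares in the role of circles *)

Section CauchyFormula.
Context {R : realType}.
Local Notation C := R[i].
Implicit Types (a z w h : C) (s : R) (f g F : C -> C).

(** The rectangle can be shrunk homothetically towards w: the strips cut off avoid w and contribute
    0 by Goursat. On the shrunken frame f is bounded by continuity at w, while the length tends to
    0. *)
Lemma rint_removable (a b c d : R) w f :
  a < complex.Re w < b -> c < complex.Im w < d ->
  (forall z, rect a b c d z -> ccont f z) ->
  (forall z, rect a b c d z -> z <> w -> exists l, cdiff f z l) -> rint f a b c d = 0.
Proof.
case: w => x y /= /andP[ax xb] /andP[cy yd] cf df.
have G p q u v : a <= p -> p <= q -> q <= b -> c <= u -> u <= v -> v <= d ->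
    ~ (p <= x <= q /\ u <= y <= v) -> rint f p q u v = 0.
  move=> ap pq qb cu uv vd nw; apply: goursat => // z [zx zy].
  apply: df; last by move=> zE; apply: nw; rewrite zE /= in zx zy.
  by move: zx zy; clear -ap qb cu vd => /andP[? ?] /andP[? ?]; split; apply/andP; split; lra.
have S t : 0 < t < 1 -> rint f a b c d =
    rint f (x + t * (a - x)) (x + t * (b - x)) (y + t * (c - y)) (y + t * (d - y)).
  move=> /andP[t0 t1].
  have H p q r : p < q -> q < r -> [/\ p <= q + t * (p - q), q + t * (p - q) < q, q < q + t * (r - q) & q + t * (r - q) <= r].
    by clear -t0 t1 => ? ?; split; nra.
  have [A1 A2 A3 A4] := H _ _ _ ax xb; have [B1 B2 B3 B4] := H _ _ _ cy yd.
  set a' := x + t * (a - x) in A1 A2 *; set b' := x + t * (b - x) in A3 A4 *.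
  set c' := y + t * (c - y) in B1 B2 *; set d' := y + t * (d - y) in B3 B4 *.
  have sub p q u v z : a <= p -> q <= b -> c <= u -> v <= d -> rect p q u v z -> ccont f z.
    move=> h1 h2 h3 h4 [zx zy]; apply: cf; move: zx zy; clear -h1 h2 h3 h4 => /andP[? ?] /andP[? ?].
    by split; apply/andP; split; lra.
  clearbody a' b' c' d'.
  have G1 : rint f a a' c d = 0.
    by apply: G; [lra..|move=> [/andP[_]]; clear -A2; lra].
  have G2 : rint f b' b c d = 0.
    by apply: G; [lra..|move=> [/andP[+ _]]; clear -A3; lra].
  have G3 : rint f a' b' c c' = 0.
    by apply: G; [lra..|move=> [_ /andP[_]]; clear -B2; lra].
  have G4 : rint f a' b' d' d = 0.
    by apply: G; [lra..|move=> [_ /andP[+ _]]; clear -B3; lra].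
  have aab : a <= a' <= b by rewrite A1 /=; clear -A2 xb; lra.
  have abb : a' <= b' <= b by rewrite A4 andbT; clear -A2 A3; lra.
  have ccd : c <= c' <= d by rewrite B1 /=; clear -B2 yd; lra.
  have cdd : c' <= d' <= d by rewrite B4 andbT; clear -B2 B3; lra.
  have [_ a'b] := andP aab; have [a'b' _] := andP abb; have [cc' c'd] := andP ccd.
  have cd : c <= d := le_trans cc' c'd.
  rewrite (rect_split_x aab cd cf) G1 add0r.
  rewrite (rect_split_x abb cd) ?G2 ?addr0; last by move=> z; exact: sub.
  rewrite (rect_split_y a'b' ccd) ?G3 ?add0r; last by move=> z; exact: sub.
  by rewrite (rect_split_y a'b' cdd) ?G4 ?addr0// => z; exact: sub.
have wr : rect a b c d (x +i* y) by split => /=; apply/andP; split; apply: ltW.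
have [r r0 Hr] := cf _ wr _ ltr01.
apply/eqP; rewrite -cmod_eq0 eq_le cmod_ge0 andbT; apply/ler_addgt0Pr => e e0; rewrite add0r.
pose P := (b - a) + (d - c); have P0 : 0 < P by rewrite /P; clear -ax xb cy yd; lra.
pose M := cmod (f (x +i* y)) + 1.
have M0 : 0 < M by have := cmod_ge0 (f (x +i* y)); rewrite /M; clear; lra.
(* Ratio of the shrinking: r / 2 / P keeps the small rectangle where f is within 1 of its value at
   w, and the last term makes bound times length at most e. *)
pose t := Num.min (1 / 2) (Num.min (r / 2 / P) (e / (M * (2 * P)))).
have t0 : 0 < t by rewrite !lt_min !divr_gt0 ?mulr_gt0.
have t12 : t <= 1 / 2 by rewrite ge_min lexx.
have tr : t * P <= r / 2 by rewrite -ler_pdivlMr// !ge_min lexx !orbT.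
have te : t * (M * (2 * P)) <= e by rewrite -ler_pdivlMr ?mulr_gt0// !ge_min lexx !orbT.
rewrite (S t); last by rewrite t0 /=; clear -t12; lra.
clearbody t.
have ab' : x + t * (a - x) <= x + t * (b - x) by clear -t0 ax xb; nra.
have cd' : y + t * (c - y) <= y + t * (d - y) by clear -t0 cy yd; nra.
have sub z : rect (x + t * (a - x)) (x + t * (b - x)) (y + t * (c - y)) (y + t * (d - y)) z ->
   rect a b c d z /\ cmod (z - (x +i* y)) < r.
  move=> [zx zy]; split.
    move: zx zy; clear -t0 t12 ax xb cy yd => /andP[? ?] /andP[? ?].
    by split; apply/andP; split; nra.
  apply: (@le_lt_trans _ _ (t * P)); last by clear -tr r0; lra.
  apply: le_trans (cmod_ReIm _) _; case: z zx zy => zx zy /=.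
  rewrite /P; clear -t0 ax xb cy yd => /andP[? ?] /andP[? ?]; rewrite mulrDr.
  by apply: lerD; rewrite ler_norml; apply/andP; split; nra.
apply: le_trans (rint_bound ab' cd' _ (M := M) _) _.
- by move=> z [/sub[]]; move=> + _ _; exact: cf.
- move=> z [/sub[_ /Hr h] _]; have := cmod_rtri (f z) (f (x +i* y)).
  by rewrite /M; move: h; clear; lra.
by apply: le_trans te; rewrite /P; clear; lra.
Qed.

Definition sq a s : set C := rect (complex.Re a - s) (complex.Re a + s) (complex.Im a - s) (complex.Im a + s).
Definition sqframe a s : set C := frame (complex.Re a - s) (complex.Re a + s) (complex.Im a - s) (complex.Im a + s).
Definition sqint f a s : C := rint f (complex.Re a - s) (complex.Re a + s) (complex.Im a - s) (complex.Im a + s).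

Lemma sq_cmod a s z : sq a s z -> cmod (z - a) ^+ 2 <= 2 * s ^+ 2.
Proof.
case: a z => x y [u v] [/=].
rewrite /cmod /= sqr_sqrtr ?addr_ge0 ?sqr_ge0// => /andP[? ?] /andP[? ?].
have H (p : R) : - s <= p -> p <= s -> p ^+ 2 <= s ^+ 2 by move=> ? ?; nra.
have := H (u - x); have := H (v - y); lra.
Qed.

Lemma cmod_sq a s z : cmod (z - a) <= s -> sq a s z.
Proof.
move=> zs; have := cmod_Re (z - a); have := cmod_Im (z - a); move: zs.
case: a z => x y [u v] /=; rewrite !ler_norml => zs /andP[? ?] /andP[? ?].
by split; apply/andP; split => /=; lra.
Qed.

Lemma sqframe_cmod a s z : 0 < s -> sqframe a s z -> s <= cmod (z - a).
Proof.
move=> s0 [_ zE]; have := cmod_Re (z - a); have := cmod_Im (z - a).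
have := ler_norm (complex.Re (z - a)); have := ler_norm (- complex.Re (z - a)).
have := ler_norm (complex.Im (z - a)); have := ler_norm (- complex.Im (z - a)).
rewrite !normrN; case: a z zE => x y [u v] /= zE *.
by case: zE => zE; lra.
Qed.

Lemma sqframe_dist a s w z : 0 < s -> cmod (w - a) <= s / 2 -> sqframe a s z -> s / 2 <= cmod (z - w).
Proof.
by move=> s0 wa /(sqframe_cmod s0) za; have := cmod_tri w z a; lra.
Qed.

Lemma ccont_pole f z w n : z != w -> ccont f z -> ccont (fun z => f z / (z - w) ^+ n) z.
Proof.
move=> zw cf; apply: ccontM => //; apply: ccontV; first by rewrite expf_neq0 ?subr_eq0.
case: n => [|n]; first exact: ccont_cst.
have := cdiff_comp (cdiff_affine z (- w) 1) (cdiffXn _ n) => /cdiff_ccont.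
by apply: ccont_near; exists 1 => // v _; rewrite mul1r addrC.
Qed.

Lemma cdiff_pole z w : z != w -> cdiff (fun z => (z - w)^-1) z (- 1 / (z - w) ^+ 2).
Proof.
move=> zw; have d : cdiff (fun z => z - w) z 1.
  by have := cdiffB (cdiff_id z) (cdiff_cst w z); rewrite subr0.
by apply: cdiffV d; rewrite subr_eq0.
Qed.

End CauchyFormula.

(** * The integral of 1 / (z - a) around a square *)

Section PoleIntegral.
Context {R : realType}.
Local Notation C := R[i].
Implicit Types (a z w h : C) (s : R) (f g F : C -> C).

(** v runs over a side at distance s from the centre, and k is the foot of the perpendicular. The
    difference has modulus |v - k| / (|v| s), which is at most 1 / (s sqrt 2) because |v - k| <= s;
    and 1 / sqrt 2 < 3 / 4. *)
Lemma pole_side (v k : C) s : 0 < s -> cmod k = s -> cmod (v - k) <= s ->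
  cmod v ^+ 2 = s ^+ 2 + cmod (v - k) ^+ 2 -> cmod (v^-1 - k^-1) <= 3 / 4 / s.
Proof.
move=> s0 ks vks vE.
have v0 : 0 < cmod v.
  rewrite lt_def cmod_ge0 andbT; apply/eqP => v0; move: vE; rewrite v0 expr0n /= => vE.
  by have : 0 < s ^+ 2 by [rewrite exprn_gt0]; have := sqr_ge0 (cmod (v - k)); lra.
have vn : v != 0 by rewrite -cmod_gt0.
have kn : k != 0 by rewrite -cmod_gt0 ks.
have -> : v^-1 - k^-1 = - (v - k) / (v * k).
  by field; rewrite kn vn.
rewrite cmod_div cmodN cmodM ks ler_pdivrMr ?mulr_gt0// mulrCA divfK ?gt_eqF//.
rewrite -(@ler_pXn2r _ 2 isT) ?nnegrE ?mulr_ge0 ?cmod_ge0//.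
have : cmod (v - k) ^+ 2 <= s ^+ 2 by rewrite ler_pXn2r ?nnegrE ?cmod_ge0 ?(ltW s0).
have := sqr_ge0 (cmod (v - k)); rewrite exprMn vE [(3 / 4) ^+ 2]expr2; lra.
Qed.

Lemma sqframe_neq a s w z : 0 < s -> cmod (w - a) <= s / 2 -> sqframe a s z -> z != w.
Proof.
move=> s0 wa /(sqframe_dist s0 wa) h; apply/eqP => zw; move: h; rewrite zw subrr cmod0; lra.
Qed.

Lemma sq_le a s : 0 < s -> complex.Re a - s <= complex.Re a + s /\ complex.Im a - s <= complex.Im a + s.
Proof. by move=> s0; split; lra. Qed.

Lemma sqint_bound a s f (M : R) : 0 < s -> (forall z, sqframe a s z -> ccont f z) ->
  (forall z, sqframe a s z -> cmod (f z) <= M) -> cmod (sqint f a s) <= M * (8 * s).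
Proof.
move=> s0 cf fM; have [h1 h2] := sq_le a s0.
apply: le_trans (rint_bound h1 h2 cf fM) _.
by rewrite (_ : 2 * _ = 8 * s)//; ring.
Qed.
Lemma sqintD a s f g : 0 < s -> (forall z, sqframe a s z -> ccont f z) ->
  (forall z, sqframe a s z -> ccont g z) ->
  sqint (fun z => f z + g z) a s = sqint f a s + sqint g a s.
Proof. by move=> s0; have [h1 h2] := sq_le a s0; exact: rintD. Qed.
Lemma sqintZ a s f (k : C) : 0 < s -> (forall z, sqframe a s z -> ccont f z) ->
  sqint (fun z => k * f z) a s = k * sqint f a s.
Proof. by move=> s0 cf; have [h1 h2] := sq_le a s0; exact: rintZ. Qed.
Lemma eq_sqint a s f g : 0 < s -> (forall z, sqframe a s z -> ccont f z) ->
  (forall z, sqframe a s z -> f z = g z) -> sqint f a s = sqint g a s.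
Proof. by move=> s0 cf; have [h1 h2] := sq_le a s0; exact: eq_rint. Qed.

(* Equal to 2 pi i; only pole a s != 0 is used. *)
Definition pole a s : C := sqint (fun z => (z - a)^-1) a s.

Lemma ccont_inv a z : z != a -> ccont (fun z => (z - a)^-1) z.
Proof. by move=> /cdiff_pole; exact: cdiff_ccont. Qed.

(** Replacing 1 / (z - a) on each side by its value at the midpoint gives 8 'i in total. Each side,
    of length 2 s, costs an error of at most 3 / 2, which leaves 8 - 6. *)
Lemma pole_ge a s : 0 < s -> 2 <= cmod (pole a s).
Proof.
move=> s0; have [h1 h2] := sq_le a s0.
have cc z : sqframe a s z -> ccont (fun z => (z - a)^-1) z.
  move=> zf; apply: ccont_inv; apply: sqframe_neq zf => //.
  by rewrite subrr cmod0; lra.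
have side (p q : R) (g : R -> C) (k : C) : q - p = 2 * s -> rcont p q g -> cmod k = s ->
  (forall t, p <= t <= q -> exists v, [/\ g t = v^-1, cmod (v - k) <= s & cmod v ^+ 2 = s ^+ 2 + cmod (v - k) ^+ 2]) ->
  cmod (cint p q g - (2 * s)%:C * k^-1) <= 3 / 2.
  move=> qp cg ks H; have pq : p <= q by lra.
  have := @cint_near _ p q g k^-1 (3 / 4 / s) pq cg; rewrite qp => HH.
  apply: le_trans (HH _) _ => [t /H[v [-> v1 v2]]|]; first exact: pole_side.
  by rewrite mulrCA divfK ?gt_eqF//; lra.
have cI (t : R) : cmod (t%:C * 'i%C) = `|t| by rewrite cmodM cmodI cmodR mulr1.
have cR2 (x y : R) : cmod (x%:C + y%:C * 'i%C) ^+ 2 = x ^+ 2 + y ^+ 2.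
  rewrite /cmod /= sqr_sqrtr ?addr_ge0 ?sqr_ge0//; ring.
have aE : a = (complex.Re a)%:C + (complex.Im a)%:C * 'i%C by rewrite [LHS]complexE mulrC.
have hs (y sg : R) : (y = complex.Im a - s) \/ (y = complex.Im a + s) -> y = complex.Im a + sg -> `|sg| = s ->
   cmod (hseg (fun z => (z - a)^-1) y (complex.Re a - s) (complex.Re a + s) - (2 * s)%:C * (sg%:C * 'i%C)^-1) <= 3 / 2.
  move=> yy yE sgE; apply: side; [ring|exact: (rcont_h h2 cc (y := y) yy)|by rewrite cI|].
  move=> t /andP[t1 t2]; exists ((t - complex.Re a)%:C + sg%:C * 'i%C).
  split.
  - by congr (_^-1); rewrite [X in _ - X = _]aE yE !rmorphD !rmorphN /=; ring.
  - by rewrite addrK cmodR ler_norml; lra.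
  - by rewrite addrK cmodR cR2 -sgE !real_normK ?num_real// addrC.
have vs (x sg : R) : (x = complex.Re a - s) \/ (x = complex.Re a + s) -> x = complex.Re a + sg -> `|sg| = s ->
   cmod (vseg (fun z => (z - a)^-1) x (complex.Im a - s) (complex.Im a + s) - (2 * s)%:C * (sg%:C)^-1) <= 3 / 2.
  move=> xx xE sgE; apply: side; [ring|exact: (rcont_v h1 cc (x := x) xx)|by rewrite cmodR|].
  move=> t /andP[t1 t2]; exists (sg%:C + (t - complex.Im a)%:C * 'i%C).
  split.
  - by congr (_^-1); rewrite [X in _ - X = _]aE xE !rmorphD !rmorphN /=; ring.
  - by rewrite addrAC subrr add0r cI ler_norml; lra.
  - by rewrite [in cmod (_ - _)]addrAC subrr add0r cI cR2 -sgE !real_normK ?num_real.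
have ns : `|- s| = s by rewrite normrN gtr0_norm.
have ps : `|s| = s by rewrite gtr0_norm.
have b1 := hs _ (- s) (or_introl erefl) erefl ns.
have b2 := hs _ s (or_intror erefl) erefl ps.
have b3 := vs _ (- s) (or_introl erefl) erefl ns.
have b4 := vs _ s (or_intror erefl) erefl ps.
rewrite /pole /sqint /rint.
set H1 := hseg _ _ _ _ in b1 *; set H2 := hseg _ _ _ _ in b2 *.
set V1 := vseg _ _ _ _ in b3 *; set V2 := vseg _ _ _ _ in b4 *.
have i2 : 'i%C * 'i%C = -1 :> C by rewrite -expr2 sqr_i.
have i0 : 'i%C != 0 :> C by rewrite -cmod_gt0 cmodI.
have sC : s%:C != 0 :> C by rewrite -cmod_gt0 cmodR ps.
have iV : 'i%C^-1 = - 'i%C :> C by apply: (mulfI i0); rewrite mulfV// mulrN i2 opprK.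
have E : H1 + 'i%C * V2 - H2 - 'i%C * V1 - 8 * 'i%C =
  (H1 - (2 * s)%:C * ((- s)%:C * 'i%C)^-1) + 'i%C * (V2 - (2 * s)%:C * (s%:C)^-1)
  - (H2 - (2 * s)%:C * (s%:C * 'i%C)^-1) - 'i%C * (V1 - (2 * s)%:C * ((- s)%:C)^-1).
  rewrite !invfM iV rmorphN rmorphM /= invrN; field. by rewrite sC.
have c8 : cmod (8 * 'i%C : C) = 8.
  by rewrite cmodM cmodI mulr1 -[8]/(8%:R) -(rmorph_nat (real_complex R)) cmodR normr_nat.
have := cmod_rtri (8 * 'i%C) (8 * 'i%C - (H1 + 'i%C * V2 - H2 - 'i%C * V1)).
rewrite subKr c8 (cmodC (8 * _)) E.
set X1 := H1 - _ in b1 *; set X2 := H2 - _ in b2 *; set Y1 := V1 - _ in b3 *; set Y2 := V2 - _ in b4 *.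
have := cmodB (X1 + 'i%C * Y2 - X2) ('i%C * Y1).
have := cmodB (X1 + 'i%C * Y2) X2.
have := cmodD X1 ('i%C * Y2).
rewrite !cmodM cmodI !mul1r; lra.
Qed.

End PoleIntegral.

(** * Cauchy's formula and Taylor expansion with remainder *)

Section Taylor.
Context {R : realType}.
Local Notation C := R[i].
Implicit Types (a z w h : C) (s : R) (f g F : C -> C).

Lemma ccont_poles f a w z n : z != a -> z != w -> ccont f z ->
  ccont (fun z => f z / ((z - a) ^+ n * (z - w))) z.
Proof.
move=> za zw cf.
have := ccontM (ccont_pole n za cf) (ccont_inv zw); apply: ccont_near.
by exists 1 => // v _; rewrite invfM mulrA.
Qed.

(** As a function of w the integral has derivative 0, because (z - w)^-2 has a primitive along the
    frame; hence it is constant on the disc of radius s / 2. *)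
Lemma pole_shift a s w : 0 < s -> cmod (w - a) <= s / 2 ->
  sqint (fun z => (z - w)^-1) a s = pole a s.
Proof.
move=> s0 wa; pose c w := sqint (fun z => (z - w)^-1) a s.
suff dc v : cmod (v - a) <= s / 2 -> cdiff c v 0.
  have := @mean_value_seg R a w c (fun=> 0) 0.
  rewrite mul0r cmod0 => H; apply/eqP; rewrite -subr_eq0 -cmod_eq0 eq_le cmod_ge0 andbT.
  apply: H => t /andP[t0 t1]; split=> //; apply: dc.
  rewrite addrC addKr cmodM cmodR ger0_norm//; apply: le_trans wa.
  by rewrite ler_piMl ?cmod_ge0.
move=> va e e0.
(* On the frame |z - v| >= s / 2 and |z - u| >= s / 4, so the integrand of the remainder is at most
   16 / s^3; the frame has length 8 s. *)
pose B := 128 / s ^+ 2.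
have B0 : 0 < B by rewrite divr_gt0 ?exprn_gt0.
exists (Num.min (s / 4) (e / B)); first by rewrite lt_min; apply/andP; split; exact: divr_gt0.
move=> u; rewrite lt_min => /andP[us ue].
have vfr z : sqframe a s z -> z != v by exact: sqframe_neq.
have zu z : sqframe a s z -> s / 4 <= cmod (z - u).
  by move=> /(sqframe_dist s0 va); have := cmod_tri u z v; lra.
have ufr z : sqframe a s z -> z != u.
  by move=> /zu h; apply/eqP => zE; move: h; rewrite zE subrr cmod0; lra.
have c1 z : sqframe a s z -> ccont (fun z => (z - v)^-1) z by move=> /vfr; exact: ccont_inv.
have c2 z : sqframe a s z -> ccont (fun z => 1 / (z - v) ^+ 2) z.
  by move=> /vfr zv; apply: ccont_pole => //; exact: ccont_cst.
have c3 z : sqframe a s z -> ccont (fun z => 1 / ((z - v) ^+ 2 * (z - u))) z.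
  by move=> zf; apply: ccont_poles; [exact: vfr|exact: ufr|exact: ccont_cst].
have I2 : sqint (fun z => 1 / (z - v) ^+ 2) a s = 0.
  have [h1 h2] := sq_le a s0.
  apply: (rint_prim h1 h2 c2 (F := fun z => -1 * (z - v)^-1)) => z zf.
  have := cdiffZ (-1) (cdiff_pole (vfr z zf)); congr cdiff.
  by rewrite mulrA mulrNN !mul1r.
have E : c u = c v + (u - v) * 0 + (u - v) ^+ 2 * sqint (fun z => 1 / ((z - v) ^+ 2 * (z - u))) a s.
  rewrite -I2 -!sqintZ// /c -sqintD//; last by move=> z zf; apply: ccontM; [exact: ccont_cst|exact: c2].
  rewrite -sqintD//; first last.
  - by move=> z zf; apply: ccontM; [exact: ccont_cst|exact: c3].
  - by move=> z zf; apply: ccontD; [exact: c1|apply: ccontM; [exact: ccont_cst|exact: c2]].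
  apply: eq_sqint => // z zf; first by apply: ccont_inv; exact: ufr.
  by field; rewrite !subr_eq0 vfr// ufr.
rewrite E !mulr0 addr0 subr0 addrAC subrr add0r cmodM cmodX expr2 mulrAC.
apply: ler_wpM2r; first exact: cmod_ge0.
have IB : cmod (sqint (fun z => 1 / ((z - v) ^+ 2 * (z - u))) a s) <= B.
  apply: le_trans (sqint_bound s0 c3 (M := 16 / s ^+ 3) _) _; last first.
    by rewrite /B le_eqVlt (_ : 16 / s ^+ 3 * (8 * s) = 128 / s ^+ 2) ?eqxx//; field; rewrite gt_eqF.
  move=> z zf; rewrite mul1r cmodV cmodM cmodX -[16 / _]invf_div lef_pV2 ?posrE; last first.
  - by rewrite divr_gt0 ?exprn_gt0.
  - by rewrite mulr_gt0 ?exprn_gt0 ?cmod_gt0 ?subr_eq0 ?vfr ?ufr.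
  rewrite (_ : s ^+ 3 / 16 = (s / 2) ^+ 2 * (s / 4)); last by field.
  have s20 : 0 <= s / 2 by lra.
  apply: ler_pM => //; [exact: exprn_ge0|lra| |exact: zu].
  by rewrite ler_pXn2r ?nnegrE ?cmod_ge0//; exact: sqframe_dist zf.
have /ltW := ue; rewrite ler_pdivlMr// => ue'.
by apply: le_trans ue'; apply: ler_wpM2l IB; exact: cmod_ge0.
Qed.

(** The difference quotient q of f at w is continuous at w and differentiable elsewhere, so its
    integral vanishes by [rint_removable]; what remains is f w times the shifted pole. *)
Lemma cauchy_formula a s f w : 0 < s -> (forall z, sq a s z -> exists l, cdiff f z l) ->
  cmod (w - a) <= s / 2 ->
  sqint (fun z => f z / (z - w)) a s = f w * pole a s.
Proof.
move=> s0 df wa; rewrite -(pole_shift s0 wa).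
have ws : sq a s w by apply: cmod_sq; lra.
have [l dl] := df w ws; have /cdiff_factor[q [cq ql fE]] := dl.
have cf z : sq a s z -> ccont f z by move=> /df[k]; exact: cdiff_ccont.
have dq z : sq a s z -> z <> w -> exists k, cdiff q z k.
  move=> zs zw; have [k dk] := df z zs; have zw' : z != w by apply/eqP.
  have := cdiffM (cdiffB dk (cdiff_cst (f w) z)) (cdiff_pole zw') => dd.
  eexists; apply: cdiff_near dd; exists (cmod (z - w)); first by rewrite cmod_gt0 subr_eq0.
  move=> u uz; rewrite (fE u) addrC addKr mulrC mulKf// subr_eq0.
  by apply: contraTneq uz => ->; rewrite cmodC ltxx.
have cq' z : sq a s z -> ccont q z.
  move=> zs; have [->//|/eqP zw] := eqVneq z w.
  by have [k] := dq z zs zw; exact: cdiff_ccont.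
have I0 : sqint q a s = 0.
  apply: (@rint_removable _ _ _ _ _ w) => //; have := cmod_Re (w - a); have := cmod_Im (w - a);
  move: wa s0; clear; case: a w => x y [u v] /=; rewrite !ler_norml => ? ? /andP[? ?] /andP[? ?];
  apply/andP; split; lra.
have fr z : sqframe a s z -> z != w by exact: sqframe_neq.
have cp z : sqframe a s z -> ccont (fun z => (z - w)^-1) z by move=> /fr; exact: ccont_inv.
have cp' z : sqframe a s z -> ccont (fun z => f w * (z - w)^-1) z.
  by move=> zf; apply: ccontM; [exact: ccont_cst|exact: cp].
have cqf z : sqframe a s z -> ccont q z by move=> [zs _]; exact: cq'.
rewrite -sqintZ// -[RHS]add0r -I0 -sqintD//; apply: eq_sqint => //.
  by move=> z zf; apply: ccontM; [by apply: cf; case: zf|exact: cp].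
move=> z zf; have zw := fr z zf; rewrite [in LHS](fE z).
by field; rewrite subr_eq0.
Qed.

(** Iteration of 1 / (z - w) = 1 / (z - a) + (w - a) / ((z - a) (z - w)) under the integral. The 8
    comes from the length 8 s of the frame; in the remainder, the factor 2 lost through |z - w| >= s
    / 2 is regained from the lower bound 2 for the pole. *)
Lemma taylor a s f (M : R) : 0 < s -> (forall z, sq a s z -> exists l, cdiff f z l) ->
  (forall z, sq a s z -> cmod (f z) <= M) ->
  exists c : nat -> C, (forall j, cmod (c j) <= 8 * M / s ^+ j) /\
    forall k w, cmod (w - a) <= s / 2 ->
      cmod (f w - \sum_(j < k) c j * (w - a) ^+ j) <= 8 * M * (cmod (w - a) / s) ^+ k.
Proof.
move=> s0 df fM.
have M0 : 0 <= M by apply: le_trans (fM a _); [exact: cmod_ge0|apply: cmod_sq; rewrite subrr cmod0 ltW].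
pose P := pole a s; have P2 : 2 <= cmod P := pole_ge a s0.
have P0 : P != 0 by rewrite -cmod_gt0; lra.
have cf z : sqframe a s z -> ccont f z by move=> [/df[k dk] _]; exact: cdiff_ccont dk.
have fM' z : sqframe a s z -> cmod (f z) <= M by move=> [/fM].
have aa : cmod (a - a) <= s / 2 by rewrite subrr cmod0; lra.
have afr z : sqframe a s z -> z != a by exact: sqframe_neq.
have ca j z : sqframe a s z -> ccont (fun z => f z / (z - a) ^+ j) z.
  by move=> zf; apply: ccont_pole; [exact: afr|exact: cf].
have zaj j z : sqframe a s z -> cmod (f z / (z - a) ^+ j) <= M / s ^+ j.
  move=> zf; rewrite cmod_div cmodX; apply: ler_pM; rewrite ?cmod_ge0 ?invr_ge0 ?exprn_ge0 ?cmod_ge0//.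
    exact: fM'.
  rewrite lef_pV2 ?posrE ?exprn_gt0 ?cmod_gt0 ?subr_eq0 ?afr//.
  by rewrite lerXn2r ?nnegrE ?cmod_ge0 ?(ltW s0) ?(sqframe_cmod s0 zf).
exists (fun j => P^-1 * sqint (fun z => f z / (z - a) ^+ j.+1) a s); split.
  move=> j; rewrite cmodM cmodV mulrC ler_pdivrMr; last by lra.
  apply: le_trans (sqint_bound s0 (ca j.+1) (zaj j.+1)) _.
  have X0 : 0 <= 8 * M / s ^+ j by rewrite divr_ge0 ?mulr_ge0 ?exprn_ge0 ?(ltW s0).
  rewrite (_ : _ * (8 * s) = 8 * M / s ^+ j); last by rewrite exprS; field; rewrite ?expf_neq0 ?gt_eqF.
  by rewrite ler_peMr//; lra.
move=> k w wa.
have wfr z : sqframe a s z -> z != w by exact: sqframe_neq.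
have cw j z : sqframe a s z -> ccont (fun z => f z / ((z - a) ^+ j * (z - w))) z.
  by move=> zf; apply: ccont_poles; [exact: afr|exact: wfr|exact: cf].
pose Rm j := sqint (fun z => f z / ((z - a) ^+ j * (z - w))) a s.
have step j : Rm j = sqint (fun z => f z / (z - a) ^+ j.+1) a s + (w - a) * Rm j.+1.
  have cwa z : sqframe a s z -> ccont (fun z => (w - a) * (f z / ((z - a) ^+ j.+1 * (z - w)))) z.
    by move=> zf; apply: ccontM; [exact: ccont_cst|exact: cw].
  rewrite /Rm -(sqintZ (w - a) s0 (cw j.+1)) -(sqintD s0 (ca j.+1) cwa).
  apply: eq_sqint => // [z|z zf]; first exact: cw.
  by rewrite !exprS; field; rewrite ?expf_neq0 ?subr_eq0 ?wfr ?afr.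
have main j : f w * P = \sum_(i < j) sqint (fun z => f z / (z - a) ^+ i.+1) a s * (w - a) ^+ i + (w - a) ^+ j * Rm j.
  elim: j => [|n IH].
    rewrite big_ord0 add0r expr0 mul1r -(cauchy_formula s0 df wa) /Rm.
    apply: eq_sqint => // z zf; last by rewrite expr0 mul1r.
    by apply: ccontM; [exact: cf|apply: ccont_inv; exact: wfr].
  by rewrite big_ord_recr /= IH step exprS; ring.
have -> : f w - \sum_(j < k) P^-1 * sqint (fun z => f z / (z - a) ^+ j.+1) a s * (w - a) ^+ j =
    P^-1 * ((w - a) ^+ k * Rm k).
  have -> : \sum_(j < k) P^-1 * sqint (fun z => f z / (z - a) ^+ j.+1) a s * (w - a) ^+ j =
      P^-1 * \sum_(j < k) sqint (fun z => f z / (z - a) ^+ j.+1) a s * (w - a) ^+ j.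
    by rewrite big_distrr /=; apply: eq_bigr => j _; rewrite mulrA.
  by rewrite -[f w](mulfK P0) (main k); ring.
rewrite !cmodM cmodV mulrC ler_pdivrMr; last by lra.
have RB : cmod (Rm k) <= 2 * M / s ^+ k.+1 * (8 * s).
  apply: sqint_bound => // z zf; first exact: cw.
  rewrite invfM mulrA cmodM cmodV (_ : 2 * M / _ = M / s ^+ k * (s / 2)^-1); last first.
    by rewrite exprS; field; rewrite ?expf_neq0 ?gt_eqF.
  apply: ler_pM; rewrite ?cmod_ge0 ?invr_ge0 ?cmod_ge0 ?zaj//.
  rewrite lef_pV2 ?posrE ?cmod_gt0 ?subr_eq0 ?wfr//; first exact: sqframe_dist zf.
  by lra.
rewrite cmodX; have X0 : 0 <= 8 * M * (cmod (w - a) / s) ^+ k.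
  by rewrite !mulr_ge0 ?exprn_ge0 ?divr_ge0 ?cmod_ge0 ?(ltW s0).
apply: (@le_trans _ _ (8 * M * (cmod (w - a) / s) ^+ k * 2)); last by apply: ler_wpM2l.
apply: le_trans (ler_wpM2l (exprn_ge0 _ (cmod_ge0 _)) RB) _.
rewrite le_eqVlt; apply/orP; left; apply/eqP.
by rewrite expr_div_n exprS; field; rewrite ?expf_neq0 ?gt_eqF.
Qed.

End Taylor.

(** * Holomorphic functions on discs *)

Section Compactness.
Context {R : realType}.
Local Notation C := R[i].
Implicit Types (a z w : C) (r : R).

Lemma closed_disc_closed a r : closed [set z : C | cmod (z - a) <= r].
Proof.
move=> z cz /=; apply/ler_addgt0Pr => e e0.
have /cz [w [/= wr wz]] : nbhs z [set w | cmod (w - z) < e].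
  by apply/nbhs_cmod; exists e.
by have := cmod_tri w z a; rewrite (cmodC z w); lra.
Qed.

Lemma closed_disc_compact a r : compact [set z : C | cmod (z - a) <= r].
Proof.
have K := compact_setX (@segment_compact R (- r) r) (@segment_compact R (- r) r).
pose h (p : R * R) : C := a + (p.1%:C + p.2%:C * 'i%C).
have ch : continuous h.
  move=> [x y]; apply/(@cvgrPdist_le C C _ (nbhs (x, y)) _ h (h (x, y))) => e e0.
  have [-> e0'] := gt0_complex e0.
  have e20 : 0 < complex.Re e / 2 by lra.
  exists (ball x (complex.Re e / 2), ball y (complex.Re e / 2)).
    by split; apply: nbhsx_ballx.
  move=> [u v] /= [ux vy]; rewrite normcmodE lecR /h.
  rewrite (_ : _ - _ = (x - u)%:C + (y - v)%:C * 'i%C); last by rewrite !rmorphB /=; ring.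
  apply: le_trans (cmodD _ _) _; rewrite cmodM cmodI mulr1 !cmodR.
  by move: ux vy; rewrite /ball /= => ? ?; lra.
have cc := continuous_compact (continuous_subspaceT ch) K.
apply: (subclosed_compact _ cc); first exact: closed_disc_closed.
move=> z /= zr; exists (complex.Re (z - a), complex.Im (z - a)).
  have := cmod_Re (z - a); have := cmod_Im (z - a); rewrite !ler_norml => /andP[? ?] /andP[? ?].
  by split; rewrite /= in_itv /=; apply/andP; split; lra.
change (a + ((complex.Re (z - a))%:C + (complex.Im (z - a))%:C * 'i%C) = z).
by rewrite [_%:C * _]mulrC -complexE addrC subrK.
Qed.

(** A finite subcover in disguise: n stands for a bound, an inverse radius or a word length, and
    monotonicity lets finitely many local values be replaced by their maximum. *)
Lemma compact_unif (K : set C) (P : C -> nat -> Prop) : compact K ->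
  (forall y n m, (n <= m)%N -> P y n -> P y m) ->
  (forall x, K x -> exists2 d : R, 0 < d & exists n, forall y, K y -> cmod (y - x) < d -> P y n) ->
  exists n, forall y, K y -> P y n.
Proof.
move=> cK mono loc.
have := (compact_near_coveringP K).1 cK nat \oo (fun n y => K y -> P y n) _.
case.
  move=> x Kx; have [d d0 [n Hn]] := loc x Kx.
  exists ([set y | cmod (y - x) < d], [set m | (n <= m)%N]).
    by split; [apply/nbhs_cmod; exists d|exists n].
  by move=> [y m] [/= yx nm] Ky; apply: mono nm _; exact: Hn.
by move=> n _ H; exists n => y Ky; apply: (H n) => //=.
Qed.

End Compactness.

Section Discs.
Context {R : realType}.
Local Notation C := R[i].
Implicit Types (a z w h : C) (r s : R) (f g F : C -> C).

Definition holoD f a r := forall z, cmod (z - a) < r -> exists l, cdiff f z l.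
(** Locked so that conversion does not unfold the derivative; [cderE] is the way to compute it. *)
Definition cder : (C -> C) -> C -> C := locked (fun f z => 'D_1 f z).

Lemma cderE f z l : cdiff f z l -> cder f z = l.
Proof. by move=> /cdiff_is_derive[]; rewrite /cder -lock. Qed.

Lemma cdiffP f z : (exists l, cdiff f z l) -> cdiff f z (cder f z).
Proof. by move=> [l dl]; rewrite (cderE dl). Qed.

Lemma holoD_sub f a r b s : holoD f a r -> cmod (b - a) + s <= r -> holoD f b s.
Proof. by move=> hf bs z zb; apply: hf; have := cmod_tri b z a; lra. Qed.

Lemma cont_bounded f a r : (forall z, cmod (z - a) <= r -> ccont f z) ->
  exists2 M : R, 0 < M & forall z, cmod (z - a) <= r -> cmod (f z) <= M.
Proof.
move=> cf; have [|||n Hn] := @compact_unif R [set z | cmod (z - a) <= r] (fun z n => cmod (f z) <= n%:R).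
- exact: closed_disc_compact.
- by move=> y n m nm h; apply: le_trans h _; rewrite ler_nat.
- move=> x xr; have [d d0 Hd] := cf x xr _ ltr01; exists d => //.
  exists (Num.trunc (cmod (f x) + 1)).+1 => y _ /Hd h.
  have := cmod_rtri (f y) (f x); have := Num.Theory.truncnS_gt (cmod (f x) + 1); lra.
exists (n%:R + 1); first by rewrite ltr_wpDl.
by move=> z /Hn; lra.
Qed.

Lemma holo_bounded f a r s : holoD f a r -> s < r ->
  exists2 M : R, 0 < M & forall z, cmod (z - a) <= s -> cmod (f z) <= M.
Proof.
move=> hf sr; apply: cont_bounded => z zs.
by have [|l] := hf z; [lra|exact: cdiff_ccont].
Qed.

(** The square of half side r / 2 has circumradius r / sqrt 2 < r and lies inside the disc; this is
    the origin of r / 4 and 2 / r. *)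
Lemma taylorD f a r (M : R) : 0 < r -> holoD f a r ->
  (forall z, cmod (z - a) < r -> cmod (f z) <= M) ->
  exists c : nat -> C, [/\ c 0%N = f a, c 1%N = cder f a,
    forall j, cmod (c j) <= 8 * M * (2 / r) ^+ j &
    forall k w, cmod (w - a) <= r / 4 ->
      cmod (f w - \sum_(j < k) c j * (w - a) ^+ j) <= 8 * M * (2 * cmod (w - a) / r) ^+ k].
Proof.
move=> r0 hf fM; have s0 : 0 < r / 2 by lra.
have sub z : sq a (r / 2) z -> cmod (z - a) < r.
  move=> /sq_cmod h; rewrite -(@ltr_pXn2r _ 2 isT) ?nnegrE ?cmod_ge0 ?(ltW r0)//.
  apply: le_lt_trans h _; rewrite expr_div_n (_ : (2 : R) ^+ 2 = 4); last by ring.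
  have : 0 < r ^+ 2 by rewrite exprn_gt0.
  lra.
have [c [cB H]] := taylor s0 (fun z zs => hf z (sub z zs)) (fun z zs => fM z (sub z zs)).
have H' k w : cmod (w - a) <= r / 4 ->
      cmod (f w - \sum_(j < k) c j * (w - a) ^+ j) <= 8 * M * (2 * cmod (w - a) / r) ^+ k.
  move=> wa; have := H k w; rewrite (_ : cmod (w - a) / (r / 2) = 2 * cmod (w - a) / r).
    by apply; lra.
  by field; rewrite gt_eqF.
have c0 : c 0%N = f a.
  have := H' 1%N a; rewrite subrr cmod0 mulr0 mul0r expr1 mulr0 big_ord1 expr0 mulr1 => HH.
  have /HH : 0 <= r / 4 by lra.
  move=> h; apply/eqP; rewrite eq_sym -subr_eq0 -cmod_eq0 eq_le cmod_ge0 andbT//.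
exists c; split=> //.
  symmetry; apply: cderE => e e0.
  have M0 : 0 <= M by apply: le_trans (fM a _); rewrite ?cmod_ge0// subrr cmod0.
  pose B := 32 * M / r ^+ 2 + 1.
  have B0 : 0 < B by rewrite /B ltr_wpDl// divr_ge0 ?mulr_ge0 ?exprn_ge0 ?(ltW r0).
  exists (Num.min (r / 4) (e / B)); first by rewrite lt_min; apply/andP; split; exact: divr_gt0.
  move=> w; rewrite lt_min => /andP[/ltW w1 /ltW]; rewrite ler_pdivlMr// => w2.
  have := H' 2%N w w1; rewrite !big_ord_recr big_ord0 /= add0r expr0 mulr1 expr1 c0.
  rewrite opprD addrA (mulrC (c 1%N)) => h; apply: le_trans h _.
  rewrite (_ : 8 * M * _ ^+ 2 = cmod (w - a) * (32 * M / r ^+ 2) * cmod (w - a)); last first.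
    by field; rewrite gt_eqF.
  apply: ler_wpM2r; first exact: cmod_ge0.
  by apply: le_trans w2; apply: ler_wpM2l; [exact: cmod_ge0|rewrite /B lerDl].
move=> j; have := cB j; rewrite (_ : 8 * M / (r / 2) ^+ j = 8 * M * (2 / r) ^+ j)//.
by rewrite !expr_div_n; field; rewrite ?expf_neq0 ?gt_eqF.
Qed.

Lemma cauchy_est f a r (M : R) : 0 < r -> holoD f a r ->
  (forall z, cmod (z - a) < r -> cmod (f z) <= M) ->
  cmod (cder f a) <= 16 * M / r.
Proof.
move=> r0 hf fM; have [c [_ <- cB _]] := taylorD r0 hf fM.
by have := cB 1%N; rewrite expr1 (_ : 8 * M * _ = 16 * M / r)//; field; rewrite gt_eqF.
Qed.

Lemma quad_est w f a r (M : R) : 0 < r -> holoD f a r ->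
  (forall z, cmod (z - a) < r -> cmod (f z) <= M) ->
  cmod (w - a) <= r / 4 ->
  cmod (f w - f a - (w - a) * cder f a) <= 32 * M / r ^+ 2 * cmod (w - a) ^+ 2.
Proof.
move=> r0 hf fM; have [c [c0 c1 _ H]] := taylorD r0 hf fM.
move=> /(H 2%N w); rewrite !big_ord_recr big_ord0 /= add0r expr0 mulr1 expr1 c0 c1.
rewrite opprD addrA (mulrC (cder _ _)) => h; apply: le_trans h _.
rewrite le_eqVlt; apply/orP; left; apply/eqP; field; by rewrite gt_eqF.
Qed.

(** With h = w - a, the quadratic Taylor polynomials at w, evaluated at w + h and w - h, and the one
    at a, evaluated at w + h, combine so that all values of f cancel. What is left is 2 h times the
    error to be estimated, up to O(h^3). *)
Lemma cder_holo_at f a r (M : R) : 0 < r -> holoD f a r ->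
  (forall z, cmod (z - a) < r -> cmod (f z) <= M) ->
  exists l, cdiff (cder f) a l.
Proof.
move=> r0 hf fM; have [c [c0 c1 cB H]] := taylorD r0 hf fM; exists (2 * c 2%N) => e e0.
have M0 : 0 <= M by apply: le_trans (cmod_ge0 (f a)) (fM a _); rewrite subrr cmod0.
pose B := 3 * 16 * 16 * M / r ^+ 3 + 1.
have B0 : 0 < B by rewrite /B ltr_wpDl// divr_ge0 ?mulr_ge0 ?exprn_ge0 ?(ltW r0).
exists (Num.min (r / 8) (e / B)); first by rewrite lt_min; apply/andP; split; exact: divr_gt0.
move=> w; rewrite lt_min => /andP[/ltW w1 /ltW]; rewrite ler_pdivlMr// => w2.
have [->|wa] := eqVneq w a; first by rewrite !subrr mul0r subrr cmod0 mulr0.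
pose h := w - a; have hn : h != 0 by rewrite /h subr_eq0.
have r20 : 0 < r / 2 by clear -r0; lra.
have hw : holoD f w (r / 2) by apply: holoD_sub hf _; clear -w1 r0; lra.
have fw z : cmod (z - w) < r / 2 -> cmod (f z) <= M.
  by move=> zw; apply: fM; have := cmod_tri w z a; move: zw w1 r0; clear; lra.
have [d [d0 d1 _ G]] := taylorD r20 hw fw.
have E1 := G 3%N (w + h); have E2 := G 3%N a; have E3 := H 3%N (w + h).
move: E1 E2 E3; rewrite !big_ord_recr !big_ord0 /= !add0r !expr0 !mulr1 !expr1 d0 d1 c0 c1.
rewrite (_ : w + h - w = h); last by ring.
rewrite (_ : a - w = - h); last by rewrite /h; ring.
rewrite (_ : w + h - a = 2 * h); last by rewrite /h; ring.
rewrite cmodN cmodM (_ : cmod 2 = 2); last by rewrite -(rmorph_nat (real_complex R) 2) cmodR normr_nat.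
rewrite -/h in w1 w2 *; set dl := cmod h in w1 w2 *.
have dl0 : 0 < dl by rewrite cmod_gt0.
have h8 : dl <= r / 2 / 4 by clear -w1; lra.
have h4 : 2 * dl <= r / 4 by clear -w1; lra.
move=> /(_ h8) E1 /(_ h8) E2 /(_ h4) E3.
set X1 := (X in cmod X) in E1; set X2 := (X in cmod X) in E2; set X3 := (X in cmod X) in E3.
have E : 2 * h * (cder f w - cder f a - h * (2 * c 2%N)) = X3 - X1 + X2.
  rewrite /X1 /X2 /X3; move: (f (w + h)) (f w) (f a) (cder f w) (cder f a) (c 2%N) (d 2%N) (h).
  by clear => *; ring.
have : cmod (X3 - X1 + X2) <= 3 * (8 * M * (4 * dl / r) ^+ 3).
  apply: le_trans (cmodD _ _) _; have := cmodB X3 X1.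
  move: E1 E2 E3; rewrite (_ : 2 * dl / (r / 2) = 4 * dl / r); last by field; rewrite gt_eqF.
  rewrite (_ : 2 * (2 * dl) / r = 4 * dl / r); last by field; rewrite gt_eqF.
  by clear; lra.
rewrite -E !cmodM (_ : cmod 2 = 2); last by rewrite -(rmorph_nat (real_complex R) 2) cmodR normr_nat.
rewrite -/dl -ler_pdivlMl ?mulr_gt0// => h1; apply: le_trans h1 _.
have -> : (2 * dl)^-1 * (3 * (8 * M * (4 * dl / r) ^+ 3)) = dl * (3 * 16 * 16 * M / r ^+ 3) * dl.
  by field; rewrite !gt_eqF.
apply: ler_wpM2r; first exact: ltW.
by apply: le_trans w2; apply: ler_wpM2l; [exact: ltW|rewrite /B lerDl].
Qed.
Lemma cder_holo f a r : holoD f a r -> holoD (cder f) a r.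
Proof.
move=> hf z zr; pose s := (r - cmod (z - a)) / 2; have s0 : 0 < s by rewrite /s; lra.
have hz : holoD f z (2 * s) by apply: holoD_sub hf _; rewrite /s; lra.
have [|M M0 HM] := holo_bounded hz (s := s); first by lra.
apply: (@cder_holo_at f z s M) => //; last by move=> w /ltW; exact: HM.
by apply: holoD_sub hz _; rewrite subrr cmod0; lra.
Qed.

End Discs.

(** * Zeros and the identity theorem *)

Section Zeros.
Context {R : realType}.
Local Notation C := R[i].
Implicit Types (a z w h : C) (r s : R) (f g F : C -> C).

Lemma seg_in a r b w (t : R) : 0 <= t <= 1 -> cmod (b - a) < r -> cmod (w - a) < r ->
  cmod (b + t%:C * (w - b) - a) < r.
Proof.
move=> /andP[t0 t1] ba wa.
rewrite (_ : _ - a = (1 - t)%:C * (b - a) + t%:C * (w - a)); last by rewrite rmorphB rmorph1; ring.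
apply: le_lt_trans (cmodD _ _) _; rewrite !cmodM !cmodR !ger0_norm ?subr_ge0//.
set m := Num.max (cmod (b - a)) (cmod (w - a)).
have mr : m < r by rewrite gt_max ba.
have h1 : (1 - t) * cmod (b - a) <= (1 - t) * m by apply: ler_wpM2l; rewrite ?subr_ge0// le_max lexx.
have h2 : t * cmod (w - a) <= t * m by apply: ler_wpM2l => //; rewrite le_max lexx orbT.
by lra.
Qed.

Lemma lip_disc f a r (M : R) : holoD f a r -> (forall z, cmod (z - a) < r -> cmod (cder f z) <= M) ->
  forall z w, cmod (z - a) < r -> cmod (w - a) < r -> cmod (f w - f z) <= M * cmod (w - z).
Proof.
move=> hf fM z w za wa; apply: (mean_value_seg (g := cder f)) => t t01.
have zt := seg_in t01 za wa.
by split; [apply: cdiffP; exact: hf|exact: fM].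
Qed.

Lemma linear_approx f a r (l : C) (M : R) : holoD f a r ->
  (forall z, cmod (z - a) < r -> cmod (cder f z - l) <= M) ->
  forall z w, cmod (z - a) < r -> cmod (w - a) < r ->
    cmod (f w - f z - l * (w - z)) <= M * cmod (w - z).
Proof.
move=> hf fM z w za wa.
pose g u := f u - l * u.
have dg u : cmod (u - a) < r -> cdiff g u (cder f u - l).
  move=> ur; have := cdiffB (cdiffP (hf u ur)) (cdiffZ l (cdiff_id u)); rewrite mulr1.
  by [].
rewrite (_ : _ - _ = g w - g z); last by rewrite /g; ring.
apply: (@lip_disc g a r M) => //.
  by move=> u ur; exists (cder f u - l); exact: dg.
by move=> u ur; rewrite (cderE (dg u ur)); exact: fM.
Qed.

(** k is the order of the zero. The term of order k + 1 is kept because [univ_der_neq0_disc] needs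
    the quotient by (z - a)^k to be differentiable at a, not only continuous. *)
Lemma zeros_local f a r : 0 < r -> holoD f a r ->
  (exists2 d : R, 0 < d & forall z, cmod (z - a) < d -> f z = 0) \/
  exists k (c c' : C) (d K : R), [/\ c != 0, 0 < d, 0 < K &
    forall z, cmod (z - a) < d ->
      cmod (f z - c * (z - a) ^+ k - c' * (z - a) ^+ k.+1) <= K * cmod (z - a) ^+ k.+2].
Proof.
move=> r0 hf; have r20 : 0 < r / 2 by lra.
have r2r : r / 2 < r by lra.
have [M M0 fM] := holo_bounded hf r2r.
have hf2 : holoD f a (r / 2) by apply: holoD_sub hf _; rewrite subrr cmod0; lra.
have [c [_ _ _ H]] := taylorD r20 hf2 (fun z zr => fM z (ltW zr)).
have r8 : 0 < r / 2 / 4 by lra.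
have [c0|] := pselect (forall j, c j = 0).
  left; exists (r / 2 / 4) => // z za; apply/eqP; rewrite -cmod_eq0 eq_le cmod_ge0 andbT.
  rewrite leNgt; apply/negP => fz; have [n] := half_pow_lt (8 * M) fz.
  have := H n z (ltW za); rewrite big1 ?subr0 => [h|i _]; last by rewrite c0 mul0r.
  apply/negP; rewrite -leNgt; apply: le_trans h _; apply: ler_wpM2l; first by rewrite mulr_ge0 ?ltW.
  apply: lerXn2r; rewrite ?nnegrE ?divr_ge0 ?mulr_ge0 ?invr_ge0 ?ler0n ?cmod_ge0 ?(ltW r0)//.
  by rewrite ler_pdivrMr//; lra.
move=> /existsNP; rewrite -/(exists j, c j <> 0) => nz.
have nz' : exists j, c j != 0 by case: nz => j /eqP; exists j.
right; case: (ex_minnP nz') => k ck kmin.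
exists k, (c k), (c k.+1), (r / 2 / 4), (8 * M * (2 / (r / 2)) ^+ k.+2); split=> //.
  by apply: mulr_gt0; [exact: mulr_gt0|apply: exprn_gt0; exact: divr_gt0].
move=> z za; have := H k.+2 z (ltW za).
rewrite 2!big_ord_recr /= big1 ?add0r => [h|i _].
  rewrite -addrA -opprD; apply: le_trans h _; by rewrite -[leRHS]mulrA -exprMn [2 * cmod _ / _]mulrAC.
rewrite (_ : c i = 0) ?mul0r//; apply/eqP/negPn/negP => /kmin.
by rewrite leqNgt ltn_ord.
Qed.

Lemma zeros_isolated f a r : 0 < r -> holoD f a r ->
  (exists2 d : R, 0 < d & forall z, cmod (z - a) < d -> f z = 0) \/
  (exists2 d : R, 0 < d & forall z, cmod (z - a) < d -> z != a -> f z != 0).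
Proof.
move=> r0 hf; have [?|[k [c [c' [d [K' [c0 d0 K'0 H']]]]]]] := zeros_local r0 hf; first by left.
right; have cc : 0 < cmod c by rewrite cmod_gt0.
pose K := K' * d + cmod c'.
have K0 : 0 < K by rewrite /K ltr_pwDl ?cmod_ge0// mulr_gt0.
have H z : cmod (z - a) < d -> cmod (f z - c * (z - a) ^+ k) <= K * cmod (z - a) ^+ k.+1.
  move=> zd; have := H' z zd.
  have := cmod_rtri (f z - c * (z - a) ^+ k) (c' * (z - a) ^+ k.+1).
  rewrite cmodM cmodX /K mulrDl => h1 h2.
  have h3 : K' * cmod (z - a) ^+ k.+2 <= K' * d * cmod (z - a) ^+ k.+1.
    rewrite exprS mulrA; apply: ler_wpM2r; first by rewrite exprn_ge0 ?cmod_ge0.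
    by rewrite ler_pM2l// ltW.
  by move: h1 h2 h3; clear; lra.
exists (Num.min d (cmod c / K)); first by rewrite lt_min d0 divr_gt0.
move=> z; rewrite lt_min => /andP[/H h zc] za.
apply/eqP => fz; move: h; rewrite fz sub0r cmodN cmodM cmodX exprS mulrA leNgt => /negP; apply.
rewrite ltr_pM2r ?exprn_gt0 ?cmod_gt0 ?subr_eq0//.
by rewrite mulrC -ltr_pdivlMr.
Qed.

(** The class of x and the union of the other classes are both open in V. This carries local
    statements along V: the identity theorem, Harnack chains, contraction of words. *)
Lemma connected_class (V : set C) (rel : C -> C -> Prop) :
  connected V -> (forall z, V z -> rel z z) ->
  (forall x y z, rel x y -> rel y z -> rel x z) -> (forall x y, rel x y -> rel y x) ->
  (forall z, V z -> exists2 d : R, 0 < d & forall w, cmod (w - z) < d -> V w /\ rel z w) ->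
  forall x y, V x -> V y -> rel x y.
Proof.
move=> cV refl tr sym loc x y Vx Vy.
pose B := V `&` [set z | rel x z].
suff : B = V by move=> E; have := Vy; rewrite -E => -[].
apply: cV; first by exists x; split=> //; exact: refl.
- exists [set z | V z /\ rel x z]; last by rewrite eqEsubset; split=> z; [move=> [? ?]; split|move=> [_ []]].
  rewrite openE => z [Vz xz]; apply/nbhs_cmod; have [d d0 H] := loc z Vz.
  by exists d => // w /H[Vw zw]; split=> //; exact: tr zw.
- exists (~` [set z | V z /\ ~ rel x z]).
    apply: open_closedC; rewrite openE => z [Vz xz]; apply/nbhs_cmod; have [d d0 H] := loc z Vz.
    by exists d => // w /H[Vw zw]; split=> // xw; apply: xz; exact: tr xw (sym _ _ zw).
  rewrite eqEsubset; split=> z; move=> [Vz h]; split=> //; first by move=> [].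
  by apply: contrapT => nx; apply: h.
Qed.

Lemma identity_thm (V : set C) f : connected V -> open V ->
  (forall z, V z -> exists l, cdiff f z l) ->
  forall a, V a -> (exists2 d : R, 0 < d & forall z, cmod (z - a) < d -> f z = 0) ->
  forall z, V z -> f z = 0.
Proof.
move=> cV oV df a Va fa z Vz.
pose Z w := exists2 d : R, 0 < d & forall z, cmod (z - w) < d -> f z = 0.
suff H : (Z a <-> Z z).
  by have [/(_ fa)[d d0 h] _] := H; apply: h; rewrite subrr cmod0.
have ball_V w : V w -> exists2 d : R, 0 < d & forall u, cmod (u - w) < d -> V u.
  by move=> Vw; apply/nbhs_cmod; move: oV; rewrite openE; apply.
apply: (@connected_class V (fun x y => Z x <-> Z y)) => //.
- by move=> x u v [h1 h2] [h3 h4]; split; auto.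
- by move=> x y [].
move=> w Vw; have [d d0 Hd] := ball_V w Vw.
have hf : holoD f w d by move=> u /Hd; exact: df.
have [fw|[e e0 He]] := zeros_isolated d0 hf.
  have [e e0 He] := fw; exists (Num.min d e); first by rewrite lt_min d0.
  move=> u; rewrite lt_min => /andP[/Hd Vu ue]; split=> //; split=> // _.
  exists (e - cmod (u - w)); first by lra.
  by move=> v vu; apply: He; have := cmod_tri u v w; lra.
exists (Num.min d e); first by rewrite lt_min d0.
move=> u; rewrite lt_min => /andP[/Hd Vu ue]; split=> //.
(* Every neighbourhood of v contains a point of the isolating disc other than w, also when v = w;
   hence f vanishes identically near no point of that disc. *)
have punct v k : 0 < k -> cmod (v - w) < e -> exists z, [/\ cmod (z - v) < k, z != w & cmod (z - w) < e].
  move=> k0 ve; pose t := Num.min k (e - cmod (v - w)) / 2.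
  have t0 : 0 < t by rewrite /t divr_gt0// lt_min k0 /=; lra.
  have tk : t < k.
    have : Num.min k (e - cmod (v - w)) <= k by rewrite ge_min lexx.
    by rewrite /t; lra.
  have te : t < e - cmod (v - w).
    have : Num.min k (e - cmod (v - w)) <= e - cmod (v - w) by rewrite ge_min lexx orbT.
    by move: k0 ve; rewrite /t; lra.
  have [E|N] := eqVneq (v + t%:C) w.
    exists v; split=> //; first by rewrite subrr cmod0.
    by rewrite -E -subr_eq0 opprD addrA subrr sub0r oppr_eq0 -cmod_gt0 cmodR gtr0_norm.
  exists (v + t%:C); split=> //; first by rewrite addrC addKr cmodR gtr0_norm.
  rewrite addrAC; apply: le_lt_trans (cmodD _ _) _; rewrite cmodR gtr0_norm//; lra.
have nZ v : cmod (v - w) < e -> ~ Z v.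
  move=> ve [k k0 Hk]; have [z' [z1 z2 z3]] := punct v k k0 ve.
  by have := He z' z3 z2; rewrite Hk// eqxx.
by split=> [/nZ|/nZ]; [rewrite subrr cmod0 => /(_ e0)|move=> /(_ ue)].
Qed.

Lemma disc_open a r : open [set z : C | cmod (z - a) < r].
Proof.
rewrite openE => z /= za; apply/nbhs_cmod; exists (r - cmod (z - a)); first by lra.
by move=> w wz /=; have := cmod_tri z w a; lra.
Qed.

Lemma path_connected (gam : R -> C) : rcont 0 1 gam -> connected (gam @` `[0, 1]).
Proof.
move=> cg; apply: connected_continuous_connected; first exact: segment_connected.
apply/(@subspace_continuousP _ _ _ gam) => t; rewrite /= in_itv /= => t01.
apply/(@cvgrPdist_le C C _ _ _ gam (gam t)) => e e0.
have [-> e0'] := gt0_complex e0; have [d d0 H] := cg t t01 _ e0'.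
rewrite /within /=; exists d => //= s st; rewrite in_itv /= => s01.
by rewrite normcmodE lecR cmodC; apply: H => //; rewrite distrC.
Qed.

Lemma convex_connected S c f : S c ->
  (forall p q s, S p -> S q -> 0 <= s <= 1 -> S (p + s%:C * (q - p))) ->
  (forall z, S z -> ccont f z) -> connected (f @` S).
Proof.
move=> Sc cvx cf.
rewrite (_ : f @` S = \bigcup_(w in S) ((fun t : R => f (c + t%:C * (w - c))) @` `[0, 1])).
  apply: bigcup_connected.
    exists (f c) => w _ /=; exists 0; last by rewrite rmorph0 mul0r addr0.
    by rewrite /= in_itv /= lexx ler01.
  move=> w wr; apply: path_connected; apply: (@ccont_line R 0 1 c (w - c) f) => t t01.
  exact/cf/cvx.
rewrite eqEsubset; split=> z /=.
  move=> [w Sw <-]; exists w => //; exists 1; first by rewrite /= in_itv /= lexx ler01.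
  by rewrite rmorph1 mul1r addrC subrK.
move=> [w wr [t]]; rewrite /= in_itv /= => t01 <-.
by exists (c + t%:C * (w - c)) => //; exact: cvx.
Qed.

Lemma disc_connected a r : connected [set z : C | cmod (z - a) < r].
Proof.
have [r0|r0] := ltrP 0 r; last first.
  rewrite (_ : [set _ | _] = set0); first exact: connected0.
  by rewrite -subset0 => z /= zr; have := cmod_ge0 (z - a); lra.
rewrite -[X in connected X]image_id; apply: (@convex_connected _ a) => [|p q s ps qs s01|z _].
- by rewrite /= subrr cmod0.
- exact: seg_in.
- exact: ccont_id.
Qed.

End Zeros.

(** * Primitives on discs *)

Section DiscPrimitive.
Context {R : realType}.
Local Notation C := R[i].
Implicit Types (a z w h : C) (r s : R) (f g F : C -> C).

Lemma rcontM (a b : R) (f g : R -> C) : rcont a b f -> rcont a b g -> rcont a b (fun t => f t * g t).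
Proof.
move=> cf cg t tab e e0; pose A := cmod (f t) + 1; pose B := cmod (g t) + 1.
have A0 : 0 < A by have := cmod_ge0 (f t); rewrite /A; lra.
have B0 : 0 < B by have := cmod_ge0 (g t); rewrite /B; lra.
have eA : 0 < e / 2 / A by rewrite !divr_gt0.
have eB : 0 < e / 2 / B by rewrite !divr_gt0.
have [d1 d10 H1] := cf t tab _ eB; have [d2 d20 H2] := cg t tab _ eA.
have [d3 d30 H3] := cg t tab _ ltr01.
exists (Num.min d1 (Num.min d2 d3)); first by rewrite !lt_min d10 d20.
move=> s sab; rewrite !lt_min => /and3P[/(H1 s sab) h1 /(H2 s sab) h2 /(H3 s sab) h3].
have gB : cmod (g s) <= B by have := cmod_rtri (g s) (g t); rewrite /B; lra.
rewrite (_ : _ - _ = (f s - f t) * g s + f t * (g s - g t)); last by ring.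
apply: le_trans (cmodD _ _) _; rewrite !cmodM (splitr e); apply: lerD.
  apply: le_trans (ler_pM (cmod_ge0 _) (cmod_ge0 _) h1 gB) _.
  by rewrite divfK ?gt_eqF.
have fA : cmod (f t) <= A by rewrite /A; lra.
apply: le_trans (ler_pM (cmod_ge0 _) (cmod_ge0 _) fA h2) _.
by rewrite mulrC divfK ?gt_eqF.
Qed.

Lemma rcont_real (a b : R) : rcont a b (fun t : R => t%:C).
Proof.
move=> t _ e e0; exists e => // s _ /ltW.
by rewrite -rmorphB cmodR.
Qed.

Lemma quad_unif f a r s : 0 < s < r -> holoD f a r -> exists2 K : R, 0 < K &
  forall z u, cmod (z - a) <= s -> cmod u <= (r - s) / 8 ->
    cmod (f (z + u) - f z - u * cder f z) <= K * cmod u ^+ 2.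
Proof.
move=> /andP[s0 sr] hf; have rs : (r + s) / 2 < r by lra.
have [M M0 fM] := holo_bounded hf rs.
have p0 : 0 < (r - s) / 2 by lra.
exists (32 * M / ((r - s) / 2) ^+ 2); first by apply: divr_gt0; [exact: mulr_gt0|exact: exprn_gt0].
move=> z u za us.
have hz : holoD f z ((r - s) / 2) by apply: holoD_sub hf _; lra.
have := @quad_est R (z + u) f z ((r - s) / 2) M p0 hz _.
rewrite (_ : z + u - z = u); last by ring.
apply; last by lra.
by move=> w wz; apply: fM; have := cmod_tri z w a; lra.
Qed.

(** Integration along the radius from a. Differentiation under the integral sign gives I0 + (w0 - a)
    I1, which is the integral over [0, 1] of the derivative of t f(a + t (w0 - a)), hence f w0. *)
Lemma disc_primitive f a r : holoD f a r -> exists F, forall z, cmod (z - a) < r -> cdiff F z (f z).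
Proof.
move=> hf; pose p w (t : R) := a + t%:C * (w - a).
exists (fun w => (w - a) * cint 0 1 (fun t => f (p w t))) => w0 w0r e e0.
have r0 : 0 < r by have := cmod_ge0 (w0 - a); lra.
pose s := (r + cmod (w0 - a)) / 2.
have sr : 0 < s < r by have := cmod_ge0 (w0 - a); rewrite /s => ?; apply/andP; split; lra.
have [K K0 HK] := quad_unif sr hf.
have pin w t : 0 <= t <= 1 -> cmod (p w t - a) <= cmod (w - a).
  move=> /andP[t0 t1]; rewrite /p addrC addKr cmodM cmodR ger0_norm//.
  by rewrite ler_piMl ?cmod_ge0.
have cline g w : holoD g a r -> cmod (w - a) < r -> rcont 0 1 (fun t => g (p w t)).
  move=> hg wr; apply: ccont_line => t t01.
  by have [|l] := hg (p w t); [apply: le_lt_trans (pin w t t01) wr|exact: cdiff_ccont].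
have hd := cder_holo hf.
have c0 := cline f w0 hf w0r; have c1 := cline _ w0 hd w0r.
have c1t := rcontM (@rcont_real 0 1) c1.
pose I0 := cint 0 1 (fun t => f (p w0 t)).
pose I1 := cint 0 1 (fun t => t%:C * cder f (p w0 t)).
have I01 : I0 + (w0 - a) * I1 = f w0.
  rewrite /I0 /I1 -cintZ ?ler01// -cintD ?ler01//; last first.
    by apply: rcontM => // t _ e' e'0; exists 1 => // ? _ _; rewrite subrr cmod0 ltW.
  rewrite (@cintE _ 0 1 _ (fun t => t%:C * f (p w0 t)))//.
    by rewrite rmorph1 rmorph0 mul1r mul0r subr0 /p rmorph1 mul1r addrC subrK.
  move=> t t01 e' e'0.
  have tin : cmod (p w0 t - a) < r by apply: le_lt_trans (pin _ _ t01) _.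
  pose g z := (z - a) * f z.
  have [->|w0a] := eqVneq w0 a.
    exists 1 => // u _ _; rewrite /p subrr !mulr0 !addr0 mul0r addr0.
    rewrite (_ : _ - _ - _ = 0); first by rewrite cmod0 mulr_ge0 ?normr_ge0 ?(ltW e'0).
    by rewrite rmorphB /=; ring.
  have dg : cdiff g (p w0 t) (f (p w0 t) + (p w0 t - a) * cder f (p w0 t)).
    have := cdiffM (cdiffB (cdiff_id (p w0 t)) (cdiff_cst a _)) (cdiffP (hf _ tin)).
    by rewrite subr0 mul1r.
  have := @prim_line R t t a (w0 - a) g (fun z => f z + (z - a) * cder f z).
  have w0a' : 0 < cmod (w0 - a) by rewrite cmod_gt0 subr_eq0.
  have [d d0 Hd] := dg _ e'0; move=> _; exists (d / cmod (w0 - a)); first by rewrite divr_gt0.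
  move=> u _; rewrite ltr_pdivlMr// => ut; have := Hd (p w0 u).
  have E : p w0 u - p w0 t = (u - t)%:C * (w0 - a) by rewrite /p rmorphB /=; ring.
  rewrite E cmodM cmodR => /(_ ut).
  rewrite /g (_ : p w0 u - a = u%:C * (w0 - a)); last by rewrite /p addrC addKr.
  rewrite (_ : p w0 t - a = t%:C * (w0 - a)); last by rewrite /p addrC addKr.
  rewrite (_ : _ - _ - _ = (w0 - a) * (u%:C * f (p w0 u) - t%:C * f (p w0 t) -
     (u - t)%:C * (f (p w0 t) + (w0 - a) * (t%:C * cder f (p w0 t))))); last first.
    by ring.
  by move=> h; rewrite -(ler_pM2r w0a') -[leRHS]mulrA [leLHS]mulrC -cmodM.
pose B := K * (cmod (w0 - a) + 1) + cmod I1 + 1.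
have B0 : 0 < B by rewrite /B ltr_wpDl// addr_ge0 ?cmod_ge0// mulr_ge0 ?addr_ge0 ?cmod_ge0 ?ltW.
exists (Num.min 1 (Num.min ((r - s) / 8) (e / B))).
  by rewrite !lt_min ltr01 /= divr_gt0 /= ?divr_gt0//; move: sr => /andP[_]; lra.
move=> w; rewrite !lt_min => /and3P[w1 w2 w3].
set u := w - w0; have uE : w = w0 + u by rewrite /u addrC subrK.
have wr : cmod (w - a) < r.
  move: w2; have := cmod_tri w0 w a; rewrite /s; lra.
have cw := cline f w hf wr.
pose rem t := f (p w t) + (-1) * (f (p w0 t) + u * (t%:C * cder f (p w0 t))).
have cst (k : C) : rcont 0 1 (fun _ : R => k).
  by move=> t _ e' e'0; exists 1 => // ? _ _; rewrite subrr cmod0 ltW.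
have rcD (x y : R -> C) : rcont 0 1 x -> rcont 0 1 y -> rcont 0 1 (fun t => x t + y t).
  move=> cx cy t tab e' e'0; have e20 : 0 < e' / 2 by lra.
  have [d1 d10 H1] := cx t tab _ e20; have [d2 d20 H2] := cy t tab _ e20.
  exists (Num.min d1 d2); first by rewrite lt_min d10.
  move=> v vab; rewrite lt_min => /andP[/(H1 v vab) h1 /(H2 v vab) h2].
  rewrite (_ : _ - _ = (x v - x t) + (y v - y t)); last by ring.
  by apply: le_trans (cmodD _ _) _; lra.
have c2 : rcont 0 1 (fun t => u * (t%:C * cder f (p w0 t))) by apply: rcontM.
have c3 := rcD _ _ c0 c2.
have c4 : rcont 0 1 (fun t => -1 * (f (p w0 t) + u * (t%:C * cder f (p w0 t)))) by apply: rcontM.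
have Irem : cint 0 1 rem = cint 0 1 (fun t => f (p w t)) - I0 - u * I1.
  by rewrite /rem (cintD ler01 cw c4) (cintZ (-1) ler01 c3) (cintD ler01 c0 c2) (cintZ u ler01 c1t) -/I0 -/I1; ring.
have Brem : cmod (cint 0 1 rem) <= K * cmod u ^+ 2.
  have := @cint_bound R 0 1 rem (K * cmod u ^+ 2) ler01; rewrite subr0 mulr1; apply.
    exact: rcD.
  move=> t t01; rewrite /rem.
  have pE : p w t = p w0 t + t%:C * u by rewrite /p uE; ring.
  have := HK (p w0 t) (t%:C * u); rewrite -pE cmodM cmodR ger0_norm; last by case/andP: t01.
  move=> HH; have := HH _ _.
  rewrite (_ : _ - _ - _ = f (p w t) + -1 * (f (p w0 t) + u * (t%:C * cder f (p w0 t)))); last by ring.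
  have tu : t * cmod u <= cmod u by case/andP: t01 => ? ?; rewrite ler_piMl ?cmod_ge0.
  have tu0 : 0 <= t * cmod u by case/andP: t01 => ? ?; rewrite mulr_ge0 ?cmod_ge0.
  move=> HH'; apply: le_trans (HH' _ _) _.
  - by apply: le_trans (pin _ _ t01) _; rewrite /s; lra.
  - by apply: le_trans tu (ltW w2).
  by apply: ler_wpM2l; [exact: ltW|rewrite ler_pXn2r ?nnegrE ?cmod_ge0].
rewrite -/I0 (_ : _ - _ - _ = (w - a) * cint 0 1 rem + u ^+ 2 * I1); last first.
  by rewrite Irem -I01 {1 3}uE; ring.
apply: le_trans (cmodD _ _) _; rewrite [cmod (_ * cint _ _ _)]cmodM [cmod (_ * I1)]cmodM cmodX.
have u1 : cmod (w - a) <= cmod (w0 - a) + 1.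
  by have := cmod_tri w0 w a; lra.
have h1 := ler_pM (cmod_ge0 _) (cmod_ge0 _) u1 Brem.
have h2 : cmod u ^+ 2 * B <= e * cmod u.
  rewrite expr2 -mulrA mulrC; apply: ler_wpM2r; first exact: cmod_ge0.
  by rewrite -ler_pdivlMr// ltW.
apply: le_trans h2; apply: le_trans (lerD h1 (lexx _)) _.
rewrite /B; have := sqr_ge0 (cmod u); nra.
Qed.

End DiscPrimitive.

(** * Quantitative local inversion *)

Section LocalInverse.
Context {R : realType}.
Local Notation C := R[i].
Implicit Types (a z w h : C) (r s t : R) (f g F : C -> C).

Lemma closed_disc_argmin a r f : 0 <= r -> (forall z, cmod (z - a) <= r -> ccont f z) ->
  exists2 y, cmod (y - a) <= r & forall z, cmod (z - a) <= r -> cmod (f y) <= cmod (f z).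
Proof.
move=> r0 cf; apply: contrapT => no.
pose K := [set z : C | cmod (z - a) <= r].
pose S : set R := [set cmod (f z) | z in K].
have Ka : K a by rewrite /K /= subrr cmod0.
have S0 : S !=set0 by exists (cmod (f a)), a.
have lS : has_lbound S by exists 0 => _ [z _ <-]; exact: cmod_ge0.
pose m : R := inf S.
have mlt z : K z -> m < cmod (f z).
  move=> Kz; rewrite ltNge; apply/negP => zm; apply: no; exists z => // w Kw.
  by apply: le_trans zm _; apply: ge_inf => //; exists w.
have minf b : (forall z, K z -> b <= cmod (f z)) -> b <= m.
  by move=> bz; apply: lb_le_inf => // _ [z Kz <-]; exact: bz.
clearbody m; clear S S0 lS.
have [||n Hn] := @compact_unif R K (fun z n => m + n.+1%:R^-1 <= cmod (f z)) (@closed_disc_compact R a r).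
- move=> y i j ij h; apply: le_trans h; rewrite lerD2l lef_pV2 ?posrE ?ltr0n//.
  by rewrite ler_nat.
- move=> x Kx; pose k := (cmod (f x) - m) / 2.
  have k0 : 0 < k by rewrite /k divr_gt0 ?ltr0n// subr_gt0; exact: mlt.
  have [d d0 Hd] := cf x Kx _ k0; exists d => //.
  exists (Num.trunc k^-1) => y Ky /Hd h; have := cmod_rtri (f x) (f y); rewrite cmodC => h2.
  have h3 : (Num.trunc k^-1).+1%:R^-1 <= k.
    rewrite invf_ple ?posrE ?ltr0n//; exact/ltW/Num.Theory.truncnS_gt.
  have kE : k * 2 = cmod (f x) - m by rewrite /k divfK.
  by move: (_.+1%:R^-1) h3 => q h3; move: h h2 h3 kE; clear; lra.
have : m + n.+1%:R^-1 <= m by exact: minf.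
by rewrite gerDl leNgt invr_gt0 ltr0n.
Qed.

(** Hypothesis of a quantitative inverse function theorem: for nonzero l, an error factor of |l| / 2
    makes the map injective, changes distances by factors between |l| / 2 and 3 |l| / 2, and lets
    the image contain discs of comparable size. *)
Definition nearlin f a r (l : C) := forall z w, cmod (z - a) < r -> cmod (w - a) < r ->
  cmod (f w - f z - l * (w - z)) <= cmod l / 2 * cmod (w - z).

Lemma nearlin_lower f a r l : nearlin f a r l -> forall z w, cmod (z - a) < r -> cmod (w - a) < r ->
  cmod l / 2 * cmod (w - z) <= cmod (f w - f z).
Proof.
move=> nf z w zr wr; have := nf z w zr wr.
have := cmod_rtri (l * (w - z)) (l * (w - z) - (f w - f z)).
by rewrite subKr -(cmodC (f w - f z)) cmodM; lra.
Qed.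

Lemma nearlin_upper f a r l : nearlin f a r l -> forall z w, cmod (z - a) < r -> cmod (w - a) < r ->
  cmod (f w - f z) <= 3 / 2 * cmod l * cmod (w - z).
Proof.
move=> nf z w zr wr; have := nf z w zr wr.
by have := cmod_rtri (f w - f z) (l * (w - z)); rewrite cmodM; lra.
Qed.

(** A minimum of |f - u| over the closed disc is interior, since on the boundary f is too far from f
    z. At an interior point where f differs from u, a short Newton step would decrease it. *)
Lemma nearlin_surj f a r l : l != 0 -> nearlin f a r l -> (forall z, cmod (z - a) < r -> ccont f z) ->
  forall z t u, cmod (z - a) + t < r -> 0 <= t -> cmod (u - f z) < cmod l / 4 * t ->
  exists2 y, cmod (y - z) < t & f y = u.
Proof.
move=> l0 nf cf z t u zt t0 uz.
have ll : 0 < cmod l by rewrite cmod_gt0.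
have inr y : cmod (y - z) <= t -> cmod (y - a) < r by have := cmod_tri z y a; lra.
have zr : cmod (z - a) < r by apply: inr; rewrite subrr cmod0.
have [|y yt ymin] := @closed_disc_argmin z t (fun y => f y + - u) t0.
  by move=> y /inr yr; apply: ccontD; [exact: cf|exact: ccont_cst].
have fyz : cmod (f y - u) <= cmod (f z - u) by apply: ymin; rewrite subrr cmod0.
have yt' : cmod (y - z) < t.
  rewrite lt_neqAle yt andbT; apply/eqP => E.
  have := nearlin_lower nf zr (inr y yt); rewrite E.
  have := cmod_tri u (f y) (f z); rewrite (cmodC (f z) u) in fyz; lra.
exists y => //; apply/eqP; rewrite -subr_eq0; apply/negPn/negP => fyu.
set v := f y - u in fyu fyz.
have v0 : 0 < cmod v by rewrite cmod_gt0.
(* Damping of the Newton step - v / l, chosen so that it stays in the disc of radius t; half of the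
   gain q |v| survives the error allowed by [nearlin]. *)
pose q := Num.min 1 ((t - cmod (y - z)) * cmod l / cmod v).
have q0 : 0 < q by rewrite lt_min ltr01 divr_gt0// mulr_gt0// subr_gt0.
have q1 : q <= 1 by rewrite ge_min lexx.
have qs : q * cmod v / cmod l <= t - cmod (y - z).
  by rewrite ler_pdivrMr// -ler_pdivlMr// ge_min lexx orbT.
pose y1 := y - q%:C * v / l.
have dy : cmod (y1 - y) = q * cmod v / cmod l.
  by rewrite /y1 addrC addKr cmodN cmod_div cmodM cmodR gtr0_norm.
have y1t : cmod (y1 - z) <= t by have := cmod_tri y y1 z; rewrite dy; lra.
have := ymin y1 y1t; rewrite -/v leNgt => /negP; apply.
have := nf y y1 (inr y yt) (inr y1 y1t); rewrite dy => H.
rewrite (_ : f y1 + - u = (f y1 - f y - l * (y1 - y)) + (1 - q)%:C * v); last first.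
  by rewrite /y1 /v rmorphB rmorph1; field.
apply: le_lt_trans (cmodD _ _) _; rewrite cmodM cmodR ger0_norm ?subr_ge0//.
have E : cmod l / 2 * (q * cmod v / cmod l) = q * cmod v / 2 by field; rewrite gt_eqF.
rewrite E in H; have : 0 < q * cmod v by rewrite mulr_gt0.
lra.
Qed.

Lemma nearlin_near f a r : 0 < r -> holoD f a r -> cder f a != 0 ->
  exists2 d : R, 0 < d <= r & nearlin f a d (cder f a).
Proof.
move=> r0 hf l0; have [|k dk] := cder_holo hf (z := a); first by rewrite subrr cmod0.
have [|d d0 Hd] := cdiff_ccont dk (e := cmod (cder f a) / 2); first by rewrite divr_gt0 ?cmod_gt0 ?ltr0n.
exists (Num.min d r); first by rewrite lt_min d0 r0 ge_min lexx orbT.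
apply: linear_approx.
  by apply: holoD_sub hf _; rewrite subrr cmod0 add0r ge_min lexx orbT.
by move=> z; rewrite lt_min => /andP[/Hd].
Qed.

Lemma inverse_cdiff f g a l : l != 0 -> cdiff f a l -> ccont g (f a) -> g (f a) = a ->
  (exists2 d : R, 0 < d & forall u, cmod (u - f a) < d -> f (g u) = u) ->
  cdiff g (f a) l^-1.
Proof.
move=> l0 /cdiff_factor[q [cq ql fE]] cg ga [d d0 fg].
have q0 : q (g (f a)) != 0 by rewrite ga ql.
have cqg : ccont (fun u => q (g u)) (f a) by apply: ccont_comp => //; rewrite ga.
have [d' d'0 Hq] := ccont_neq0 q0 cqg.
apply: (@cdiff_near _ (fun u => g (f a) + (u - f a) * (q (g u))^-1)).
  exists (Num.min d d'); first by rewrite lt_min d0.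
  move=> u; rewrite lt_min => /andP[/fg fgu /Hq[_ qu]].
  have E : u - f a = (g u - a) * q (g u) by rewrite -{1}fgu (fE (g u)); ring.
  by rewrite E mulfK// ga addrC subrK.
apply/cdiff_factor; exists (fun u => (q (g u))^-1); split.
- exact: ccontV.
- by rewrite ga ql.
- by move=> w; rewrite subrr mul0r addr0.
Qed.

End LocalInverse.

(** * Exponential and logarithms *)

Section Exponential.
Context {R : realType}.
Local Notation C := R[i].
Implicit Types (a z w h : C) (r s t : R) (f g F : C -> C).

Definition cexp z : C := (expR (complex.Re z))%:C * ((cos (complex.Im z))%:C + (sin (complex.Im z))%:C * 'i%C).

Lemma cexpD z w : cexp (z + w) = cexp z * cexp w.
Proof.
case: z w => x y [u v]; rewrite /cexp /= expRD cosD sinD !rmorphB !rmorphD !rmorphM /=.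
have : 'i%C * 'i%C = -1 :> C by rewrite -expr2 sqr_i.
move: 'i%C (expR x)%:C (expR u)%:C (cos y)%:C (cos v)%:C (sin y)%:C (sin v)%:C => i e1 e2 c1 c2 s1 s2 ii.
transitivity (e1 * e2 * (c1 * c2 + (i * i) * (s1 * s2) + (s1 * c2 + c1 * s2) * i)); last by ring.
by rewrite ii; ring.
Qed.

Lemma cexp0 : cexp 0 = 1.
Proof. by rewrite /cexp /= expR0 cos0 sin0 rmorph0 mul0r addr0 rmorph1 mulr1. Qed.

Lemma cmod_cexp z : cmod (cexp z) = expR (complex.Re z).
Proof.
rewrite /cexp cmodM cmodR ger0_norm ?expR_ge0// (_ : cmod _ = 1) ?mulr1//.
rewrite /cmod /= (_ : _ + _ = 1) ?sqrtr1//.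
by rewrite !(mulr0, mul0r, mulr1, subr0, add0r, addr0) cos2Dsin2.
Qed.

Lemma cexp_2pi z : cexp (z + (2 * pi)%:C * 'i%C) = cexp z.
Proof.
have -> : (2 * pi)%:C * 'i%C = (0 +i* (2 * pi) : C).
  by apply/eqP; rewrite eq_complex /=; apply/andP; split; apply/eqP; ring.
rewrite cexpD [cexp (_ +i* _)](_ : _ = 1) ?mulr1// /cexp /= expR0.
rewrite (_ : 2 * pi = pi *+ 2); last by rewrite mulr2n; ring.
by rewrite cos2pi sin2pi rmorph0 mul0r addr0 rmorph1 mulr1.
Qed.

Lemma cexp_diff0 : cdiff cexp 0 1.
Proof.
move=> e e0; pose k := Num.min (1 / 4) (e / 8).
have k0 : 0 < k by rewrite lt_min; apply/andP; split; lra.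
have k4 : k <= 1 / 4 by rewrite ge_min lexx.
have k8 : k <= e / 8 by rewrite ge_min lexx orbT.
clearbody k.
have E (f : R -> R) (x l : R) : is_derive x 1 f l -> exists2 d : R, 0 < d & forall h : R, `|h| < d -> `|f (h + x) - f x - h * l| <= k * `|h|.
  by move=> [df <-]; exact: derivable_eps.
have [d1 d10 H1] := E _ _ _ (is_derive_expR 0).
have [d2 d20 H2] := E _ _ _ (is_derive_cos 0).
have [d3 d30 H3] := E _ _ _ (is_derive_sin 0).
exists (Num.min k (Num.min d1 (Num.min d2 d3))); first by rewrite !lt_min k0 d10 d20.
move=> w; rewrite subr0 !lt_min => /and4P[wk w1 w2 w3].
have hx := cmod_Re w; have hy := cmod_Im w.
have := H1 _ (le_lt_trans hx w1); have := H2 _ (le_lt_trans hy w2); have := H3 _ (le_lt_trans hy w3).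
rewrite !addr0 sin0 cos0 expR0 oppr0 !mulr0 !mulr1 ?oppr0 ?subr0 ?addr0 cexp0.
rewrite /cexp; move: hx hy; rewrite -/(cmod w).
set x := complex.Re w; set y := complex.Im w => hx hy hs hc he.
have -> : (expR x)%:C * ((cos y)%:C + (sin y)%:C * 'i%C) - 1 - w =
   (expR x * cos y - 1 - x)%:C + (expR x * sin y - y)%:C * 'i%C.
  by rewrite {1}[w]complexE -/x -/y !rmorphB !rmorphM rmorph1 /=; ring.
apply: le_trans (cmodD _ _) _; rewrite cmodM cmodI mulr1 !cmodR.
have [x0 y0] : 0 <= `|x| /\ 0 <= `|y| by [].
have ex2 : `|expR x| <= 2.
  have := ler_normD (expR x - 1 - x) (1 + x); rewrite (_ : _ + (1 + x) = expR x); last by ring.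
  by have := ler_normD 1 x; rewrite normr1; move: wk hx k4 he; clear -x0 k0; nra.
have b1 : `|expR x * cos y - 1 - x| <= k * `|x| + 2 * (k * `|y|).
  rewrite (_ : _ - x = (expR x - 1 - x) + expR x * (cos y - 1)); last by ring.
  apply: le_trans (ler_normD _ _) _; rewrite normrM; apply: lerD => //.
  exact: ler_pM.
have b2 : `|expR x * sin y - y| <= (2 * k) * `|y| + 2 * (k * `|y|).
  rewrite (_ : _ - y = (expR x - 1) * y + expR x * (sin y - y)); last by ring.
  apply: le_trans (ler_normD _ _) _; rewrite !normrM; apply: lerD; last exact: ler_pM.
  apply: ler_wpM2r => //.
  have := ler_normD (expR x - 1 - x) x; rewrite subrK; move: wk hx k4 he; clear -x0 k0; nra.
apply: le_trans (lerD b1 b2) _.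
have : k * cmod w <= e / 8 * cmod w by apply: ler_wpM2r; rewrite ?cmod_ge0.
have : k * `|x| <= k * cmod w by apply: ler_wpM2l; rewrite ?(ltW k0).
have : k * `|y| <= k * cmod w by apply: ler_wpM2l; rewrite ?(ltW k0).
have : 0 <= e * cmod w by rewrite mulr_ge0 ?cmod_ge0 ?(ltW e0).
clear; lra.
Qed.

Lemma cexp_diff z : cdiff cexp z (cexp z).
Proof.
have d0 : cdiff (fun w => w - z) z 1.
  by have := cdiffB (cdiff_id z) (cdiff_cst z z); rewrite subr0.
have := cexp_diff0; rewrite -{1}(subrr z) => d1.
have := cdiffZ (cexp z) (cdiff_comp d0 d1); rewrite !mulr1.
by apply: cdiff_ext => w; rewrite -cexpD addrC subrK.
Qed.

(** L is a primitive of F' / F, and F exp(-L) has derivative 0 on the disc. *)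
Lemma disc_log F a r : holoD F a r -> (forall z, cmod (z - a) < r -> F z != 0) ->
  exists L, [/\ L a = 0,
    forall z, cmod (z - a) < r -> F z = F a * cexp (L z) &
    forall z, cmod (z - a) < r -> cdiff L z (cder F z / F z)].
Proof.
move=> hF F0.
have [|G dG] := @disc_primitive R (fun z => cder F z * (F z)^-1) a r.
  move=> z zr; have [l dl] := cder_holo hF zr; have [m dm] := hF z zr.
  by eexists; exact: (cdiffM dl (cdiffV (F0 z zr) dm)).
have dL z : cmod (z - a) < r -> cdiff (fun z => G z - G a) z (cder F z / F z).
  by move=> zr; have := cdiffB (dG z zr) (cdiff_cst (G a) z); rewrite subr0.
exists (fun z => G z - G a); split=> //; first by rewrite subrr.
move=> z zr.
pose H z := F z * cexp (- (G z - G a)).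
have dH w : cmod (w - a) < r -> cdiff H w 0.
  move=> wr; have := cdiffM (cdiffP (hF w wr)) (cdiff_comp (cdiffN (dL w wr)) (cexp_diff _)).
  by congr cdiff; field; exact: F0.
have r0 : 0 < r by have := cmod_ge0 (z - a); lra.
have := @lip_disc R H a r 0 _ _ a z; rewrite mul0r subrr cmod0 => HH.
have {}HH : cmod (H z - H a) <= 0.
  by apply: HH => // w wr; [exists 0; exact: dH|rewrite (cderE (dH w wr)) cmod0].
have /eqP : cmod (H z - H a) == 0 by rewrite eq_le HH cmod_ge0.
move=> /eqP; rewrite cmod_eq0 subr_eq0 /H subrr oppr0 cexp0 mulr1 => /eqP <-.
by rewrite -mulrA -cexpD addrC subrr cexp0 mulr1.
Qed.

End Exponential.

(** * Univalent functions *)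

Section Univalent.
Context {R : realType}.
Local Notation C := R[i].
Implicit Types (a z w h u : C) (r s t : R) (f g F : C -> C) (S : set C).

Definition isopen S := forall z, S z -> exists2 d : R, 0 < d & forall w, cmod (w - z) < d -> S w.
Definition univ S f := (forall z, S z -> exists l, cdiff f z l) /\
  (forall z w, S z -> S w -> f z = f w -> z = w).

Lemma addKB (x y : C) : x + y - x = y.
Proof. by rewrite addrAC subrr add0r. Qed.

Lemma isopenP S : isopen S <-> open S.
Proof.
rewrite openE; split=> oS z Sz; first by apply/nbhs_cmod; exact: oS.
by apply/nbhs_cmod; exact: oS.
Qed.

Lemma isopen_disc a r : isopen [set z | cmod (z - a) < r].
Proof. by apply/isopenP; exact: disc_open. Qed.

Lemma cexpX z n : cexp (n%:R * z) = cexp z ^+ n.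
Proof.
elim: n => [|n IH]; first by rewrite mul0r cexp0 expr0.
by rewrite -natr1 mulrDl mul1r cexpD IH exprSr.
Qed.

(** Any root of 1 + X + ... + X^(n+1) will do: this polynomial has the value n + 2 at 1. *)
Lemma nontrivial_unity_root n : exists2 x : C, x ^+ n.+2 = 1 & x != 1.
Proof.
pose p : {poly C} := \poly_(i < n.+2) 1.
have sp : size p = n.+2 by rewrite size_poly_eq ?oner_neq0.
have /closed_rootP[x] : size p != 1%N by rewrite sp.
rewrite /root horner_poly => /eqP px; exists x.
  apply/eqP; rewrite -subr_eq0 subrX1 (eq_bigr (fun i : 'I_n.+2 => 1 * x ^+ i)) ?px ?mulr0// => i _.
  by rewrite mul1r.
apply/eqP => x1; move: px; rewrite x1.
under eq_bigr do rewrite expr1n mulr1.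
by rewrite sumr_const card_ord => /eqP; rewrite pnatr_eq0.
Qed.

(** If f - f a vanishes to order k >= 2 at a, it is near a the k-th power of a function [zt] with a
    simple zero. By local surjectivity [zt] takes the values e and x e for a nontrivial k-th root of
    unity x, so f takes one value twice. *)
Lemma univ_der_neq0_disc a r f : 0 < r -> univ [set z | cmod (z - a) < r] f -> cder f a != 0.
Proof.
move=> r0 [hf inj].
have aD : cmod (a - a) < r by rewrite subrr cmod0.
pose g z := f z - f a.
have hg : holoD g a r by move=> z /hf[l dl]; exists (l - 0); exact: cdiffB dl (cdiff_cst _ _).
have [[d d0 gd]|[k [c [c' [d [K [c0 d0 K0 H]]]]]]] := zeros_local r0 hg.
  pose t := Num.min d r / 2; have t0 : 0 < t by rewrite divr_gt0// lt_min d0.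
  have td : t < d by have : Num.min d r <= d by [rewrite ge_min lexx]; rewrite /t; move: d0 r0 t0; rewrite /t; lra.
  have tr : t < r by have : Num.min d r <= r by [rewrite ge_min lexx orbT]; move: d0 r0 t0; rewrite /t; lra.
  have E : cmod (a + t%:C - a) = t by rewrite addKB cmodR gtr0_norm.
  exfalso; have := gd (a + t%:C); rewrite E => /(_ td)/eqP; rewrite subr_eq0 => /eqP/inj.
  rewrite /= E subrr cmod0 => /(_ tr r0) /eqP; rewrite -subr_eq0 addKB -cmod_eq0 cmodR gtr0_norm//.
  by rewrite gt_eqF.
have [k1|k1] := leqP k 1.
  case: k k1 H => [_|[_|//]] H.
    have := H a; rewrite subrr cmod0 => /(_ d0); rewrite !expr0n /= /g subrr mulr1 !mulr0 subr0 sub0r cmodN.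
    by move: c0; rewrite -cmod_gt0 => h1 h2; exfalso; move: h1 h2; lra.
  suff -> : cder f a = c by [].
  apply: cderE => e e0.
  pose B := K * d + cmod c' + 1.
  have B0 : 0 < B by rewrite /B ltr_wpDl// addr_ge0 ?cmod_ge0// mulr_ge0 ?ltW.
  exists (Num.min d (e / B)); first by rewrite lt_min d0 divr_gt0.
  move=> w; rewrite lt_min => /andP[wd we]; have := H w wd.
  have := cmod_rtri (g w - c * (w - a) ^+ 1) (c' * (w - a) ^+ 2).
  rewrite cmodM cmodX !expr1 (mulrC c) -/g => h1 h2.
  apply: (@le_trans _ _ (B * cmod (w - a) * cmod (w - a))); last first.
    by apply: ler_wpM2r; rewrite ?cmod_ge0// mulrC -ler_pdivlMr// ltW.
  have h3 : K * cmod (w - a) ^+ 3 <= K * d * cmod (w - a) ^+ 2.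
    rewrite exprS mulrA; apply: ler_wpM2r; first by rewrite exprn_ge0 ?cmod_ge0.
    by rewrite ler_pM2l// ltW.
  have -> : B * cmod (w - a) * cmod (w - a) = K * d * cmod (w - a) ^+ 2 + cmod c' * cmod (w - a) ^+ 2 + cmod (w - a) ^+ 2 by rewrite /B; ring.
  have h4 := sqr_ge0 (cmod (w - a)).
  by move: h1 h2 h3 h4; rewrite /g; clear; lra.
exfalso.
have [n kE] : exists n, k = n.+2 by exists k.-2; rewrite -[LHS](ltn_predK k1) -[in LHS](@ltn_predK 0 k.-1)// -ltnS (ltn_predK k1).
pose v z := if z == a then c else g z / (z - a) ^+ k.
have gv z : g z = v z * (z - a) ^+ k.
  rewrite /v; case: eqVneq => [->|za]; first by rewrite /g !subrr kE expr0n mulr0.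
  by rewrite divfK// expf_neq0 ?subr_eq0.
have dv : forall z, cmod (z - a) < r -> exists l, cdiff v z l.
  move=> z zr; have [->|za] := eqVneq z a.
    (* At a itself the derivative of the quotient is the next Taylor coefficient. *)
    exists c' => e e0.
    exists (Num.min d (e / K)); first by rewrite lt_min d0 divr_gt0.
    move=> w; rewrite lt_min => /andP[wd we]; have := H w wd.
    have [->|wa] := eqVneq w a; first by rewrite !subrr mul0r subr0 cmod0 mulr0.
    have wa0 : 0 < cmod (w - a) by rewrite cmod_gt0 subr_eq0.
    rewrite gv {3}/v eqxx.
    rewrite (_ : _ - _ - _ = (v w - c - (w - a) * c') * (w - a) ^+ k); last by rewrite exprS; ring.
    rewrite cmodM cmodX 2!exprS 2!mulrA ler_pM2r ?exprn_gt0// => h.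
    apply: le_trans h _; apply: ler_wpM2r; first exact: ltW.
    by rewrite mulrC -ler_pdivlMr// ltW.
  have [l dl] := hg z zr.
  have dp : cdiff (fun z => (z - a) ^+ k) z (k%:R * (z - a) ^+ k.-1 * 1).
    have d1 : cdiff (fun z => z - a) z 1 by have := cdiffB (cdiff_id z) (cdiff_cst a z); rewrite subr0.
    by have := cdiff_comp d1 (cdiffXn (z - a) k.-1); rewrite kE.
  have zk : (z - a) ^+ k != 0 by rewrite expf_neq0 ?subr_eq0.
  have := cdiffM dl (@cdiffV _ (fun z => (z - a) ^+ k) z _ zk dp) => dd; eexists; apply: cdiff_near dd.
  exists (cmod (z - a)); first by rewrite cmod_gt0 subr_eq0.
  move=> w wz; rewrite /v ifN//; apply: contraTneq wz => ->.
  by rewrite cmodC ltxx.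
have va : v a = c by rewrite /v eqxx.
have [m dm] := dv a aD.
have [|d1 d10 v0] := @ccont_neq0 _ v a _ (cdiff_ccont dm); first by rewrite va.
pose q := Num.min r d1.
have q0 : 0 < q by rewrite lt_min r0.
have qr : q <= r by rewrite ge_min lexx.
have qd : q <= d1 by rewrite ge_min lexx orbT.
have hv : holoD v a q by move=> z zq; apply: dv; apply: lt_le_trans zq qr.
have [|L [La vL dL]] := @disc_log R v a q hv.
  by move=> z zq; have [] := v0 z (lt_le_trans zq qd).
pose c0k := k.-root c.
have ckE : c0k ^+ k = c by rewrite rootCK// kE.
have c0k0 : c0k != 0 by apply: contra_neq c0 => E; rewrite -ckE E kE expr0n.
have kn0 : k%:R != 0 :> C by rewrite pnatr_eq0 kE.
(* A k-th root of g, built from a root of c and the logarithm L of v / c. *)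
pose zt z := (z - a) * (c0k * cexp (L z / k%:R)).
have dzt z : cmod (z - a) < q -> exists l, cdiff zt z l.
  move=> zq; eexists; apply: cdiffM; first exact: cdiffB (cdiff_id z) (cdiff_cst a z).
  apply: cdiffZ; apply: cdiff_comp; last exact: cexp_diff.
  by apply: cdiffM; [exact: dL|exact: cdiff_cst].
have ztk z : cmod (z - a) < q -> g z = zt z ^+ k.
  move=> zq; have E : cexp (L z / k%:R) ^+ k = cexp (L z) by rewrite -cexpX mulrC divfK.
  by rewrite gv vL// va /zt 2!exprMn ckE E mulrC.
have dzta : cder zt a = c0k.
  apply: cderE; have aq : cmod (a - a) < q by rewrite subrr cmod0.
  have [l dl] : exists l, cdiff (fun z => c0k * cexp (L z / k%:R)) a l.
    eexists; apply: cdiffZ; apply: cdiff_comp; last exact: cexp_diff.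
    by apply: cdiffM; [exact: dL|exact: cdiff_cst].
  have := cdiffM (cdiffB (cdiff_id a) (cdiff_cst a a)) dl.
  by rewrite subr0 mul1r subrr mul0r addr0 La mul0r cexp0 mulr1.
have [|p /andP[p0 pq] nl] := nearlin_near q0 dzt; first by rewrite dzta.
rewrite dzta in nl.
have cz z : cmod (z - a) < p -> ccont zt z.
  by move=> zp; have [|l] := dzt z; [exact: lt_le_trans zp pq|exact: cdiff_ccont].
have zta : zt a = 0 by rewrite /zt subrr mul0r.
have c0p : 0 < cmod c0k by rewrite cmod_gt0.
have hit y : cmod y < cmod c0k / 4 * (p / 2) -> exists2 z, cmod (z - a) < p / 2 & zt z = y.
  move=> yp; apply: (nearlin_surj c0k0 nl cz); rewrite ?zta ?subr0 ?subrr ?cmod0//.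
    by clear -p0; lra.
  by clear -p0; lra.
have [x xk x1] := nontrivial_unity_root n.
have x_1 : cmod x = 1.
  apply/eqP; rewrite -(@pexpr_eq1 _ _ n.+2)// ?cmod_ge0// -cmodX xk cmod1//.
pose e := cmod c0k / 4 * (p / 2) / 2.
have e0 : 0 < e by rewrite /e !(divr_gt0, mulr_gt0).
have ep : e < cmod c0k / 4 * (p / 2) by move: e0; rewrite /e; clear; lra.
have [z1 z1p E1] : exists2 z, cmod (z - a) < p / 2 & zt z = e%:C by apply: hit; rewrite cmodR gtr0_norm.
have [z2 z2p E2] : exists2 z, cmod (z - a) < p / 2 & zt z = x * e%:C.
  by apply: hit; rewrite cmodM x_1 mul1r cmodR gtr0_norm.
have pq2 : p / 2 < q by clear -p0 pq; lra.
have pr2 : p / 2 < r by clear -p0 pq qr; lra.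
have : g z1 = g z2.
  by rewrite !ztk ?(lt_trans z1p)// ?(lt_trans z2p)// E1 E2 exprMn kE xk mul1r.
rewrite /g => /addIr/inj /= /(_ (lt_trans z1p pr2) (lt_trans z2p pr2)) zz.
move: E2; rewrite -zz E1 => /eqP; rewrite -subr_eq0 -{1}[e%:C]mul1r -mulrBl mulf_eq0 subr_eq0 eq_sym (negPf x1).
by rewrite -cmod_eq0 cmodR gtr0_norm// gt_eqF.
Qed.

Lemma univ_sub S T f : T `<=` S -> univ S f -> univ T f.
Proof.
move=> TS [df inj]; split; first by move=> z /TS; exact: df.
by move=> z w /TS Sz /TS Sw; exact: inj.
Qed.

Lemma univ_der_neq0 S f z : isopen S -> univ S f -> S z -> cder f z != 0.
Proof.
move=> oS uf Sz; have [d d0 Hd] := oS z Sz.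
by apply: (@univ_der_neq0_disc z d) => //; apply: univ_sub uf => w; exact: Hd.
Qed.

Lemma univ_open S f z t : isopen S -> univ S f -> S z -> 0 < t ->
  exists2 p : R, 0 < p & forall u, cmod (u - f z) < p -> exists y, [/\ cmod (y - z) < t, S y & f y = u].
Proof.
move=> oS uf Sz t0; have [d d0 Hd] := oS z Sz.
have l0 := univ_der_neq0 oS uf Sz.
have hf : holoD f z d by move=> w /Hd; exact: uf.1.
have [q /andP[q0 qd] nl] := nearlin_near d0 hf l0.
have cf w : cmod (w - z) < q -> ccont f w.
  by move=> wq; have [|l] := hf w; [exact: lt_le_trans wq qd|exact: cdiff_ccont].
have l1 : 0 < cmod (cder f z) by rewrite cmod_gt0.
pose tt := Num.min (q / 2) t.
have tt0 : 0 < tt by rewrite lt_min t0 andbT divr_gt0.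
have ttq : tt <= q / 2 by rewrite ge_min lexx.
have ttt : tt <= t by rewrite ge_min lexx orbT.
exists (cmod (cder f z) / 4 * tt); first by rewrite mulr_gt0// divr_gt0.
move=> u up; have [||y yt fy] := nearlin_surj l0 nl cf (z := z) (t := tt) _ _ up.
- by rewrite subrr cmod0; move: q0 ttq; clear; lra.
- exact: ltW.
exists y; split=> //; first exact: lt_le_trans yt ttt.
by apply: Hd; move: yt ttq q0 qd; clear; lra.
Qed.

Lemma univ_inv S f g y : isopen S -> univ S f -> S y -> g (f y) = y ->
  (exists2 d : R, 0 < d & forall u, cmod (u - f y) < d -> S (g u) /\ f (g u) = u) ->
  cdiff g (f y) (cder f y)^-1.
Proof.
move=> oS uf Sy gy [d d0 Hd]; have l0 := univ_der_neq0 oS uf Sy.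
apply: (inverse_cdiff l0) => //; last by exists d => // u /Hd[].
- by apply: cdiffP; exact: uf.1.
- move=> e e0; have [p p0 Hp] := univ_open oS uf Sy e0.
  exists (Num.min d p); first by rewrite lt_min d0.
  move=> u; rewrite lt_min gy => /andP[/Hd[Sg fg] /Hp[w [wy Sw fw]]].
  by rewrite (_ : g u = w) ?ltW//; apply: uf.2 => //; rewrite fg.
Qed.

End Univalent.

(** * Bloch's theorem and the distortion of univalent functions *)

Section Distortion.
Context {R : realType}.
Local Notation C := R[i].
Implicit Types (a z w h u : C) (r s t : R) (f g F L : C -> C) (S : set C).

(* Landau's form of Bloch's theorem: a large derivative at an almost extremal
   point of (s - |z - a|) |L'(z)| forces a large schlicht disc in the image. *)
Lemma bloch_bound L a r (D : R) : 0 < D -> holoD L a r ->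
  (forall z0, cmod (z0 - a) < r ->
     ~ forall u, cmod (u - L z0) < D -> exists2 y, cmod (y - a) < r & L y = u) ->
  forall z, cmod (z - a) < r -> cmod (cder L z) * (r - cmod (z - a)) <= 16 * 16 * 16 * 2 * D.
Proof.
move=> D0 hL nodisc z zr; set K := 16 * 16 * 16 * 2 * D.
have K0 : 0 < K by rewrite /K !mulr_gt0.
have KE : K / 2 = D * (16 * 16 * 16) by rewrite /K; field.
clearbody K.
(* On the smaller radius s the derivative is bounded, so the supremum below is finite; s then tends
   to r. *)
suff H s : cmod (z - a) < s -> s < r -> cmod (cder L z) * (s - cmod (z - a)) <= K.
  rewrite leNgt; apply/negP => KL.
  have l0 : 0 < cmod (cder L z).
    rewrite lt_neqAle cmod_ge0 andbT; apply/eqP => E; move: KL; rewrite -E mul0r.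
    by move: K0; clear; lra.
  pose e := (cmod (cder L z) * (r - cmod (z - a)) - K) / 2 / cmod (cder L z).
  have e0 : 0 < e by rewrite /e !divr_gt0// subr_gt0.
  have ee : cmod (cder L z) * e = (cmod (cder L z) * (r - cmod (z - a)) - K) / 2.
    by rewrite /e mulrC divfK ?gt_eqF.
  pose k := Num.min e ((r - cmod (z - a)) / 2).
  have k0 : 0 < k by rewrite lt_min e0; move: zr; clear; lra.
  have ke : k <= e by rewrite ge_min lexx.
  have kr : k <= (r - cmod (z - a)) / 2 by rewrite ge_min lexx orbT.
  clearbody k.
  have := H (r - k); have -> : cmod (z - a) < r - k by move: zr kr; clear; lra.
  have -> : r - k < r by move: k0; clear; lra.
  move=> /(_ isT isT); have : cmod (cder L z) * k <= cmod (cder L z) * e by rewrite ler_pM2l.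
  rewrite ee; move: KL; clear; lra.
move=> zs sr.
have hd := cder_holo hL.
have [M M0 dM] := holo_bounded hd sr.
pose P w := cmod (cder L w) * (s - cmod (w - a)).
pose Z : set R := [set P w | w in [set w | cmod (w - a) <= s]].
have hZ : has_sup Z.
  split; first by exists (P z), z => //; exact: ltW.
  exists (M * s) => _ [w /= ws <-]; apply: ler_pM; rewrite ?cmod_ge0 ?subr_ge0 ?dM//.
  by have := cmod_ge0 (w - a); clear; lra.
have PZ w : cmod (w - a) <= s -> P w <= sup Z.
  by move=> ws; apply: ub_le_sup; [exact: hZ.2|exists w].
set m := sup Z in PZ.
rewrite leNgt; apply/negP => KP.
have Km : K < m by apply: lt_le_trans KP (PZ z (ltW zs)).
have m2 : 0 < m / 2 by move: K0 Km; clear; lra.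
have [_ [z1 z1s <-] Pz1] := sup_adherent m2 hZ; rewrite -/m in Pz1.
have {Pz1} Pz1 : m / 2 < P z1 by move: Pz1; clear; lra.
clearbody m; clear Z hZ M M0 dM.
(* z1 is extremal up to a factor 2. On the disc of radius t, half of the remaining distance, the
   weight s - |w - a| is at least t, so the derivative is at most 4 l there. *)
pose l := cmod (cder L z1); pose t := (s - cmod (z1 - a)) / 2.
have t0 : 0 < t.
  rewrite /t divr_gt0// subr_gt0 lt_neqAle z1s andbT; apply/eqP => E.
  by move: Pz1; rewrite /P E subrr mulr0; move: m2; clear; lra.
have Pl : P z1 = l * (2 * t) by rewrite /P -/l /t; field.
have l0 : 0 < l.
  rewrite lt_neqAle cmod_ge0 andbT; apply/eqP => E; move: Pz1; rewrite Pl -E mul0r.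
  by move: m2; clear; lra.
have dl w : cmod (w - z1) < t -> cmod (cder L w) <= 4 * l.
  move=> wt; have wa : t <= s - cmod (w - a).
    by have := cmod_tri z1 w a; move: wt; rewrite /t; clear; lra.
  have ws : cmod (w - a) <= s by move: wa t0; clear; lra.
  have h1 := PZ w ws.
  have h2 : cmod (cder L w) * t <= P w by rewrite /P; exact: (ler_wpM2l (cmod_ge0 _) wa).
  rewrite -(ler_pM2r t0); move: h1 h2 Pz1; rewrite Pl; clear; lra.
have z1r : cmod (z1 - a) + 2 * t = s by rewrite /t; field.
have hdt : holoD (cder L) z1 t by apply: holoD_sub hd _; move: sr z1r t0; clear; lra.
have t20 : 0 < t / 2 by move: t0; clear; lra.
have ddl w : cmod (w - z1) < t / 2 -> cmod (cder (cder L) w) <= 16 * 8 * l / t.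
  move=> wt; have hw : holoD (cder L) w (t / 2) by apply: holoD_sub hdt _; move: wt; clear; lra.
  have := cauchy_est t20 hw (M := 4 * l); rewrite (_ : 16 * (4 * l) / (t / 2) = 16 * 8 * l / t); last first.
    by field; rewrite gt_eqF.
  by apply=> v vw; apply: dl; have := cmod_tri w v z1; move: wt vw; clear; lra.
(* Cauchy's estimate bounds the second derivative by 128 l / t on half of that disc, so the first
   one varies by at most l / 2 over the radius q and [nearlin] applies. *)
pose q := t / (16 * 16).
have q0 : 0 < q by rewrite divr_gt0// mulr_gt0.
have q2 : q <= t / 2 by rewrite /q; move: t0; clear; lra.
have hdt2 : holoD (cder L) z1 (t / 2) by apply: holoD_sub hdt _; rewrite subrr cmod0; move: t0; clear; lra.
have zz : cmod (z1 - z1) < t / 2 by rewrite subrr cmod0.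
have nl : nearlin L z1 q (cder L z1).
  apply: linear_approx.
    by apply: holoD_sub hL _; move: q2 z1r sr t0; clear; lra.
  move=> w wq; apply: le_trans (lip_disc hdt2 ddl zz (lt_le_trans wq q2)) _.
  rewrite -/l; apply: (@le_trans _ _ (16 * 8 * l / t * q)).
    apply: ler_wpM2l; last exact: ltW.
    by apply: divr_ge0; [apply: mulr_ge0; [exact: mulr_ge0|exact: ltW]|exact: ltW].
  by rewrite /q le_eqVlt; apply/orP; left; apply/eqP; field; rewrite gt_eqF.
have Lc w : cmod (w - z1) < q -> ccont L w.
  move=> wq; have [|k] := hL w; last exact: cdiff_ccont.
  by have := cmod_tri z1 w a; move: wq q2 z1r sr t0; clear; lra.
have lz : cder L z1 != 0 by rewrite -cmod_gt0.
apply: (nodisc z1); first by move: z1r sr t0; clear; lra.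
move=> u ud.
have [|||y yq yu] := nearlin_surj lz nl Lc (z := z1) (t := q / 2) (u := u).
- by rewrite subrr cmod0; move: q0; clear; lra.
- by move: q0; clear; lra.
- apply: lt_le_trans ud _; rewrite -/l.
  have : K / 2 <= l * (2 * t) by rewrite -Pl; move: Km Pz1; clear; lra.
  rewrite (_ : l / 4 * (q / 2) = l * (2 * t) / (16 * 16 * 16)); last by rewrite /q; field.
  rewrite KE.
  by rewrite -ler_pdivlMr// !mulr_gt0.
exists y => //; have := cmod_tri z1 y a; move: yq q2 z1r sr t0 q0; clear; lra.
Qed.

Lemma pi_lt4 : pi < 4 :> R.
Proof. by have := @pihalf_lt2 R; lra. Qed.

(* Cauchy's estimate for the inverse of f bounds the discs contained in its image. *)
Lemma univ_omits f a r : 0 < r -> univ [set z | cmod (z - a) < r] f ->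
  exists2 w0, cmod (w0 - f a) < 17 * r * cmod (cder f a) &
    forall z, cmod (z - a) < r -> f z != w0.
Proof.
move=> r0 uf; apply: contrapT => no.
have oD := @isopen_disc R a r.
have aD : [set z | cmod (z - a) < r] a by rewrite /= subrr cmod0.
have l0 := univ_der_neq0 oD uf aD.
have l1 : 0 < cmod (cder f a) by rewrite cmod_gt0.
(* 17 exceeds the constant 16 of Cauchy's estimate: an image disc of this radius would bound 1 /
   |f'(a)| by 16 / 17 of itself. *)
pose p := 17 * r * cmod (cder f a).
have p0 : 0 < p by rewrite /p !mulr_gt0.
have ex u : exists y, cmod (u - f a) < p -> cmod (y - a) < r /\ f y = u.
  have [up|up] := pselect (cmod (u - f a) < p); last by exists a.
  apply: contrapT => nu; apply: no; exists u => // z zr; apply/eqP => fz.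
  by apply: nu; exists z => _; split.
have [g Hg] := choice ex.
have gfa : g (f a) = a.
  have [|h1 h2] := Hg (f a); first by rewrite subrr cmod0.
  by apply: uf.2 => //.
have hg : holoD g (f a) p.
  move=> u up; have [gu fgu] := Hg u up.
  have := univ_inv oD uf gu (g := g); rewrite fgu => /(_ erefl) H; eexists; apply: H.
  exists (p - cmod (u - f a)); first by move: up; clear; lra.
  by move=> v vu; apply: Hg; have := cmod_tri u v (f a); move: vu; clear; lra.
have dg : cder g (f a) = (cder f a)^-1.
  by apply: cderE; apply: (univ_inv oD uf aD gfa); exists p.
pose k u := g u - a.
have dk u : cmod (u - f a) < p -> cdiff k u (cder g u).
  by move=> up; have := cdiffB (cdiffP (hg u up)) (cdiff_cst a u); rewrite subr0.
have := @cauchy_est R k (f a) p r p0 (fun u up => ex_intro _ _ (dk u up)) (fun u up => ltW (Hg u up).1).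
rewrite (cderE (dk (f a) _)) ?subrr ?cmod0// dg cmodV /p.
rewrite (_ : 16 * r / _ = 16 / 17 / cmod (cder f a)); last by field; rewrite !gt_eqF.
rewrite leNgt => /negP; apply; rewrite -[ltRHS]mul1r ltr_pM2r ?invr_gt0//.
by clear; lra.
Qed.

(* For an omitted value w0, a logarithm of f - w0 takes no two values that
   differ by 2 pi i, so its image contains no disc of radius 4 and Bloch's theorem
   bounds its derivative. *)
Lemma distortion : exists2 K : R, 0 < K & forall f a r, 0 < r ->
  univ [set z | cmod (z - a) < r] f ->
  forall z, cmod (z - a) <= r / 2 -> cmod (f z - f a) <= K * r * cmod (cder f a).
Proof.
(* Bloch's bound with D = 8: since 2 pi < 8, a disc of this radius about L z0 contains L z0 + 2 pi
   'i. *)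
pose K1 : R := 16 * 16 * 16 * 2 * 8.
(* |f z - w0| is at most exp(K1) |f a - w0|, and 17 comes from [univ_omits]; the summand 1 accounts
   for |w0 - f a|. *)
exists (17 * (expR K1 + 1)); first by rewrite mulr_gt0// addr_gt0 ?expR_gt0.
move=> f a r r0 uf z zr.
have [w0 w0a fw] := univ_omits r0 uf.
have hF : holoD (fun z => f z - w0) a r.
  by move=> y /uf.1[l dl]; exists (l - 0); exact: cdiffB dl (cdiff_cst _ _).
have [|L [La FL dL]] := disc_log hF; first by move=> y /fw; rewrite subr_eq0.
have hL : holoD L a r by move=> y yr; eexists; exact: dL.
have aD : cmod (a - a) < r by rewrite subrr cmod0.
have F0 : f a - w0 != 0 by rewrite subr_eq0; exact: fw.
have nodisc z0 : cmod (z0 - a) < r ->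
     ~ forall u, cmod (u - L z0) < 8 -> exists2 y, cmod (y - a) < r & L y = u.
  move=> z0r H; have pi0 := pi_gt0 R.
  have [|y yr yL] := H (L z0 + (2 * pi)%:C * 'i%C).
    rewrite addKB cmodM cmodI cmodR mulr1 ger0_norm ?mulr_ge0 ?pi_ge0//.
    by have := pi_lt4; lra.
  have /addIr/(uf.2 _ _ yr z0r) yz : f y - w0 = f z0 - w0.
    by rewrite (FL y yr) (FL z0 z0r) yL cexp_2pi.
  move: yL; rewrite yz => /eqP; rewrite eq_sym -subr_eq0 addKB -cmod_eq0 cmodM cmodI mulr1 cmodR.
  by rewrite gtr0_norm ?mulr_gt0// gt_eqF// mulr_gt0.
have B := bloch_bound (ltr0n _ 8) hL nodisc.
have zr' : cmod (z - a) < r by move: zr r0; clear; lra.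
have hL2 : holoD L a r := hL.
have Lz : cmod (L z) <= K1.
  have := @mean_value_seg R a z L (cder L) (K1 / (r / 2)).
  rewrite La subr0 => H; apply: le_trans (H _) _.
    move=> t t01; have tr : cmod (a + t%:C * (z - a) - a) <= r / 2.
      rewrite addKB cmodM cmodR; case/andP: t01 => t0 t1; rewrite ger0_norm//.
      by apply: le_trans zr; rewrite ler_piMl ?cmod_ge0.
    have tr' : cmod (a + t%:C * (z - a) - a) < r by move: tr r0; clear; lra.
    split; first by apply: cdiffP; exact: hL.
    have r20 : 0 < r / 2 by move: r0; clear; lra.
    rewrite ler_pdivlMr//; apply: le_trans (B _ tr').
    by apply: ler_wpM2l; [exact: cmod_ge0|move: tr; clear; lra].
  have K10 : 0 <= K1 by rewrite /K1 !mulr_ge0.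
  rewrite mulrAC ler_pdivrMr; last by move: r0; clear; lra.
  by apply: ler_wpM2l.
have Fz : cmod (f z - w0) <= expR K1 * cmod (f a - w0).
  rewrite (FL z zr') cmodM cmod_cexp mulrC; apply: ler_wpM2r; first exact: cmod_ge0.
  rewrite ler_expR; apply: le_trans Lz; apply: le_trans (cmod_Re _); exact: ler_norm.
have := cmod_tri w0 (f z) (f a) => h1.
have e0 := expR_gt0 K1.
have h2 : cmod (f a - w0) <= 17 * r * cmod (cder f a) by rewrite cmodC ltW.
have h3 : expR K1 * cmod (f a - w0) <= expR K1 * (17 * r * cmod (cder f a)) by rewrite ler_pM2l.
rewrite (cmodC w0) in h1.
rewrite (_ : 17 * _ * r * _ = expR K1 * (17 * r * cmod (cder f a)) + 17 * r * cmod (cder f a)); last by ring.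
by move: h1 h2 h3 Fz; clear; lra.
Qed.

End Distortion.

(** * Koebe and Harnack type estimates *)

Section Harnack.
Context {R : realType}.
Local Notation C := R[i].
Implicit Types (a z w h u : C) (r s t : R) (f g F L : C -> C) (S V A : set C).

Lemma cauchy_est_osc f a r (b : C) (M : R) : 0 < r -> holoD f a r ->
  (forall z, cmod (z - a) < r -> cmod (f z - b) <= M) -> cmod (cder f a) <= 16 * M / r.
Proof.
move=> r0 hf fM; have aD : cmod (a - a) < r by rewrite subrr cmod0.
have d z : cmod (z - a) < r -> cdiff (fun z => f z - b) z (cder f z).
  by move=> zr; have := cdiffB (cdiffP (hf z zr)) (cdiff_cst b z); rewrite subr0.
have := @cauchy_est R (fun z => f z - b) a r M r0 (fun z zr => ex_intro _ _ (d z zr)) fM.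
by rewrite (cderE (d a aD)).
Qed.

(** Distortion bounds f - f a by K r |f'(a)|, and two Cauchy estimates, on radii r / 4 and r / 8,
    bound the second derivative by a multiple of |f'(a)| / r. Only the existence of some k
    matters. *)
Lemma koebe : exists2 k : R, 0 < k <= 1 & forall f a r, 0 < r ->
  univ [set z | cmod (z - a) < r] f ->
  forall z, cmod (z - a) < k * r -> cmod (cder f z - cder f a) <= cmod (cder f a) / 2.
Proof.
have [K K0 HK] := @distortion R.
(* The product is twice the bound for the second derivative in units of |f'(a)| / r; the summand 8
   keeps the disc of radius r / N inside that of radius r / 8. *)
pose N : R := 16 * 16 * 4 * 16 * K + 8.
have N0 : 0 < N by rewrite /N addr_gt0// !mulr_gt0.
have N8 : 8 <= N by rewrite /N lerDr !mulr_ge0// ltW.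
exists N^-1; first by rewrite invr_gt0 N0 /= invf_le1//; apply: le_trans N8; clear; lra.
move=> f a r r0 uf z zr.
have hf : holoD f a r by move=> y /uf.1.
set D := cmod (cder f a).
have D0 : 0 <= D by exact: cmod_ge0.
have fb w : cmod (w - a) <= r / 2 -> cmod (f w - f a) <= K * r * D by exact: HK.
have r4 : 0 < r / 4 by move: r0; clear; lra.
have r8 : 0 < r / 8 by move: r0; clear; lra.
have d1 w : cmod (w - a) < r / 4 -> cmod (cder f w) <= 16 * 4 * K * D.
  move=> wr; have hw : holoD f w (r / 4) by apply: holoD_sub hf _; move: wr r0; clear; lra.
  have := cauchy_est_osc r4 hw (b := f a) (M := K * r * D).
  rewrite (_ : 16 * (K * r * D) / (r / 4) = 16 * 4 * K * D); last by field; rewrite gt_eqF.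
  by apply=> v vw; apply: fb; have := cmod_tri w v a; move: wr vw; clear; lra.
have hd : holoD (cder f) a (r / 8).
  by apply: holoD_sub (cder_holo hf) _; rewrite subrr cmod0; move: r0; clear; lra.
have d2 w : cmod (w - a) < r / 8 -> cmod (cder (cder f) w) <= 16 * 16 * 4 * 8 * K * D / r.
  move=> wr; have hw : holoD (cder f) w (r / 8).
    by apply: holoD_sub (cder_holo hf) _; move: wr r0; clear; lra.
  have := cauchy_est r8 hw (M := 16 * 4 * K * D).
  rewrite (_ : 16 * (16 * 4 * K * D) / (r / 8) = 16 * 16 * 4 * 8 * K * D / r); last by field; rewrite gt_eqF.
  by apply=> v vw; apply: d1; have := cmod_tri w v a; move: wr vw; clear; lra.
have zN : cmod (z - a) * N < r by move: zr; rewrite mulrC ltr_pdivlMr.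
have aD : cmod (a - a) < r / 8 by rewrite subrr cmod0.
have z8 : cmod (z - a) < r / 8.
  rewrite ltr_pdivlMr//; apply: le_lt_trans zN; apply: ler_wpM2l => //; exact: cmod_ge0.
apply: le_trans (lip_disc hd d2 aD z8) _.
rewrite mulrAC ler_pdivrMr// (_ : 16 * 16 * 4 * 8 * K * D * cmod (z - a) = (16 * 16 * 4 * 16 * K * cmod (z - a)) * D / 2); last by field.
rewrite [leRHS]mulrAC [D * r]mulrC ler_pM2r ?invr_gt0//; apply: ler_wpM2r => //.
apply: le_trans (ltW zN); rewrite mulrC; apply: ler_wpM2l; first exact: cmod_ge0.
by rewrite /N lerDl.
Qed.

Lemma nearlin_of_der f a r : holoD f a r ->
  (forall z, cmod (z - a) < r -> cmod (cder f z - cder f a) <= cmod (cder f a) / 2) ->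
  nearlin f a r (cder f a).
Proof. by move=> hf fM; exact: linear_approx. Qed.

(** A Harnack inequality with one constant for all univalent functions on V. The third clause
    converts a small derivative at one point into a small image. *)
Definition comparable_at (K : R) V x y := forall f, univ V f ->
  [/\ cmod (cder f x) <= K * cmod (cder f y), cmod (cder f y) <= K * cmod (cder f x) &
      cmod (f y - f x) <= K * cmod (cder f x)].

Lemma comparable_arith (q X Y P S c : R) : 0 <= q -> 0 <= X -> 0 <= Y ->
  P <= 3 / 2 * X * c -> c <= q -> S <= X / 2 -> X - Y <= S -> Y - X <= S ->
  [/\ X <= (2 + 2 * q) * Y, Y <= (2 + 2 * q) * X & P <= (2 + 2 * q) * X].
Proof.
move=> q0 X0 Y0 HP cq SX XY YX.
have p1 := mulr_ge0 q0 X0; have p2 := mulr_ge0 q0 Y0.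
have p3 : X * c <= X * q by apply: ler_wpM2l.
have E D : (2 + 2 * q) * D = 2 * D + 2 * (q * D) by ring.
rewrite !E -mulrA in HP *; rewrite [X * q]mulrC in p3.
move: (q * X) (q * Y) (X * c) p1 p2 p3 HP => *; split; lra.
Qed.

Lemma comparable_local V x : isopen V -> V x ->
  exists2 d : R, 0 < d & exists2 K : R, 0 < K & forall w, cmod (w - x) < d -> V w /\ comparable_at K V x w.
Proof.
move=> oV Vx; have [r r0 Hr] := oV x Vx; have [k /andP[k0 k1] Hk] := koebe.
have q0 : 0 < k * r by exact: mulr_gt0.
have qr : k * r <= r by rewrite ler_piMl// ltW.
have {}Hk f := Hk f x r r0.
move: (k * r) q0 qr Hk => q q0 qr Hk.
exists q => //; exists (2 + 2 * q); first by move: q0; clear; lra.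
move=> w wk; split; first by apply: Hr; exact: lt_le_trans wk qr.
move=> f uf.
have uf' : univ [set z | cmod (z - x) < r] f by apply: univ_sub uf => z; exact: Hr.
have H := Hk f uf'.
have hf : holoD f x q by move=> z zk; apply: uf'.1; exact: lt_le_trans zk qr.
have nl := nearlin_of_der hf H.
have xx : cmod (x - x) < q by rewrite subrr cmod0.
have h3 := cmod_rtri (cder f x) (cder f w); rewrite cmodC in h3.
exact: (comparable_arith (ltW q0) (cmod_ge0 _) (cmod_ge0 _) (nearlin_upper nl xx wk) (ltW wk)
  (H w wk) h3 (cmod_rtri (cder f w) (cder f x))).
Qed.

Lemma comparable_trans V x y z (K L : R) : 0 < K -> 0 < L ->
  comparable_at K V x y -> comparable_at L V y z -> comparable_at (K * L + K) V x z.
Proof.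
move=> K0 L0 c1 c2 f uf; have [h1 h2 h3] := c1 f uf; have [h4 h5 h6] := c2 f uf.
have X := cmod_ge0 (cder f x); have Y := cmod_ge0 (cder f y); have Z := cmod_ge0 (cder f z).
have q1 : K * cmod (cder f y) <= K * (L * cmod (cder f z)) by rewrite ler_pM2l.
have q2 : L * cmod (cder f y) <= L * (K * cmod (cder f x)) by rewrite ler_pM2l.
have p1 := mulr_ge0 (ltW K0) Z; have p2 := mulr_ge0 (ltW K0) X.
have h7 := cmod_tri (f y) (f z) (f x).
rewrite !mulrDl -!mulrA; rewrite (mulrCA L K) in q2.
split; [move: h1 q1 p1|move: h5 q2 p2|move: h3 h6 q2 p2 h7]; clear; lra.
Qed.

Lemma comparable_sym V x y (K : R) : 0 < K -> comparable_at K V x y -> comparable_at (K * K + K) V y x.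
Proof.
move=> K0 c f uf; have [h1 h2 h3] := c f uf; rewrite -(cmodC (f y)).
have X := cmod_ge0 (cder f x); have Y := cmod_ge0 (cder f y).
have q1 : K * cmod (cder f x) <= K * (K * cmod (cder f y)) by rewrite ler_pM2l.
have p1 := mulr_ge0 (mulr_ge0 (ltW K0) (ltW K0)) X.
have p2 := mulr_ge0 (mulr_ge0 (ltW K0) (ltW K0)) Y.
have p3 := mulr_ge0 (ltW K0) X; have p4 := mulr_ge0 (ltW K0) Y.
rewrite !mulrDl; rewrite mulrA in q1.
by split; move: h1 h2 h3 q1 p1 p2 p3 p4; clear; lra.
Qed.

Lemma comparable_all V : isopen V -> connected V -> forall x y, V x -> V y ->
  exists2 K : R, 0 < K & comparable_at K V x y.
Proof.
move=> oV cV; apply: (@connected_class R V (fun x y => exists2 K : R, 0 < K & comparable_at K V x y)) => //.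
- move=> z Vz; exists 1 => // f _; rewrite subrr cmod0 !mul1r; split=> //; exact: cmod_ge0.
- move=> x y z [K K0 h1] [L L0 h2]; exists (K * L + K); first by rewrite addr_gt0// mulr_gt0.
  exact: comparable_trans h1 h2.
- move=> x y [K K0 h]; exists (K * K + K); first by rewrite addr_gt0// mulr_gt0.
  exact: comparable_sym h.
- move=> z Vz; have [d d0 [K K0 H]] := comparable_local oV Vz; exists d => // w /H[Vw cw].
  by split=> //; exists K.
Qed.

Lemma comparable_mono V x y (K L : R) : K <= L -> comparable_at K V x y -> comparable_at L V x y.
Proof.
move=> KL c f uf; have [h1 h2 h3] := c f uf.
have X := cmod_ge0 (cder f x); have Y := cmod_ge0 (cder f y).
split.
- exact: le_trans h1 (ler_wpM2r Y KL).
- exact: le_trans h2 (ler_wpM2r X KL).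
- exact: le_trans h3 (ler_wpM2r X KL).
Qed.

Lemma comparable_compact V A x : isopen V -> connected V -> compact A -> A `<=` V -> V x ->
  exists2 K : R, 0 < K & forall y, A y -> comparable_at K V x y.
Proof.
move=> oV cV cA AV Vx.
have [|y Ay|n Hn] := @compact_unif R A (fun y n => comparable_at n.+1%:R V x y) cA.
- by move=> y n m nm; apply: comparable_mono; rewrite ler_nat.
- have [K K0 cK] := comparable_all oV cV Vx (AV y Ay).
  have [d d0 [L L0 H]] := comparable_local oV (AV y Ay); exists d => //.
  exists (Num.trunc (K * L + K)) => z Az /H[_ cz].
  apply: comparable_mono (comparable_trans K0 L0 cK cz).
  exact/ltW/Num.Theory.truncnS_gt.
by exists n.+1%:R.
Qed.

End Harnack.

(** * Iterated function systems *)

Section Words.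
Context {R : realType}.
Local Notation C := R[i].
Implicit Types (a z x y : C) (f h F : C -> C) (S U A : set C).

(** The invariance of A is kept pointwise, in a forward and a backward half. Contraction is not part
    of the record: for words it follows from the margin of [holo_ifs_margin]. *)
Record ifs_on (Om A : set C) n (g : 'I_n -> C -> C) : Prop := IfsOn {
  ifs_open : isopen Om;
  ifs_univ : forall i, univ Om (g i);
  ifs_stable : forall i z, Om z -> Om (g i z);
  ifs_sub : A `<=` Om;
  ifs_fwd : forall i z, A z -> A (g i z);
  ifs_bwd : forall z, A z -> exists i w, A w /\ g i w = z }.

(** The image of U under f contains a disc about h a, and h maps points of U close to a into it. A
    coincidence at the limit point a thus yields one inside U, where disjointness of the g(U) can be
    used; A is only contained in the closure of U. *)
Lemma overlap U f h x a : isopen U -> univ U f -> U x -> f x = h a -> ccont h a ->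
  (forall d, 0 < d -> exists2 u, U u & cmod (u - a) < d) -> exists u v, [/\ U u, U v & f u = h v].
Proof.
move=> oU uU Ux fx ch near.
have [p p0 Hp] := univ_open oU uU Ux ltr01.
have p20 : 0 < p / 2 by lra.
have [d d0 Hd] := ch _ p20.
have [v Uv va] := near d d0.
have [|u [_ Uu uE]] := Hp (h v); first by rewrite fx; have := Hd v va; lra.
by exists u, v.
Qed.

(** g i x is also g j a for some a in A. By [overlap] and disjointness i = j, and injectivity gives
    x = a. *)
Lemma faithful Om A n (g : 'I_n -> C -> C) U : ifs_on Om A g -> isopen U -> U `<=` Om ->
  (forall a, A a -> forall d, 0 < d -> exists2 u, U u & cmod (u - a) < d) ->
  (forall i j u v, U u -> U v -> g i u = g j v -> i = j) ->
  forall i x, U x -> A (g i x) -> A x.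
Proof.
move=> G oU UO AU dis i x Ux Agx; have [j [a [Aa ja]]] := ifs_bwd G Agx.
suff E : i = j.
  by rewrite (_ : x = a)//; apply: (ifs_univ G i).2; [exact: UO|exact: (ifs_sub G)|rewrite -ja E].
have uU : univ U (g i) by apply: univ_sub (ifs_univ G i).
have [l dl] := (ifs_univ G j).1 a (ifs_sub G Aa).
by have [u [v [Uu Uv]]] := overlap oU uU Ux (esym ja) (cdiff_ccont dl) (AU a Aa); exact: dis.
Qed.

Lemma pow_lt (e L d : R) : 0 < e -> 0 < d -> exists n, forall m, (n <= m)%N -> L * (1 + e)^-1 ^+ m < d.
Proof.
move=> e0 d0.
have B m : 1 + m%:R * e <= (1 + e) ^+ m.
  elim: m => [|m IH]; first by rewrite mul0r addr0 expr0.
  rewrite exprS -natr1; have : (1 + e) * (1 + m%:R * e) <= (1 + e) * (1 + e) ^+ m.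
    by rewrite ler_pM2l//; lra.
  have : 0 <= m%:R * (e * e) by rewrite !mulr_ge0 ?ler0n ?(ltW e0).
  move: (m%:R) ((1 + e) ^+ m) => q p; nra.
have e1 : 0 < 1 + e by lra.
exists (Num.trunc `|L / d / e|).+1 => m nm.
rewrite exprVn ltr_pdivrMr ?exprn_gt0//.
have h : L / d / e < m%:R.
  apply: le_lt_trans (ler_norm _) _; apply: lt_le_trans (Num.Theory.truncnS_gt _) _.
  by rewrite ler_nat.
rewrite mulrC -ltr_pdivrMr//; apply: lt_le_trans (B m).
by move: h; rewrite ltr_pdivrMr//; lra.
Qed.

Section OneIfs.
Variables (Om A : set C) (n : nat) (g : 'I_n -> C -> C).
Hypothesis G : ifs_on Om A g.

Fixpoint word (w : seq 'I_n) (x : C) : C :=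
  if w is i :: w' then g i (word w' x) else x.

Lemma word_cat v w x : word (v ++ w) x = word v (word w x).
Proof. by elim: v => //= i v ->. Qed.

Lemma word_stable w z : Om z -> Om (word w z).
Proof. by move=> Oz; elim: w => //= i w; exact: (ifs_stable G). Qed.

Lemma word_fwd w z : A z -> A (word w z).
Proof. by move=> Oz; elim: w => //= i w; exact: (ifs_fwd G). Qed.

Lemma word_bwd k z : A z -> exists w x, [/\ size w = k, A x & word w x = z].
Proof.
elim: k z => [|k IH] z Az; first by exists [::], z.
have [i [y [Ay <-]]] := ifs_bwd G Az; have [w [x [sw Ax <-]]] := IH y Ay.
by exists (i :: w), x; rewrite /= sw.
Qed.

Lemma word_univ w : univ Om (word w).
Proof.
elim: w => [|i w [dw iw]] /=.
  by split=> // z _; exists 1; exact: cdiff_id.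
split=> [z Oz|z y Oz Oy E].
  have [l dl] := dw z Oz; have [m dm] := (ifs_univ G i).1 _ (word_stable w Oz).
  by eexists; exact: cdiff_comp dl dm.
by apply: iw => //; apply: (ifs_univ G i).2 E; exact: word_stable.
Qed.

(* The Earle-Hamilton trick: if h maps Om into Om with margin eta, so does
   z |-> h z + e (h z - h x) map Om into Om, and its derivative at x is larger by
   the factor 1 + e. *)
Lemma expanded_word (M e eta : R) : 0 < e -> (forall z, Om z -> cmod z <= M) -> e * (2 * M) < eta ->
  (forall i x y, Om x -> cmod (y - g i x) < eta -> Om y) ->
  forall w x, Om x -> exists F, [/\ forall z, Om z -> exists l, cdiff F z l,
    forall z, Om z -> Om (F z), F x = word w x & cder F x = (1 + e)%:C ^+ size w * cder (word w) x].
Proof.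
move=> e0 OM eM Oeta w x Ox; elim: w => [|i w [F [dF FO Fx dFx]]].
  exists id; split=> // [z _|/=]; first by exists 1; exact: cdiff_id.
  by rewrite expr0 mul1r.
have dg z : Om z -> cdiff (g i) z (cder (g i) z) by move=> Oz; apply: cdiffP; exact: (ifs_univ G i).1.
pose H z := g i (F z) + e%:C * (g i (F z) - g i (F x)).
have dH z : Om z -> cdiff H z (cder (g i) (F z) * cder F z + e%:C * (cder (g i) (F z) * cder F z)).
  move=> Oz; have d1 := cdiff_comp (cdiffP (dF z Oz)) (dg _ (FO z Oz)).
  have := cdiffD d1 (cdiffZ e%:C (cdiffB d1 (cdiff_cst (g i (F x)) z))).
  by rewrite subr0.
exists H; split.
- by move=> z Oz; eexists; exact: dH.
- move=> z Oz; apply: (Oeta i (F z)); first exact: FO.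
  rewrite /H addKB cmodM cmodR gtr0_norm//; apply: le_lt_trans eM; rewrite ler_pM2l//.
  apply: le_trans (cmodB _ _) _.
  have := OM _ (ifs_stable G i (FO z Oz)); have := OM _ (ifs_stable G i (FO x Ox)); lra.
- by rewrite /H subrr mulr0 addr0 Fx.
- rewrite (cderE (dH x Ox)) dFx /= Fx.
  have := cdiff_comp (cdiffP ((word_univ w).1 x Ox)) (dg _ (word_stable w Ox)).
  by move=> /cderE ->; rewrite rmorphD rmorph1 exprS; ring.
Qed.

(** Cauchy's estimate holds for the expanded map, whose values stay in the bounded set Om; dividing
    by the expansion factor leaves geometric decay for the word. *)
Lemma word_der_bound (M e eta : R) : 0 < e -> (forall z, Om z -> cmod z <= M) -> e * (2 * M) < eta ->
  (forall i x y, Om x -> cmod (y - g i x) < eta -> Om y) ->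
  forall w x r, 0 < r -> (forall y, cmod (y - x) < r -> Om y) ->
  cmod (cder (word w) x) <= 16 * M / r * (1 + e)^-1 ^+ size w.
Proof.
move=> e0 OM eM Oeta w x r r0 Hr.
have Ox : Om x by apply: Hr; rewrite subrr cmod0.
have [F [dF FO Fx dFx]] := expanded_word e0 OM eM Oeta w Ox.
have := @cauchy_est R F x r M r0 (fun z zr => dF z (Hr z zr)) (fun z zr => OM _ (FO z (Hr z zr))).
have e1 : 0 < 1 + e by lra.
rewrite dFx cmodM cmodX cmodR gtr0_norm// => h.
by rewrite exprVn ler_pdivlMr ?exprn_gt0// [leLHS]mulrC.
Qed.

End OneIfs.
End Words.

(** * Uniform contraction of long words near A *)

Section Contraction.
Context {R : realType}.
Local Notation C := R[i].
Implicit Types (a z x y : C) (f F : C -> C) (S U K : set C).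

Lemma compact_margin K S : compact K -> isopen S -> K `<=` S ->
  exists2 r : R, 0 < r & forall a, K a -> forall z, cmod (z - a) < r -> S z.
Proof.
move=> cK oS KS.
have [|y Ky|n Hn] := @compact_unif R K (fun y n => forall z, cmod (z - y) < n.+1%:R^-1 -> S z) cK.
- move=> y n m nm H z zy; apply: H; apply: lt_le_trans zy _.
  by rewrite lef_pV2 ?posrE ?ltr0n// ler_nat.
- have [d d0 Hd] := oS y (KS y Ky); have d20 : 0 < d / 2 by lra.
  exists (d / 2) => //; exists (Num.trunc (d / 2)^-1) => x Kx xy z zx.
  have h : (Num.trunc (d / 2)^-1).+1%:R^-1 <= d / 2.
    rewrite invf_ple ?posrE ?ltr0n//; exact/ltW/Num.Theory.truncnS_gt.
  apply: Hd; have := cmod_tri x z y; move: (_.+1%:R^-1) zx h => q; move: xy; clear; lra.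
by exists n.+1%:R^-1; rewrite ?invr_gt0 ?ltr0n.
Qed.

Lemma finite_min n (F : 'I_n -> R) : (forall i, 0 < F i) -> exists2 l : R, 0 < l <= 1 & forall i, l <= F i.
Proof.
elim: n F => [|n IH] F F0; first by exists 1 => [|[]//]; rewrite ltr01 lexx.
have [l /andP[l0 l1] Hl] := IH (fun i => F (lift ord0 i)) (fun i => F0 _).
exists (Num.min l (F ord0)).
  by rewrite lt_min l0 F0 ge_min l1.
move=> i; have [j ->|->] := unliftP ord0 i.
  by apply: le_trans (Hl j); rewrite ge_min lexx.
by rewrite ge_min lexx orbT.
Qed.

(** The derivative bound is integrated along segments inside discs about A. Diameters of the images
    of A need a separate argument, because A may be disconnected: discs are chained inside the
    connected set Om. The lower bound is the chain rule together with [comparable_compact] for each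
    generator. *)
Lemma words_contract Om A n (g : 'I_n -> C -> C) (M eta : R) : ifs_on Om A g ->
  connected Om -> compact A -> A !=set0 -> 0 < eta -> (forall z, Om z -> cmod z <= M) ->
  (forall i x y, Om x -> cmod (y - g i x) < eta -> Om y) ->
  exists2 r : R, 0 < r &
  [/\ forall a z, A a -> cmod (z - a) < 2 * r -> Om z,
      exists2 L : R, 0 < L & forall w a, A a ->
        forall x y, cmod (x - a) < r -> cmod (y - a) < r ->
        cmod (word g w x - word g w y) <= L * cmod (x - y),
      forall e, 0 < e -> exists k, forall w, (k <= size w)%N -> forall a, A a ->
        forall x y, cmod (x - a) < r -> cmod (y - a) < r ->
        cmod (word g w x - word g w y) <= e * cmod (x - y),
      forall e, 0 < e -> exists k, forall w, (k <= size w)%N -> forall a b, A a -> A b ->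
        cmod (word g w a - word g w b) < e &
      exists2 l : R, 0 < l <= 1 & forall w a, A a -> l ^+ size w <= cmod (cder (word g w) a)].
Proof.
move=> G cO cA [a0 Aa0] eta0 OM Oeta.
have oO := ifs_open G.
have M0 : 0 <= M by apply: le_trans (OM a0 (ifs_sub G Aa0)); exact: cmod_ge0.
(* Any positive e1 with e1 (2 M) < eta is allowed by [expanded_word]; the 1 avoids a division by
   0. *)
pose e1 := eta / (2 * M + 1) / 2.
have M1 : 0 < 2 * M + 1 by move: M0; clear; lra.
have e10 : 0 < e1 by rewrite /e1 !divr_gt0.
have e1M : e1 * (2 * M) < eta.
  have : e1 * (2 * M + 1) = eta / 2 by rewrite /e1; field; rewrite gt_eqF.
  by have := mulr_ge0 (ltW e10) M0; move: eta0 e10; clear; move: (e1 * M) => ? *; lra.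
clearbody e1.
have db := word_der_bound G e10 OM e1M Oeta.
have lip a r w x y : 0 < r -> (forall z, cmod (z - a) < 2 * r -> Om z) -> cmod (x - a) < r -> cmod (y - a) < r ->
    cmod (word g w x - word g w y) <= 16 * M / r * (1 + e1)^-1 ^+ size w * cmod (x - y).
  move=> r0 Hr xa ya; apply: (@lip_disc R (word g w) a r) => //.
    by move=> z zr; apply: (word_univ G w).1; apply: Hr; move: zr r0; clear; lra.
  move=> z zr; apply: db => // v vz; apply: Hr.
  by have := cmod_tri z v a; move: vz zr; clear; lra.
have [r2 r20 Hr2] := compact_margin cA oO (ifs_sub G).
have r0 : 0 < r2 / 2 by move: r20; clear; lra.
have r22 : 2 * (r2 / 2) = r2 by rewrite mulrC divfK.
exists (r2 / 2) => //; rewrite r22; split.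
- by move=> a z Aa; exact: Hr2.
- have L0 : 0 <= 16 * M / (r2 / 2) by apply: divr_ge0; [exact: mulr_ge0|exact: ltW].
  exists (16 * M / (r2 / 2) + 1); first by move: L0; clear; lra.
  move=> w a Aa x y xa ya; apply: le_trans (lip a _ w x y r0 _ xa ya) _.
    by rewrite r22; exact: Hr2.
  apply: ler_wpM2r; first exact: cmod_ge0.
  have : 16 * M / (r2 / 2) * (1 + e1)^-1 ^+ size w <= 16 * M / (r2 / 2).
    rewrite ler_piMr// exprn_ile1 ?invr_ge0 ?invf_le1//; move: e10; clear; lra.
  by clear; lra.
- move=> e e0; have [k Hk] := pow_lt (16 * M / (r2 / 2)) e10 e0.
  exists k => w kw a Aa x y xa ya; apply: le_trans (lip a _ w x y r0 _ xa ya) _.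
    by rewrite r22; exact: Hr2.
  by apply: ler_wpM2r; [exact: cmod_ge0|apply: ltW; exact: Hk].
- move=> e e0.
  (* Points whose images under long words come together. Classes are open by the Lipschitz bound, so
     connectedness of Om leaves a single class. *)
  pose rel x y := forall e : R, 0 < e -> exists k, forall w, (k <= size w)%N -> cmod (word g w x - word g w y) < e.
  have reltr x y z : rel x y -> rel y z -> rel x z.
    move=> h1 h2 d d0; have d20 : 0 < d / 2 by move: d0; clear; lra.
    have [k1 H1] := h1 _ d20; have [k2 H2] := h2 _ d20.
    exists (maxn k1 k2) => w; rewrite geq_max => /andP[/H1 w1 /H2 w2].
    by have := cmod_tri (word g w y) (word g w x) (word g w z); move: w1 w2; clear; lra.
  have cpos (q : R) k : 0 < q -> 0 <= 16 * M / q * (1 + e1)^-1 ^+ k.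
    move=> q0; apply: mulr_ge0; first by apply: divr_ge0; [exact: mulr_ge0|exact: ltW].
    by apply: exprn_ge0; rewrite invr_ge0; move: e10; clear; lra.
  have near x : Om x -> exists2 d : R, 0 < d & (forall y, cmod (y - x) < d -> Om y) /\
      forall e : R, 0 < e -> exists k, forall y, cmod (y - x) < d ->
      forall w, (k <= size w)%N -> cmod (word g w x - word g w y) < e.
    move=> Ox; have [q q0 Hq] := oO x Ox.
    have q20 : 0 < q / 2 by move: q0; clear; lra.
    have E : 2 * (q / 2) = q by rewrite mulrC divfK.
    exists (q / 2) => //; split; first by move=> y yx; apply: Hq; move: yx q0; clear; lra.
    move=> d d0; have [k Hk] := pow_lt (16 * M / (q / 2) * q) e10 d0.
    exists k => y yx w kw; apply: le_lt_trans (Hk _ kw).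
    apply: le_trans (lip x _ w x y q20 _ _ yx) _; rewrite ?E ?subrr ?cmod0//.
    rewrite [leRHS]mulrAC; apply: ler_wpM2l; first exact: cpos.
    by rewrite cmodC; move: yx q0; clear; lra.
  have R1 : forall x y, Om x -> Om y -> rel x y.
    apply: connected_class => //.
    + by move=> z Oz d d0; exists 0%N => w _; rewrite subrr cmod0.
    + by move=> x y h d /h[k Hk]; exists k => w /Hk; rewrite cmodC.
    + move=> z Oz; have [d d0 [H1 H2]] := near z Oz; exists d => // y yz; split; first exact: H1.
      by move=> e' e'0; have [k Hk] := H2 e' e'0; exists k; exact: Hk.
  have e20 : 0 < e / 2 by move: e0; clear; lra.
  have e40 : 0 < e / 4 by move: e0; clear; lra.
  have [|y Ay|k Hk] := @compact_unif R A (fun y k => forall w, (k <= size w)%N -> cmod (word g w y - word g w a0) < e / 2) cA.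
  + by move=> y k m km H w mw; apply: H; exact: leq_trans mw.
  + have [d d0 [_ /(_ _ e40)[k1 H1]]] := near y (ifs_sub G Ay).
    have [k2 H2] := R1 y a0 (ifs_sub G Ay) (ifs_sub G Aa0) _ e40.
    exists d => //; exists (maxn k1 k2) => x Ax /H1 {}H1 w; rewrite geq_max => /andP[/H1 w1 /H2 w2].
    rewrite cmodC in w1.
    by have := cmod_tri (word g w y) (word g w x) (word g w a0); move: w1 w2; clear; lra.
  exists k => w kw a b Aa Ab; have h1 := Hk a Aa w kw; have h2 := Hk b Ab w kw.
  rewrite cmodC in h2.
  by have := cmod_tri (word g w a0) (word g w a) (word g w b); move: h1 h2; clear; lra.
- have [K K0 HK] := comparable_compact oO cO cA (ifs_sub G) (ifs_sub G Aa0).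
  have [|l /andP[l0 l1] Hl] := @finite_min n (fun i => cmod (cder (g i) a0) / K).
    move=> i; rewrite divr_gt0// cmod_gt0; apply: (univ_der_neq0 oO (ifs_univ G i)).
    exact: (ifs_sub G).
  exists l; first by rewrite l0.
  elim=> [|i w IH] a Aa /=.
    by rewrite expr0 (cderE (cdiff_id a)) cmod1.
  have Aw := word_fwd G w Aa.
  have := cdiff_comp (cdiffP ((word_univ G w).1 a (ifs_sub G Aa))) (cdiffP ((ifs_univ G i).1 _ (ifs_sub G Aw))).
  move=> /cderE ->; rewrite cmodM exprS; apply: ler_pM; rewrite ?exprn_ge0 ?(ltW l0)//; last exact: IH.
  apply: le_trans (Hl i) _; rewrite ler_pdivrMr// mulrC.
  by have [] := HK _ Aw _ (ifs_univ G i).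
Qed.

End Contraction.

(** * Germs of symmetries of the attractor *)

Section Renormalisation.
Context {R : realType}.
Local Notation C := R[i].
Implicit Types (a z x y p q : C) (f h u psi : C -> C) (S A : set C) (r s : R).

Lemma nearlin_univ f a r l : l != 0 -> holoD f a r -> nearlin f a r l ->
  univ [set z | cmod (z - a) < r] f.
Proof.
move=> l0 hf nl; split; first exact: hf.
move=> z w zr wr fzw; have := nearlin_lower nl zr wr; rewrite fzw subrr cmod0 => h.
have l1 : 0 < cmod l by rewrite cmod_gt0.
apply/eqP; rewrite eq_sym -subr_eq0 -cmod_eq0 eq_le cmod_ge0 andbT.
rewrite -(@ler_pM2l _ (cmod l / 2)) ?mulr0// divr_gt0//.
Qed.

(** psi is f^-1 composed with u, defined because u x stays in a disc about f x that f covers. With u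
    a germ composed with h and f = h it conjugates the germ; with u = g1 and f = g2 it produces
    one. *)
Lemma lift_nearlin f u a r l : 0 < r -> l != 0 -> holoD f a r -> nearlin f a r l ->
  holoD u a (r / 2) ->
  (forall x, cmod (x - a) < r / 2 -> cmod (u x - f x) < cmod l / 4 * (r / 2)) ->
  exists psi, [/\ holoD psi a (r / 2),
    forall x, cmod (x - a) < r / 2 -> f (psi x) = u x &
    forall x, cmod (x - a) < r / 2 -> cmod l / 2 * cmod (psi x - x) <= cmod (u x - f x) /\ cmod (psi x - a) < r].
Proof.
move=> r0 l0 hf nl hu uf.
have uS := nearlin_univ l0 hf nl.
have oS := @isopen_disc R a r.
have ex v : exists y, (exists2 y, cmod (y - a) < r & f y = v) -> cmod (y - a) < r /\ f y = v.
  have [[y yr yv]|no] := pselect (exists2 y, cmod (y - a) < r & f y = v); first by exists y.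
  by exists a => /no.
have [k Hk] := choice ex.
have cf z : cmod (z - a) < r -> ccont f z by move=> /hf[m]; exact: cdiff_ccont.
have r20 : 0 <= r / 2 by move: r0; clear; lra.
have H x : cmod (x - a) < r / 2 -> exists2 y, cmod (y - a) < r & f y = u x.
  move=> xr; have [||y yx fy] := nearlin_surj l0 nl cf (z := x) (t := r / 2) _ _ (uf x xr) => //.
    by move: xr; clear; lra.
  by exists y => //; have := cmod_tri x y a; move: xr yx; clear; lra.
exists (fun x => k (u x)); split.
- move=> x xr; have [kr fk] := Hk _ (H x xr).
  have [m dm] := hu x xr.
  have kf : k (f (k (u x))) = k (u x) by rewrite fk.
  have [|p p0 Hp] := univ_open oS uS kr (t := 1); first exact: ltr01.
  have := univ_inv oS uS kr kf _; rewrite fk => dk; eexists; apply: (cdiff_comp dm); apply: dk.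
  exists p => // v vp; have [|y [_ yr yv]] := Hp v; first by rewrite fk.
  by apply: Hk; exists y.
- by move=> x /H /Hk[].
- move=> x xr; have [kr fk] := Hk _ (H x xr); split=> //.
  have xr' : cmod (x - a) < r by move: xr r0; clear; lra.
  by have := nearlin_lower nl xr' kr; rewrite fk.
Qed.

(* [psi] is a local symmetry of [A] on the disc of centre [q] and radius [s],
   tested only at points of [Fa]. *)
Definition germ (A Fa : set C) psi q (s e : R) := [/\ A q, holoD psi q s,
  forall x, cmod (x - q) < s -> cmod (psi x - x) <= e &
  forall x, cmod (x - q) < s -> Fa x -> Fa (psi x) -> (A x <-> A (psi x))].

(** What renormalisation uses of the words of one large length of G_*: slopes of modulus at least
    lam, images of r-discs inside rho-discs, inheritance of [Fa]. A smaller rho costs a smaller lam,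
    while r can stay fixed. *)
Record contracting_family (A Fa : set C) (H : set (C -> C)) (r lam rho : R) : Prop := ContractingFamily {
  cf_r0 : 0 < r;
  cf_lam01 : 0 < lam <= 1;
  cf_fwd : forall h x, H h -> A x -> A (h x);
  cf_bwd : forall x, A x -> exists h q, [/\ H h, A q & h q = x];
  cf_Fa : forall h x, H h -> Fa x -> Fa (h x) /\ (A (h x) -> A x);
  cf_holo : forall h q, H h -> A q -> holoD h q r;
  cf_lin : forall h q, H h -> A q -> exists2 l, lam <= cmod l & nearlin h q r l;
  cf_lip : forall h q x y, H h -> A q -> cmod (x - q) < r -> cmod (y - q) < r ->
    cmod (h x - h y) <= cmod (x - y);
  cf_small : forall h q x, H h -> A q -> cmod (x - q) < r -> cmod (h x - h q) < rho }.

(** psi' is h^-1 psi h. As h maps the r-disc about q into the rho-disc about h q, only that part of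
    psi is used. Displacements grow by at most 2 / lam, and at the marked point they cannot decrease
    because h is 1-Lipschitz. *)
Lemma germ_pull A Fa H r lam rho psi h q (e d : R) :
  contracting_family A Fa H r lam rho -> H h -> A q ->
  germ A Fa psi (h q) rho e -> (forall x, cmod (x - h q) < rho -> cmod (psi x - x) <= d) -> 
  d < lam / 4 * (r / 2) ->
  exists psi', germ A Fa psi' q (r / 2) (2 / lam * d) /\
    cmod (psi (h q) - h q) <= cmod (psi' q - q).
Proof.
case=> r0 lam01 Hfwd Hbwd HFa Hholo Hlin Hlip Hsmall.
move=> Hh Aq [Ahq hpsi psie sym] psid dl; have [lam0 lam1] := andP lam01.
have hh := Hholo _ _ Hh Aq; have [l ll nl] := Hlin _ _ Hh Aq.
have l0 : l != 0 by rewrite -cmod_gt0; exact: lt_le_trans lam0 ll.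
have hr x : cmod (x - q) < r / 2 -> cmod (h x - h q) < rho.
  by move=> xr; apply: (Hsmall _ _ _ Hh Aq); move: xr r0; clear; lra.
have hu : holoD (fun x => psi (h x)) q (r / 2).
  move=> x xr; have [|m dm] := hh x; first by move: xr r0; clear; lra.
  by have [k dk] := hpsi (h x) (hr x xr); eexists; exact: cdiff_comp dm dk.
have r2 : 0 < r / 2 by move: r0; clear; lra.
have [|psi' [hp fp pd]] := lift_nearlin r0 l0 hh nl hu.
  move=> x xr; apply: le_lt_trans (psid _ (hr x xr)) _; apply: lt_le_trans dl _.
  by rewrite ler_pM2r// ler_pM2r ?invr_gt0.
have qr : cmod (q - q) < r / 2 by rewrite subrr cmod0.
exists psi'; split; last first.
  rewrite -(fp q qr); apply: (Hlip _ _ _ _ Hh Aq); first exact: (pd q qr).2.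
  by rewrite subrr cmod0.
split=> //.
- move=> x xr; have := (pd x xr).1 => h1.
  have h2 := le_trans h1 (psid _ (hr x xr)).
  have h3 : lam / 2 * cmod (psi' x - x) <= d.
    by apply: le_trans h2; apply: ler_wpM2r; [exact: cmod_ge0|rewrite ler_pM2r ?invr_gt0].
  by rewrite -ler_pdivrMl ?divr_gt0// invf_div.
- move=> x xr Fx Fpx.
  have [F1 A1] := HFa _ _ Hh Fx; have [F2 A2] := HFa _ _ Hh Fpx.
  have := sym (h x) (hr x xr) F1; rewrite -(fp x xr) => /(_ F2) [S1 S2].
  split; first by move=> /(Hfwd _ _ Hh)/S1/A2.
  by move=> /(Hfwd _ _ Hh)/S2/A1.
Qed.
(* Pulling psi back by contractions does not decrease the displacement of the
   marked point; as long as psi is much closer to the identity than e near q, the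
   bound e halves at each pull back, so this must stop. *)
Lemma doubling A Fa H r lam rho : contracting_family A Fa H r lam rho -> rho = r / 2 / 4 ->
  forall psi q (e : R), germ A Fa psi q (r / 2) e -> psi q != q -> 0 < e < r / 2 ->
  exists psi' q' (e' : R), [/\ germ A Fa psi' q' (r / 2) e', 0 < e' <= e &
    exists2 x, cmod (x - q') < rho & lam / 4 * e' <= cmod (psi' x - x)].
Proof.
move=> CF rhoE psi q e G pq /andP[e0 er].
have r0 := cf_r0 CF; have [lam0 lam1] := andP (cf_lam01 CF).
have p0 : 0 < cmod (psi q - q) by rewrite cmod_gt0 subr_eq0.
(* k bounds the number of pull backs: e <= 2^k |psi q - q| persists when e is halved and k drops by
   1. *)
have [k] := half_pow_lt e p0; rewrite exprVn ltr_pdivrMr ?exprn_gt0// mulrC => /ltW.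
elim: k psi q e G pq e0 er p0 => [|k IH] psi q e G pq e0 er p0 ek.
  exists psi, q, e; split=> //; first by rewrite e0 lexx.
  exists q; first by rewrite subrr cmod0 rhoE !divr_gt0.
  rewrite expr0 mul1r in ek; apply: le_trans ek.
  by rewrite ler_piMl ?(ltW e0)//; move: lam1; clear; lra.
have [[x xr xe]|no] := pselect (exists2 x, cmod (x - q) < rho & lam / 4 * e <= cmod (psi x - x)).
  exists psi, q, e; split=> //; first by rewrite e0 lexx.
  by exists x.
have small x : cmod (x - q) < rho -> cmod (psi x - x) <= lam / 4 * e.
  by move=> xr; rewrite leNgt; apply/negP => h; apply: no; exists x => //; exact: ltW.
have [Aq hpsi psie sym] := G.
have [h [q' [Hh Aq' hq]]] := cf_bwd CF Aq.
have rr : rho <= r / 2 by rewrite rhoE; move: r0; clear; lra.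
have G' : germ A Fa psi (h q') rho e.
  rewrite hq; split=> //.
  - by move=> x xr; apply: hpsi; exact: lt_le_trans xr rr.
  - by move=> x xr; apply: psie; exact: lt_le_trans xr rr.
  - by move=> x xr; apply: sym; exact: lt_le_trans xr rr.
have [||psi' [G2 pq2]] := germ_pull CF Hh Aq' G' (d := lam / 4 * e).
- by rewrite hq.
- by rewrite ltr_pM2l// divr_gt0.
(* The threshold lam / 4 is chosen so that a pull back, which costs a factor 2 / lam, halves e. *)
have E : 2 / lam * (lam / 4 * e) = e / 2 by field; rewrite gt_eqF.
rewrite E in G2; rewrite hq in pq2.
have p0' : 0 < cmod (psi' q' - q') by exact: lt_le_trans p0 pq2.
have [||||psi2 [q2 [e2 [G3 /andP[e20 e2e] X]]]] := IH psi' q' (e / 2) G2 _ _ _ p0'.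
- by rewrite -subr_eq0 -cmod_gt0.
- by move: e0; clear; lra.
- by move: e0 er; clear; lra.
- have : 2 ^+ k * cmod (psi q - q) <= 2 ^+ k * cmod (psi' q' - q') by rewrite ler_pM2l ?exprn_gt0.
  by move: ek; rewrite exprS -mulrA; clear; lra.
exists psi2, q2, e2; split=> //; rewrite e20; apply: le_trans e2e _; move: e0; clear; lra.
Qed.

End Renormalisation.

(** * Limits along ultrafilters; flows by polygons *)

Section UltraLimits.
Context {R : realType}.
Local Notation C := R[i].
Implicit Types (a z x y p q : C) (f h : C -> C) (S A K : set C) (r s : R).

Lemma ultra_lim (F : set_system nat) (K : set C) (u : nat -> C) : UltraFilter F -> compact K ->
  (forall n, K (u n)) -> exists2 l, K l & forall e : R, 0 < e -> F [set n | cmod (u n - l) < e].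
Proof.
move=> FU cK Ku.
have PF : ProperFilter F by exact: ultra_proper.
have [l [Kl cl]] : K `&` cluster (u @ F) !=set0.
  apply: (cK (u @ F)); rewrite /fmap /=.
  by apply: (@filterS _ F _ setT) => [n _|]; [exact: Ku|exact: filterT].
exists l => // e e0.
have [//|nF] := @in_ultra_setVsetC _ F [set n | cmod (u n - l) < e] FU.
have [||w [/= w1 w2]] := cl [set w | ~ cmod (w - l) < e] [set w | cmod (w - l) < e].
- exact: nF.
- by apply/nbhs_cmod; exists e.
by [].
Qed.

(** Montel's theorem. Values and first derivatives converge pointwise along F by compactness of
    discs. The quadratic Taylor bound, uniform in n, passes to the limit and gives differentiability
    of v; uniform Lipschitz bounds and compactness give uniform convergence on smaller discs. *)
Lemma ultra_holo (F : set_system nat) (f : nat -> C -> C) a r (M : R) : UltraFilter F -> 0 < r ->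
  (forall n, holoD (f n) a r) -> (forall n z, cmod (z - a) < r -> cmod (f n z) <= M) ->
  exists v, [/\ holoD v a r, forall z, cmod (z - a) < r -> cmod (v z) <= M &
    forall s, s < r -> forall e : R, 0 < e ->
      F [set n | forall z, cmod (z - a) <= s -> cmod (f n z - v z) <= e]].
Proof.
move=> FU r0 hf fM.
have PF : ProperFilter F by exact: ultra_proper.
have lim0 (u : nat -> C) (B : R) : (forall n, cmod (u n) <= B) ->
    exists2 l, cmod l <= B & forall e : R, 0 < e -> F [set n | cmod (u n - l) < e].
  move=> uB; have [|l] := @ultra_lim F _ u FU (@closed_disc_compact R 0 B).
    by move=> n /=; rewrite subr0.
  by rewrite /= subr0; exists l.
have ex z : exists l, cmod (z - a) < r -> cmod l <= M /\ forall e : R, 0 < e -> F [set n | cmod (f n z - l) < e].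
  have [zr|] := pselect (cmod (z - a) < r); last by exists 0.
  by have [l lM lF] := lim0 (fun n => f n z) M (fun n => fM n z zr); exists l.
have [v Hv] := choice ex.
have pick (P Q : set nat) : F P -> F Q -> exists n, P n /\ Q n.
  by move=> FP FQ; have [n [Pn Qn]] := filter_ex (filterI FP FQ); exists n.
have M0 : 0 <= M by apply: le_trans (fM 0%N a _); [exact: cmod_ge0|rewrite subrr cmod0].
exists v; split.
- move=> z zr; pose p := r - cmod (z - a).
  have p0 : 0 < p by rewrite subr_gt0.
  have hz n : holoD (f n) z p by apply: holoD_sub (hf n) _; rewrite addrC subrK.
  have fMz n w : cmod (w - z) < p -> cmod (f n w) <= M.
    by move=> wz; apply: fM; have := cmod_tri z w a; move: wz; rewrite /p; clear; lra.
  have [d dB dF] := lim0 (fun n => cder (f n) z) (16 * M / p) (fun n => cauchy_est p0 (hz n) (@fMz n)).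
  exists d => e e0.
  pose K := 32 * M / p ^+ 2.
  have K0 : 0 <= K by apply: divr_ge0; [exact: mulr_ge0|apply: exprn_ge0; exact: ltW].
  exists (Num.min (p / 4) (e / (K + 1))).
    by rewrite lt_min; apply/andP; split; apply: divr_gt0 => //; move: K0; clear; lra.
  move=> w; rewrite lt_min => /andP[w4 we].
  have wr : cmod (w - a) < r by have := cmod_tri z w a; move: w4 p0; rewrite /p; clear; lra.
  have K1 : 0 < K + 1 by move: K0; clear; lra.
  have wK : K * cmod (w - z) ^+ 2 <= e * cmod (w - z).
    rewrite expr2 mulrA; apply: ler_wpM2r; first exact: cmod_ge0.
    move: we; rewrite ltr_pdivlMr// mulrDr mulr1 mulrC.
    by have := cmod_ge0 (w - z); clear; lra.
  apply: le_trans wK; apply/ler_addgt0Pr => k k0.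
  have k40 : 0 < k / 3 by move: k0; clear; lra.
  pose B := cmod (w - z) + 1.
  have B0 : 0 < B by have := cmod_ge0 (w - z); rewrite /B; clear; lra.
  have kB : 0 < k / 3 / B by exact: divr_gt0.
  have [n [n1 [n2 n3]]] := pick _ _ ((Hv w wr).2 _ k40) (filterI ((Hv z zr).2 _ k40) (dF _ kB)).
  have Q := quad_est p0 (hz n) (@fMz n) (ltW w4); rewrite -/K in Q.
  have n3' : cmod (w - z) * cmod (cder (f n) z - d) <= k / 3.
    apply: le_trans (ler_wpM2l (cmod_ge0 _) (ltW n3)) _.
    rewrite mulrC mulrAC ler_pdivrMr//; apply: ler_wpM2l; first exact: ltW.
    by rewrite /B; clear; lra.
  rewrite (_ : _ - _ - _ = (f n w - f n z - (w - z) * cder (f n) z) - (f n w - v w) + (f n z - v z) +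
    (w - z) * (cder (f n) z - d)); last by ring.
  have t1 := cmodD ((f n w - f n z - (w - z) * cder (f n) z) - (f n w - v w) + (f n z - v z)) ((w - z) * (cder (f n) z - d)).
  have t2 := cmodD ((f n w - f n z - (w - z) * cder (f n) z) - (f n w - v w)) (f n z - v z).
  have t3 := cmodB (f n w - f n z - (w - z) * cder (f n) z) (f n w - v w).
  rewrite [X in _ <= _ + X]cmodM in t1.
  by move: n1 n2 n3' Q t1 t2 t3; rewrite /=; clear; lra.
- by move=> z zr; exact: (Hv z zr).1.
- move=> s sr e e0.
  pose p := (r - s) / 2; have p0 : 0 < p by rewrite divr_gt0// subr_gt0.
  have ps : s + 2 * p = r by rewrite /p mulrC divfK// addrC subrK.
  pose L := 16 * M / p.
  have L0 : 0 <= L by apply: divr_ge0; [exact: mulr_ge0|exact: ltW].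
  have lipn n x y : cmod (x - a) < s + p -> cmod (y - a) < s + p -> cmod (f n y - f n x) <= L * cmod (y - x).
    move=> xa ya; apply: (@lip_disc R (f n) a (s + p)) => //.
      by apply: holoD_sub (hf n) _; rewrite subrr cmod0; move: ps p0; clear; lra.
    move=> z za; have hz : holoD (f n) z p by apply: holoD_sub (hf n) _; move: ps za; clear; lra.
    apply: (cauchy_est p0 hz) => w wz; apply: fM.
    by have := cmod_tri z w a; move: wz za ps; clear; lra.
  have lipv x y : cmod (x - a) < s + p -> cmod (y - a) < s + p -> cmod (v y - v x) <= L * cmod (y - x).
    move=> xa ya; apply/ler_addgt0Pr => k k0; have k20 : 0 < k / 2 by move: k0; clear; lra.
    have xr : cmod (x - a) < r by move: xa ps p0; clear; lra.
    have yr : cmod (y - a) < r by move: ya ps p0; clear; lra.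
    have [n [n1 n2]] := pick _ _ ((Hv x xr).2 _ k20) ((Hv y yr).2 _ k20).
    have := lipn n x y xa ya.
    have t1 := cmod_tri (f n x) (v y) (v x); have t2 := cmod_tri (f n y) (v y) (f n x).
    rewrite (cmodC (v y) (f n y)) in t2; move: n1 n2 t1 t2; rewrite /=; clear; lra.
  have L1 : 0 < L + 1 by move: L0; clear; lra.
  have := (compact_near_coveringP [set z | cmod (z - a) <= s]).1 (@closed_disc_compact R a s) nat F
    (fun n z => cmod (z - a) <= s -> cmod (f n z - v z) <= e) _ _.
  move=> H; have {}H : \forall n \near F, [set z | cmod (z - a) <= s] `<=` (fun z => cmod (z - a) <= s -> cmod (f n z - v z) <= e).
    apply: H => x /= xs.
    have xr : cmod (x - a) < r by move: xs sr; clear; lra.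
    have e20 : 0 < e / 2 by move: e0; clear; lra.
    exists ([set y | cmod (y - x) < e / 4 / (L + 1)], [set n | cmod (f n x - v x) < e / 2]).
      split; last exact: (Hv x xr).2.
      by apply/nbhs_cmod; exists (e / 4 / (L + 1)) => //; rewrite divr_gt0// divr_gt0.
    move=> [y n] [/= yx nx] ys.
    have xs' : cmod (x - a) < s + p by move: xs p0; clear; lra.
    have ys' : cmod (y - a) < s + p by move: ys p0; clear; lra.
    have l1 := lipn n x y xs' ys'; have l2 := lipv x y xs' ys'.
    have Ly : L * cmod (y - x) <= e / 4.
      move: yx; rewrite ltr_pdivlMr// mulrDr mulr1 mulrC; have := cmod_ge0 (y - x); clear; lra.
    have t1 := cmod_tri (f n x) (f n y) (v y); have t2 := cmod_tri (v x) (f n x) (v y).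
    rewrite (cmodC (v x)) in t2.
    by move: l1 l2 Ly nx t1 t2; clear; lra.
  by apply: filterS H => n H z zs; exact: H.
Qed.

(* Euler's scheme. *)
Lemma flow_invariance (S : set C) b (tau : R) (sg : C) : cmod sg = 1 ->
  (forall z, cmod (z - b) < tau -> (forall d, 0 < d -> exists2 w, S w & cmod (w - z) < d) -> S z) ->
  (forall eta e0 : R, 0 < eta -> 0 < e0 -> exists2 e, 0 < e < e0 & forall z, S z -> cmod (z - b) < tau ->
     exists2 w, S w & cmod (w - (z + e%:C * sg)) <= eta * e) ->
  forall z (t : R), S z -> 0 <= t -> cmod (z - b) + t < tau -> S (z + t%:C * sg).
Proof.
move=> sg1 clS step z t Sz t0 zt.
apply: clS; first by rewrite addrAC; apply: le_lt_trans (cmodD _ _) _; rewrite cmodM sg1 mulr1 cmodR ger0_norm.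
move=> d d0.
pose g := tau - cmod (z - b) - t; have g0 : 0 < g by rewrite /g; move: zt; clear; lra.
(* The accumulated error eta t must be at most d / 2, and below the gap g so that the polygon never
   leaves the disc of radius tau. *)
pose eta := Num.min (d / 2) g / (t + 1).
have t1 : 0 < t + 1 by move: t0; clear; lra.
have eta0 : 0 < eta by rewrite divr_gt0// lt_min g0 andbT divr_gt0.
have eta1 : eta * t <= d / 2.
  apply: (@le_trans _ _ (eta * (t + 1))); first by apply: ler_wpM2l; [exact: ltW|move: t0; clear; lra].
  by rewrite divfK ?gt_eqF// ge_min lexx.
have eta2 : eta * t < g.
  apply: (@lt_le_trans _ _ (eta * (t + 1))); first by rewrite ltr_pM2l//; clear; lra.
  by rewrite divfK ?gt_eqF// ge_min lexx orbT.
have d20 : 0 < d / 2 by move: d0; clear; lra.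
have [e /andP[e0 ed] He] := step eta (d / 2) eta0 d20.
have H k : k%:R * e <= t -> exists2 w, S w & cmod (w - (z + (k%:R * e)%:C * sg)) <= eta * (k%:R * e).
  elim: k => [|k IH] kt; first by exists z => //; rewrite mul0r rmorph0 mul0r addr0 subrr cmod0 mulr0.
  rewrite -natr1 mulrDl mul1r in kt *.
  have kt' : k%:R * e <= t by move: kt e0; clear; lra.
  have [w Sw wz] := IH kt'.
  have wb : cmod (w - b) < tau.
    have t2 := cmod_tri (z + (k%:R * e)%:C * sg) w b.
    have t3 := cmodD (z - b) ((k%:R * e)%:C * sg).
    have t4 : cmod ((k%:R * e)%:C * sg) = k%:R * e.
      by rewrite cmodM sg1 mulr1 cmodR ger0_norm// mulr_ge0 ?ler0n ?ltW.
    have E : z + (k%:R * e)%:C * sg - b = z - b + (k%:R * e)%:C * sg by ring.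
    rewrite t4 in t3; rewrite E in t2.
    have t5 : eta * (k%:R * e) <= eta * t by rewrite ler_pM2l.
    by move: t2 t3 t5 wz eta2 kt'; rewrite /g; move: (k%:R * e) => ke; move: (eta * t) (eta * ke) => p1 p2; clear; lra.
  have [w' Sw' ww] := He w Sw wb; exists w' => //.
  have t2 := cmod_tri (w + e%:C * sg) w' (z + (k%:R * e + e)%:C * sg).
  have E : w + e%:C * sg - (z + (k%:R * e + e)%:C * sg) = w - (z + (k%:R * e)%:C * sg).
    by rewrite rmorphD /=; ring.
  rewrite E in t2; rewrite mulrDr; move: t2 ww wz; clear; lra.
have te : 0 <= t / e by rewrite divr_ge0// ltW.
pose k := Num.trunc (t / e).
have /andP[k1 k2] : k%:R <= t / e < k.+1%:R by exact: Num.Theory.truncn_itv.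
have kt : k%:R * e <= t by rewrite -ler_pdivlMr.
have kt2 : t < k%:R * e + e by move: k2; rewrite ltr_pdivrMr// -natr1 mulrDl mul1r.
have [w Sw wz] := H k kt; exists w => //.
have t2 := cmod_tri (z + (k%:R * e)%:C * sg) w (z + t%:C * sg).
have E : z + (k%:R * e)%:C * sg - (z + t%:C * sg) = (k%:R * e - t)%:C * sg by rewrite rmorphB /=; ring.
rewrite E cmodM sg1 mulr1 cmodR ler0_norm in t2; last by rewrite subr_le0.
have t5 : eta * (k%:R * e) <= eta * t by rewrite ler_pM2l.
by move: t2 t5 wz eta1 kt2 ed; move: (k%:R * e) => ke; move: (eta * t) (eta * ke) => p1 p2; clear; lra.
Qed.

End UltraLimits.

(** * From germs to a vector field and its straightening *)

Section Chart.
Context {R : realType}.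
Local Notation C := R[i].
Implicit Types (a z x y p q : C) (f h psi T : C -> C) (S A K Fa : set C) (r s : R).

Lemma compact_closedE K z : compact K -> (forall d : R, 0 < d -> exists2 a, K a & cmod (a - z) < d) -> K z.
Proof.
move=> cK near; apply: contrapT => nKz.
have [|y Ky|n Hn] := @compact_unif R K (fun y n => n.+1%:R^-1 <= cmod (y - z)) cK.
- by move=> y n m nm; apply: le_trans; rewrite lef_pV2 ?posrE ?ltr0n// ler_nat.
- have y0 : 0 < cmod (y - z) / 2.
    by rewrite divr_gt0// cmod_gt0 subr_eq0; apply: contra_notN nKz => /eqP <-.
  exists (cmod (y - z) / 2) => //; exists (Num.trunc (cmod (y - z) / 2)^-1) => x Kx xy.
  have h : (Num.trunc (cmod (y - z) / 2)^-1).+1%:R^-1 <= cmod (y - z) / 2.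
    rewrite invf_ple ?posrE ?ltr0n//; exact/ltW/Num.Theory.truncnS_gt.
  have t := cmod_tri x y z; rewrite (cmodC y x) in t.
  by move: (_.+1%:R^-1) h xy t => k; clear; lra.
have [|a Ka] := near n.+1%:R^-1; first by rewrite invr_gt0 ltr0n.
by rewrite ltNge Hn.
Qed.

(* v is a limit of the rescaled displacements (psi n - id) / e n. *)
Lemma limit_field A (psi : nat -> C -> C) (q : nat -> C) (e : nat -> R) s kap :
  compact A -> 0 < s -> 0 < kap ->
  (forall n, [/\ A (q n), holoD (psi n) (q n) s, 0 < e n < n.+1%:R^-1,
     forall x, cmod (x - q n) < s -> cmod (psi n x - x) <= e n &
     exists2 x, cmod (x - q n) < s / 4 & kap * e n <= cmod (psi n x - x)]) ->
  exists (v : C -> C) qs, [/\ A qs, holoD v 0 s,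
    forall z, cmod z < s -> ~ (exists2 d : R, 0 < d & forall w, cmod (w - z) < d -> v w = 0) &
    forall dl : R, 0 < dl -> exists n, [/\ e n < dl, cmod (q n - qs) < dl &
      forall z, cmod (z - qs) < s / 2 ->
        exists w, [/\ psi n z = z + (e n)%:C * w, cmod w <= 1 & cmod (w - v (z - qs)) <= dl]]].
Proof.
move=> cA s0 kap0 H.
have [F [FU Foo]] := ultraFilterLemma (F := \oo) _.
have PF : ProperFilter F by exact: ultra_proper.
(* Recentred at q n, all rescaled displacements live on one fixed disc. *)
pose f n z := (psi n (q n + z) - (q n + z)) / (e n)%:C.
have en n : 0 < e n by have [_ _ /andP[]] := H n.
have eC n : (e n)%:C != 0 :> C by rewrite -cmod_gt0 cmodR gtr0_norm.
have hf n : holoD (f n) 0 s.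
  move=> z; rewrite subr0 => zs; have [_ hp _ _ _] := H n.
  have [|l dl] := hp (q n + z); first by rewrite addKB.
  have d1 : cdiff (fun z => q n + z) z 1 by have := cdiffD (cdiff_cst (q n) z) (cdiff_id z); rewrite add0r.
  have := cdiffM (cdiffB (cdiff_comp d1 dl) d1) (cdiff_cst (e n)%:C^-1 z).
  by eexists; eassumption.
have f1 n z : cmod (z - 0) < s -> cmod (f n z) <= 1.
  rewrite subr0 => zs; have [_ _ _ He _] := H n.
  rewrite /f cmod_div cmodR gtr0_norm// ler_pdivrMr// mul1r; apply: He.
  by rewrite addKB.
have [v [hv v1 Hv]] := ultra_holo FU s0 hf f1.
have [qs Aqs Hq] := ultra_lim FU cA (fun n => let: And5 Aq _ _ _ _ := H n in Aq).
have s40 : s / 4 < s by move: s0; clear; lra.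
exists v, qs; split=> //.
(* If v vanished near one point it would vanish identically, against the displacement of at least
   kap e n at a point within s / 4 of q n, where convergence is uniform. *)
- move=> z zs vz.
  have v0 : forall w, cmod (w - 0) < s -> v w = 0.
    apply: (identity_thm (@disc_connected R 0 s) (@disc_open R 0 s) hv _ vz).
    by rewrite /= subr0.
  have k20 : 0 < kap / 2 by move: kap0; clear; lra.
  have [n Hn] := filter_ex (Hv _ s40 _ k20).
  have [_ _ _ _ [x xq xk]] := H n.
  have := Hn (x - q n); rewrite subr0 v0; last by rewrite subr0; exact: lt_trans xq s40.
  move=> /(_ (ltW xq)); rewrite subr0 /f (_ : q n + (x - q n) = x); last by rewrite addrC subrK.
  rewrite cmod_div cmodR gtr0_norm// ler_pdivrMr// => h.
  have := mulr_gt0 kap0 (en n); move: h xk; rewrite mulrAC; clear; move: (kap * e n) => ke; lra.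
- move=> dl dl0.
  pose L := 16 * 4 / s; have L0 : 0 < L by rewrite divr_gt0// mulr_gt0.
  have lipv x y : cmod (x - 0) < s / 4 * 3 -> cmod (y - 0) < s / 4 * 3 -> cmod (v y - v x) <= L * cmod (y - x).
    move=> xs ys; apply: (@lip_disc R v 0 (s / 4 * 3)) => //.
      by apply: holoD_sub hv _; rewrite subrr cmod0; move: s0; clear; lra.
    move=> z zs; have s4 : 0 < s / 4 by move: s0; clear; lra.
    have hz : holoD v z (s / 4) by apply: holoD_sub hv _; move: zs; clear; lra.
    have := cauchy_est s4 hz (M := 1); rewrite (_ : 16 * 1 / (s / 4) = L); last by rewrite /L; field; rewrite gt_eqF.
    by apply => w wz; apply: v1; have := cmod_tri z w 0; move: wz zs; clear; lra.
  (* L d2 <= dl / 2 is the price of replacing the centre q n by its limit qs; the other half of dl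
     is the distance of f n from v. *)
  pose d2 := Num.min (s / 8) (Num.min dl (dl / 2 / L)).
  have d20 : 0 < d2.
    by rewrite !lt_min dl0 /=; apply/andP; split; [move: s0; clear; lra|apply: divr_gt0 => //; move: dl0; clear; lra].
  have d2a : d2 <= s / 8 by rewrite ge_min lexx.
  have d2b : d2 <= dl by rewrite !ge_min lexx !orbT.
  have d2c : L * d2 <= dl / 2 by rewrite mulrC -ler_pdivlMr// !ge_min lexx !orbT.
  have dl20 : 0 < dl / 2 by move: dl0; clear; lra.
  have s58 : s / 8 * 5 < s by move: s0; clear; lra.
  have Fe : F [set n | e n < dl].
    apply: Foo; exists (Num.trunc dl^-1) => // n /= Hn.
    have [_ _ /andP[_ en1] _ _] := H n; apply: lt_le_trans en1 _.
    rewrite invf_ple ?posrE ?ltr0n//; apply: ltW; apply: lt_le_trans (Num.Theory.truncnS_gt _) _.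
    by rewrite ler_nat ltnS.
  have [n [n1 [n2 n3]]] := filter_ex (filterI Fe (filterI (Hq _ d20) (Hv _ s58 _ dl20))).
  exists n; split=> //=; first exact: lt_le_trans n2 d2b.
  move=> z zs; exists (f n (z - q n)).
  have qd : cmod (qs - q n) < d2 by rewrite cmodC.
  have zq : cmod (z - q n) <= s / 8 * 5.
    by have := cmod_tri qs z (q n); move: zs qd d2a; clear; lra.
  have zq' : cmod (z - q n) < s by exact: le_lt_trans zq s58.
  split.
  - by rewrite /f (_ : q n + (z - q n) = z) ?[q n + _]addrC ?subrK// mulrC divfK// addrC subrK.
  - by apply: f1; rewrite subr0.
  - have h1 := n3 (z - q n); rewrite subr0 in h1; have {}h1 := h1 zq.
    have h2 := lipv (z - qs) (z - q n); rewrite !subr0 in h2.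
    have a1 : cmod (z - qs) < s / 4 * 3 by move: zs s0; clear; lra.
    have a2 : cmod (z - q n) < s / 4 * 3 by move: zq s0; clear; lra.
    have {}h2 := h2 a1 a2.
    rewrite (_ : z - q n - (z - qs) = qs - q n) in h2; last by ring.
    have h3 : L * cmod (qs - q n) <= L * d2 by rewrite ler_pM2l// ltW.
    have t := cmod_tri (v (z - q n)) (f n (z - q n)) (v (z - qs)).
    by move: h1 h2 h3 t d2c; clear; lra.
Qed.

(** Cauchy's estimate gives psi - id a derivative of modulus at most 16 e / s <= 1 / 2, the bound
    required by [nearlin] for slope 1. *)
Lemma near_identity psi a r s (e : R) : 0 < s -> 32 * e <= s ->
  (forall z, cmod (z - a) < r -> holoD psi z s) ->
  (forall z w, cmod (z - a) < r -> cmod (w - z) < s -> cmod (psi w - w) <= e) ->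
  nearlin psi a r 1.
Proof.
move=> s0 es hp pe z w za wa.
have hf x : cmod (x - a) < r -> holoD (fun x => psi x - x) x s.
  by move=> xa y /(hp x xa)[l dl]; eexists; exact: cdiffB dl (cdiff_id y).
have ha : holoD (fun x => psi x - x) a r.
  by move=> x xa; apply: hf xa _ _; rewrite subrr cmod0.
have d12 x : cmod (x - a) < r -> cmod (cder (fun x => psi x - x) x) <= 2^-1.
  move=> xa; apply: le_trans (cauchy_est s0 (hf x xa) (pe x ^~ xa)) _.
  by rewrite ler_pdivrMr//; move: es; clear; lra.
have := lip_disc ha d12 za wa.
rewrite (_ : _ - w - _ = psi w - psi z - 1 * (w - z)); last by ring.
by rewrite (_ : cmod 1 = 1) ?mul1r// -[1]/(1%:C) cmodR normr1.
Qed.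

(** P is the inverse of the coordinate T, recentred at T z0. There psi is a translation by e up to
    eta e, so Euler's scheme moves A forward with psi and backward with its inverse, which the last
    clause on psi supplies. As eta is arbitrary and A is closed, invariance under real translations
    is exact. *)
Lemma flow_chart A Fa T z0 d : compact A -> A z0 -> 0 < d ->
  (forall z, cmod (z - z0) < d -> Fa z) ->
  holoD T z0 d -> cder T z0 != 0 -> nearlin T z0 d (cder T z0) ->
  (forall eta e0 : R, 0 < eta -> 0 < e0 -> exists psi (e : R), [/\ 0 < e < e0,
    forall z, cmod (z - z0) < d / 2 -> [/\ cmod (psi z - z0) < d, A z <-> A (psi z) &
      cmod (T (psi z) - T z - e%:C) <= eta * e] &
    forall z, cmod (z - z0) < d / 4 -> exists2 y, cmod (y - z0) < d / 2 & psi y = z]) ->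
  exists P (tau : R), [/\ 0 < tau, univ [set z | cmod (z - 0) < tau] P, A (P 0),
    forall z, cmod (z - 0) < tau -> Fa (P z) &
    forall z (t : R), cmod z + `|t| < tau -> (A (P z) <-> A (P (z + t%:C)))].
Proof.
move=> cA Az0 d0 Fz0 hT T0 nl step.
have uT := nearlin_univ T0 hT nl.
have oD := @isopen_disc R z0 d.
have inj y z : cmod (y - z0) < d -> cmod (z - z0) < d -> T y = T z -> y = z by exact: uT.2.
pose b := T z0; pose tau := cmod (cder T z0) / 4 * (d / 4).
have tau0 : 0 < tau by rewrite mulr_gt0 ?divr_gt0 ?cmod_gt0.
have d2 : d / 2 < d by move: d0; clear; lra.
have d4 : d / 4 < d / 2 by move: d0; clear; lra.
have z00 : cmod (z0 - z0) < d by rewrite subrr cmod0.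
have ex u : exists y, cmod (u - b) < tau -> cmod (y - z0) < d / 4 /\ T y = u.
  have [ub|] := pselect (cmod (u - b) < tau); last by exists 0.
  have [|||y yz Ty] := nearlin_surj T0 nl _ (z := z0) (t := d / 4) _ _ ub; last by exists y.
  - by move=> z /hT[m]; exact: cdiff_ccont.
  - by rewrite subrr cmod0 add0r; exact: lt_trans d4 d2.
  - by move: d0; clear; lra.
have [k Hk] := choice ex.
have kd u : cmod (u - b) < tau -> cmod (k u - z0) < d.
  by move=> /Hk[h _]; apply: lt_trans d2; exact: lt_trans d4.
have kT y : cmod (y - z0) < d -> cmod (T y - b) < tau -> k (T y) = y.
  by move=> yd Tb; apply: inj => //; [exact: kd|exact: (Hk _ Tb).2].
have dk u : cmod (u - b) < tau -> exists l, cdiff k u l.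
  move=> ub; have [ku Tk] := Hk u ub.
  have := @univ_inv R _ T k (k u) oD uT (kd u ub); rewrite Tk => H; eexists; apply: H => //.
  exists (tau - cmod (u - b)); first by rewrite subr_gt0.
  move=> v vu; have vb : cmod (v - b) < tau by have := cmod_tri u v b; move: vu; clear; lra.
  by split; [exact: kd|exact: (Hk v vb).2].
pose S := [set u | cmod (u - b) < tau /\ A (k u)].
have clS u : cmod (u - b) < tau / 2 -> (forall e, 0 < e -> exists2 w, S w & cmod (w - u) < e) -> S u.
  move=> ub near; have ub' : cmod (u - b) < tau by move: ub tau0; clear; lra.
  split=> //; apply: compact_closedE cA _ => e e0.
  have [l dl] := dk u ub'; have e20 : 0 < e / 2 by move: e0; clear; lra.
  have [p p0 Hp] := cdiff_ccont dl e20; have [w [wb Aw] wu] := near p p0.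
  by exists (k w) => //; have := Hp w wu; move: e0; clear; lra.
have stepS (eta e0 : R) : 0 < eta -> 0 < e0 -> exists psi (e : R), [/\ 0 < e < e0, (1 + eta) * e < tau / 2,
    forall z, cmod (z - z0) < d / 2 -> [/\ cmod (psi z - z0) < d, A z <-> A (psi z) &
      cmod (T (psi z) - T z - e%:C) <= eta * e] &
    forall z, cmod (z - z0) < d / 4 -> exists2 y, cmod (y - z0) < d / 2 & psi y = z].
  move=> eta0 e00; have e1 : 0 < 1 + eta by move: eta0; clear; lra.
  have [||psi [e [/andP[ep]]]] := step eta (Num.min e0 (tau / 2 / (1 + eta))) => //.
    by rewrite lt_min e00 !divr_gt0.
  rewrite lt_min ltr_pdivlMr// mulrC => /andP[h1 h2] h3 h4.
  by exists psi, e; split=> //; rewrite ep.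
have near_b (e eta : R) u w sg : cmod sg = 1 -> 0 < e -> (1 + eta) * e < tau / 2 -> cmod (u - b) < tau / 2 ->
    cmod (w - (u + e%:C * sg)) <= eta * e -> cmod (w - b) < tau.
  move=> sg1 e0 h1 h2 h3; have t1 := cmod_tri (u + e%:C * sg) w b.
  have t2 := cmodD (u - b) (e%:C * sg); rewrite cmodM sg1 mulr1 cmodR gtr0_norm// in t2.
  rewrite addrAC in t1; rewrite mulrDl mul1r in h1.
  by move: h1 h2 h3 t1 t2; clear; lra.
have fwd : forall z (t : R), S z -> 0 <= t -> cmod (z - b) + t < tau / 2 -> S (z + t%:C * 1).
  have s1 : cmod (1 : C) = 1 by rewrite -[1]/(1%:C) cmodR normr1.
  apply: (flow_invariance s1 clS) => eta e0 eta0 e00.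
  have [psi [e [/andP[ep ee] h h1 h2]]] := stepS eta e0 eta0 e00.
  exists e; rewrite ?ep// => u [ub Au] u2; have [ku Tk] := Hk u ub.
  have [p1 p2 p3] := h1 (k u) (lt_trans ku d4).
  have E : cmod (T (psi (k u)) - (u + e%:C * 1)) <= eta * e by rewrite mulr1 opprD addrA; rewrite Tk in p3.
  have wb := near_b e eta u _ 1 s1 ep h u2 E.
  by exists (T (psi (k u))) => //; split=> //; rewrite kT//; exact: p2.1.
have bwd : forall z (t : R), S z -> 0 <= t -> cmod (z - b) + t < tau / 2 -> S (z + t%:C * -1).
  have s1 : cmod (-1 : C) = 1 by rewrite cmodN -[1]/(1%:C) cmodR normr1.
  apply: (flow_invariance s1 clS) => eta e0 eta0 e00.
  have [psi [e [/andP[ep ee] h h1 h2]]] := stepS eta e0 eta0 e00.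
  exists e; rewrite ?ep// => u [ub Au] u2; have [ku Tk] := Hk u ub.
  have [y y2 yu] := h2 (k u) ku; have [p1 p2 p3] := h1 y y2.
  have E : cmod (T y - (u + e%:C * -1)) <= eta * e.
    rewrite mulrN1 -cmodN (_ : - _ = T (psi y) - T y - e%:C)//.
    by rewrite yu Tk; ring.
  have wb := near_b e eta u _ _ s1 ep h u2 E.
  exists (T y) => //; split=> //; rewrite kT//; last exact: lt_trans d2.
  by apply: p2.2; rewrite yu.
have tau4 : tau / 4 < tau by move: tau0; clear; lra.
have bb z : cmod (z - 0) < tau / 4 -> cmod (b + z - b) < tau by rewrite addKB subr0 => h; exact: lt_trans tau4.
have kb : k b = z0 by apply: kT => //; rewrite subrr cmod0.
have both z (t : R) : cmod z + `|t| < tau / 2 -> A (k (b + z)) -> A (k (b + (z + t%:C))).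
  move=> zt Az; have Sz : S (b + z).
    split=> //; rewrite addKB; have := normr_ge0 t; move: zt tau0; clear; lra.
  have [t0|t0] := leP 0 t.
    have := fwd (b + z) t Sz t0; rewrite addKB mulr1 -addrA => /(_ _)[]//.
    by rewrite -(ger0_norm t0).
  have := bwd (b + z) (- t) Sz; rewrite addKB mulrN1 rmorphN opprK -addrA => /(_ _ _)[]//.
  - by rewrite oppr_ge0 ltW.
  - by rewrite -(ltr0_norm t0).
exists (fun z => k (b + z)), (tau / 4); split.
- by rewrite divr_gt0.
- split=> [z /bb zb|z w /bb zb /bb wb E].
    have [l dl] := dk _ zb; eexists; apply: cdiff_comp dl.
    exact: cdiffD (cdiff_cst b z) (cdiff_id z).
  by apply: (addrI b); rewrite -(Hk _ zb).2 -(Hk _ wb).2 E.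
- by rewrite addr0 kb.
- by move=> z /bb/kd; exact: Fz0.
- move=> z t zt; split; first by apply: both; move: zt tau0; clear; lra.
  move=> h; have := both (z + t%:C) (- t) _ h; rewrite rmorphN addrK; apply.
  rewrite normrN; have := cmodD z t%:C; rewrite cmodR.
  by have := cmod_ge0 z; move: zt; clear; lra.
Qed.

(* In the coordinate T, a primitive of 1 / v, the germs psi n are translations by
   e n up to o(e n), so A is invariant under the flow of v. *)
Lemma symmetric_chart A Fa s kap : compact A ->
  (forall a, A a -> forall d, 0 < d -> exists b, [/\ A b, b != a & cmod (b - a) < d]) ->
  (forall a, A a -> forall d, 0 < d -> exists b, [/\ A b, cmod (b - a) < d &
     exists2 d', 0 < d' & forall z, cmod (z - b) < d' -> Fa z]) ->
  0 < s -> 0 < kap ->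
  (forall e0 : R, 0 < e0 -> exists psi q (e : R), [/\ germ A Fa psi q s e, 0 < e < e0 &
    exists2 x, cmod (x - q) < s / 4 & kap * e <= cmod (psi x - x)]) ->
  exists P (tau : R), [/\ 0 < tau, univ [set z | cmod (z - 0) < tau] P, A (P 0),
    forall z, cmod (z - 0) < tau -> Fa (P z) &
    forall z (t : R), cmod z + `|t| < tau -> (A (P z) <-> A (P (z + t%:C)))].
Proof.
move=> cA Aperf Adense s0 kap0 germs.
have H n : exists x : (C -> C) * C * R,
    [/\ germ A Fa x.1.1 x.1.2 s x.2, 0 < x.2 < n.+1%:R^-1 &
    exists2 y, cmod (y - x.1.2) < s / 4 & kap * x.2 <= cmod (x.1.1 y - y)].
  have [|psi [q [e He]]] := germs n.+1%:R^-1; first by rewrite invr_gt0 ltr0n.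
  by exists (psi, q, e).
have [seq Hseq] := choice H.
pose psi n := (seq n).1.1; pose q n := (seq n).1.2; pose e n := (seq n).2.
have Hn n : [/\ germ A Fa (psi n) (q n) s (e n), 0 < e n < n.+1%:R^-1 &
    exists2 x, cmod (x - q n) < s / 4 & kap * e n <= cmod (psi n x - x)] := Hseq n.
clearbody psi q e; clear seq Hseq germs H.
have [|v [qs [Aqs hv vnz Hv]]] := @limit_field A psi q e s kap cA s0 kap0.
  by move=> n; have [[Aq hp pe _] en ex] := Hn n; split.
(* A point of A in the interior of [Fa] at which v does not vanish: should v vanish at a first
   choice b, its zero there is isolated, and A has other points arbitrarily close to b. *)
have [z0 [r0 [Az0 r00 Fz0 z0q vz0]]] : exists z0 (r0 : R), [/\ A z0, 0 < r0,
    forall z, cmod (z - z0) < r0 -> Fa z, cmod (z0 - qs) < s / 4 & v (z0 - qs) != 0].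
  have s80 : 0 < s / 8 by move: s0; clear; lra.
  have [b [Ab bq [d d0 Fb]]] := Adense qs Aqs _ s80.
  have [vb|vb] := eqVneq (v (b - qs)) 0; last first.
    by exists b, d; split=> //; move: bq s0; clear; lra.
  have bs : cmod (b - qs) < s by move: bq s0; clear; lra.
  have hb : holoD v (b - qs) (s / 8).
    by apply: holoD_sub hv _; rewrite subr0; move: bq s0; clear; lra.
  have [zb|[d1 d10 nz]] := zeros_isolated s80 hb; first by have := vnz _ bs zb.
  have [|b' [Ab' bb bd]] := Aperf b Ab (Num.min (s / 8) (Num.min (d / 2) d1)).
    by rewrite !lt_min s80 d10 andbT divr_gt0.
  move: bd; rewrite !lt_min => /and3P[b1 b2 b3].
  exists b', (d / 2); split=> //.
  - by move: d0; clear; lra.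
  - by move=> z zb; apply: Fb; have := cmod_tri b' z b; move: zb b2; clear; lra.
  - by have := cmod_tri b b' qs; move: b1 bq; clear; lra.
  - apply: nz; first by rewrite (_ : b' - qs - (b - qs) = b' - b)//; ring.
    by apply: contra_neq bb => /addIr.
pose vs z := v (z - qs).
have dvs z : cmod (z - qs) < s -> exists l, cdiff vs z l.
  move=> zs; have [|l dl] := hv (z - qs); first by rewrite subr0.
  have d1 : cdiff (fun z => z - qs) z 1 by have := cdiffB (cdiff_id z) (cdiff_cst qs z); rewrite subr0.
  by eexists; exact: cdiff_comp d1 dl.
have z0s : cmod (z0 - qs) < s by move: z0q s0; clear; lra.
have [l0 dl0] := dvs z0 z0s.
have [d3 d30 Hd3] := ccont_neq0 vz0 (cdiff_ccont dl0).
pose m := cmod (vs z0) / 2; have m0 : 0 < m by rewrite divr_gt0// cmod_gt0.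
pose r := Num.min r0 (Num.min (s / 8) d3).
have rp : 0 < r by rewrite !lt_min r00 d30 andbT divr_gt0.
have rr0 : r <= r0 by rewrite ge_min lexx.
have rs : r <= s / 8 by rewrite !ge_min lexx !orbT.
have rd : r <= d3 by rewrite !ge_min lexx !orbT.
have vm z : cmod (z - z0) < r -> m <= cmod (vs z) /\ vs z != 0.
  by move=> zr; have := Hd3 z (lt_le_trans zr rd).
have rqs z : cmod (z - z0) < r -> cmod (z - qs) < s / 2.
  by move=> zr; have := cmod_tri z0 z qs; move: zr z0q rs s0; clear; lra.
have [|T dT] := @disc_primitive R (fun z => (vs z)^-1) z0 r.
  move=> z zr; have [|l dl] := dvs z; first by have := rqs z zr; move: s0; clear; lra.
  by eexists; exact: cdiffV (vm z zr).2 dl.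
have hT : holoD T z0 r by move=> z zr; eexists; exact: dT.
have zz0 : cmod (z0 - z0) < r by rewrite subrr cmod0.
have T0 : cder T z0 != 0 by rewrite (cderE (dT z0 zz0)) invr_eq0 (vm z0 zz0).2.
have [d1 /andP[d10 d1r] nl] := nearlin_near rp hT T0.
have hT1 : holoD T z0 d1 by apply: holoD_sub hT _; rewrite subrr cmod0 add0r.
have d12 : 0 < d1 / 2 < d1 by move: d10; clear=> ?; apply/andP; split; lra.
have [K K0 HK] := quad_unif d12 hT1.
apply: (flow_chart cA Az0 d10 _ hT1 T0 nl).
  by move=> z zd; apply: Fz0; apply: lt_le_trans rr0; exact: lt_le_trans zd d1r.
move=> eta e0.
  move=> eta0 e00.
  (* [dl] bounds both e n and the distance of the rescaled displacement from v. The term eta m / 2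
     makes the first order error at most eta / 2 times e n, and eta / (2 K) does the same for the
     quadratic one; the last two keep psi n z in the chart and psi n invertible. *)
  pose dl := Num.min (Num.min e0 (eta * m / 2)) (Num.min (eta / (2 * K)) (Num.min (d1 / 32) (s / (16 * 8)))).
  have dlp : 0 < dl.
    rewrite !lt_min e00 /=; apply/and4P; split; apply: divr_gt0 => //; apply: mulr_gt0 => //.
  have l1 : dl <= e0 by rewrite !ge_min lexx.
  have l2 : dl <= eta * m / 2 by rewrite !ge_min lexx !orbT.
  have l3 : dl <= eta / (2 * K) by rewrite !ge_min lexx !orbT.
  have l4 : dl <= d1 / 32 by rewrite !ge_min lexx !orbT.
  have l5 : dl <= s / (16 * 8) by rewrite !ge_min lexx !orbT.
  clearbody dl.
  have [n [n1 n2 n3]] := Hv dl dlp.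
  have [[Aq hp pe sym] /andP[en _] _] := Hn n.
  have en0 := ltW en.
  exists (psi n), (e n); split; first by rewrite en; exact: lt_le_trans n1 l1.
    move=> z z2.
    have zd1 : cmod (z - z0) < d1 by move: z2 d10; clear; lra.
    have zr : cmod (z - z0) < r by exact: lt_le_trans zd1 d1r.
    have [w [pz w1 wv]] := n3 z (rqs z zr).
    have pzz : cmod (psi n z - z) <= e n.
      by rewrite pz addKB cmodM cmodR ger0_norm// ler_piMr.
    have e32 : e n <= d1 / 32 by apply: le_trans l4; exact: ltW.
    have pz0 : cmod (psi n z - z0) < d1.
      by have := cmod_tri z (psi n z) z0; move: pzz e32 z2 d10; clear; lra.
    have zqn : cmod (z - q n) < s.
      have := cmod_tri qs z (q n); rewrite (cmodC qs).
      have := rqs z zr; have h : s / (16 * 8) <= s / 4 by rewrite ler_pM2l// lef_pV2 ?posrE ?mulr_gt0//; clear; lra.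
      by move: n2 l5 h s0; clear; move: (s / (16 * 8)) => *; lra.
    split=> //.
    - apply: sym => //; apply: Fz0; first exact: lt_le_trans zr rr0.
      by apply: lt_le_trans rr0; exact: lt_le_trans pz0 d1r.
    - have q1 := HK z ((e n)%:C * w) (ltW z2).
      have ew : cmod ((e n)%:C * w) <= e n by rewrite cmodM cmodR ger0_norm// ler_piMr.
      have d18 : (d1 - d1 / 2) / 8 = d1 / 16 by field.
      have ed : cmod ((e n)%:C * w) <= (d1 - d1 / 2) / 8.
        by rewrite d18; move: ew e32 d10; clear; lra.
      have {}q1 := q1 ed; rewrite -pz (cderE (dT z zr)) in q1.
      have [mv v0] := vm z zr.
      have q2 : cmod ((e n)%:C * w * (vs z)^-1 - (e n)%:C) <= e n * (eta / 2).
        rewrite (_ : _ - _ = (e n)%:C * ((w - vs z) / vs z)); last by field.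
        rewrite cmodM cmodR ger0_norm//; apply: ler_wpM2l => //.
        rewrite cmod_div ler_pdivrMr ?cmod_gt0//; apply: le_trans wv _; apply: le_trans l2 _.
        rewrite mulrAC; apply: ler_wpM2l => //; move: eta0; clear; lra.
      have q3 : K * cmod ((e n)%:C * w) ^+ 2 <= e n * (eta / 2).
        apply: (@le_trans _ _ (K * (e n * e n))).
          apply: ler_wpM2l; first exact: ltW.
          by rewrite expr2; apply: ler_pM; rewrite ?cmod_ge0.
        rewrite mulrCA; apply: ler_wpM2l => //.
        have : e n <= eta / (2 * K) by apply: le_trans l3; exact: ltW.
        rewrite ler_pdivlMr ?mulr_gt0// => h; move: h; rewrite mulrC -mulrA; clear; lra.
      rewrite (_ : _ - _ - _ = (T (psi n z) - T z - (e n)%:C * w * (vs z)^-1) + ((e n)%:C * w * (vs z)^-1 - (e n)%:C)); last by ring.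
      have t := cmodD (T (psi n z) - T z - (e n)%:C * w * (vs z)^-1) ((e n)%:C * w * (vs z)^-1 - (e n)%:C).
      rewrite [eta * _]mulrC; apply: le_trans t _.
      move: q1 q2 q3; rewrite (_ : e n * eta = e n * (eta / 2) * 2); last by field.
      by rewrite /vs; clear; move: (e n * (eta / 2)) => *; lra.
move=> z z4.
have zd z' : cmod (z' - z0) < d1 / 2 -> cmod (z' - q n) < s / 4 * 3.
  move=> z2; have zr : cmod (z' - z0) < r by apply: lt_le_trans d1r; move: z2 d10; clear; lra.
  have := rqs z' zr; have := cmod_tri qs z' (q n); rewrite (cmodC qs).
  have h : s / (16 * 8) <= s / 4 by rewrite ler_pM2l// lef_pV2 ?posrE ?mulr_gt0//; clear; lra.
  by move: n2 l5 h s0; clear; move: (s / (16 * 8)) => *; lra.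
have s40 : 0 < s / 4 by move: s0; clear; lra.
(* The inverse of psi n is reached by solving psi n y = z near z. *)
have nlp : nearlin (psi n) z0 (d1 / 2) 1.
  apply: (near_identity s40 (e := e n)).
  - have : e n <= s / (16 * 8) by apply: le_trans l5; exact: ltW.
    by rewrite ler_pdivlMr ?mulr_gt0//; clear; lra.
  - by move=> z' z2; apply: holoD_sub hp _; have := zd z' z2; clear; lra.
  - move=> z' w z2 wz; apply: pe; have := cmod_tri z' w (q n); have := zd z' z2.
    by move: wz; clear; lra.
have [||||y yz yE] := nearlin_surj (oner_neq0 _) nlp _ (z := z) (t := d1 / 8) (u := z).
- move=> z' /zd z2; have [|l dl'] := hp z'; first by move: z2 s0; clear; lra.
  exact: cdiff_ccont dl'.
- by move: z4 d10; clear; lra.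
- by move: d10; clear; lra.
- rewrite cmodC; apply: le_lt_trans (pe z _) _.
    by have := zd z; move: z4 d10 s0; clear; lra.
  rewrite (_ : cmod 1 = 1) -?[1]/(1%:C) ?cmodR ?normr1//.
  by move: n1 l4; clear; lra.
- exists y => //; have := cmod_tri z y z0; move: yz z4 d10; clear; lra.
Qed.

End Chart.

(** * Laminations *)

Section Laminations.
Context {R : realType}.
Local Notation C := R[i].
Local Notation Re := complex.Re.
Local Notation Im := complex.Im.
Implicit Types (p q u v w z : C) (f k Q : C -> C) (A O S K N : set C) (r s t : R).

Lemma Re_seg p q s : Re (p + s%:C * (q - p)) = Re p + s * (Re q - Re p).
Proof. by case: p q => [a b] [c d] /=; ring. Qed.

Lemma Im_seg p q s : Im (p + s%:C * (q - p)) = Im p + s * (Im q - Im p).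
Proof. by case: p q => [a b] [c d] /=; ring. Qed.

Lemma imag_axisE (y : R) : y%:C * 'i%C = Complex 0 y.
Proof. by apply/eqP; rewrite eq_complex; apply/andP; split; apply/eqP => /=; ring. Qed.

Lemma closure_cmod S z : closure S z <-> forall d, 0 < d -> exists2 a, S a & cmod (a - z) < d.
Proof.
split=> [cz d d0|H B /nbhs_cmod[d d0 Hd]].
  have [|a [Sa az]] := cz [set w | cmod (w - z) < d]; first by apply/nbhs_cmod; exists d.
  by exists a.
by have [a Sa az] := H d d0; exists a; split=> //; exact: Hd.
Qed.

Lemma image_compact S f : compact S -> (forall z, S z -> ccont f z) -> compact (f @` S).
Proof.
move=> cS cf; apply: continuous_compact cS; apply: continuous_in_subspaceT => z.
by rewrite inE => /cf /ccontP.
Qed.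

(** Width 1 is dictated by the factor [0, 1] in [laminar]; the height is such that both boxes lie in
    the disc of radius 2 on which charts are normalised. *)
Definition open_box : set C := [set z | 0 < Re z < 1 /\ -(1/2) < Im z < 1/2].
Definition closed_box : set C := [set z | 0 <= Re z <= 1 /\ -(1/2) <= Im z <= 1/2].

Lemma closed_box_disc z : closed_box z -> cmod z <= 3 / 2.
Proof.
move=> [/andP[z1 z2] /andP[z3 z4]]; apply: le_trans (cmod_ReIm z) _.
rewrite (ger0_norm z1); have : `|Im z| <= 1/2 by rewrite ler_norml z3 z4.
by move: z2; clear; lra.
Qed.

Lemma open_box_closed z : open_box z -> closed_box z.
Proof. by move=> [/andP[z1 z2] /andP[z3 z4]]; rewrite /closed_box /= !ltW. Qed.

Lemma box_limit (a b : R) z : (forall d, 0 < d -> exists2 w, cmod (w - z) < d & a <= Re w <= b) -> a <= Re z <= b.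
Proof.
move=> H; apply/andP; split; apply/ler_addgt0Pr => d /H[w wz /andP[w1 w2]];
  have := le_lt_trans (cmod_Re (w - z)) wz; rewrite raddfB ltr_norml => /andP[]; move: w1 w2; clear; lra.
Qed.

Lemma box_limit_Im (a b : R) z : (forall d, 0 < d -> exists2 w, cmod (w - z) < d & a <= Im w <= b) -> a <= Im z <= b.
Proof.
move=> H; apply/andP; split; apply/ler_addgt0Pr => d /H[w wz /andP[w1 w2]];
  have := le_lt_trans (cmod_Im (w - z)) wz; rewrite raddfB ltr_norml => /andP[]; move: w1 w2; clear; lra.
Qed.

Lemma closed_eps S : (forall z, (forall d, 0 < d -> exists2 a, S a & cmod (a - z) < d) -> S z) -> closed S.
Proof. by move=> H z /closure_cmod; exact: H. Qed.

Lemma closed_box_compact : compact closed_box.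
Proof.
apply: (subclosed_compact _ (@closed_disc_compact R 0 2)); last first.
  by move=> z /closed_box_disc /=; rewrite subr0; clear; lra.
apply: closed_eps => z H; split.
  by apply: box_limit => d /H[w [w1 w2] wz]; exists w.
by apply: box_limit_Im => d /H[w [w1 w2] wz]; exists w.
Qed.

Lemma open_box_open : isopen open_box.
Proof.
move=> z [/andP[z1 z2] /andP[z3 z4]].
pose d := Num.min (Num.min (Re z) (1 - Re z)) (Num.min (Im z + 1/2) (1/2 - Im z)).
have d0 : 0 < d by rewrite !lt_min z1; apply/andP; split; [|apply/andP; split]; move: z2 z3 z4; clear; lra.
have d1 : d <= Re z by rewrite !ge_min lexx.
have d2 : d <= 1 - Re z by rewrite !ge_min lexx !orbT.
have d3 : d <= Im z + 1/2 by rewrite !ge_min lexx !orbT.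
have d4 : d <= 1/2 - Im z by rewrite !ge_min lexx !orbT.
exists d => // w wz.
have := le_lt_trans (cmod_Im (w - z)) wz; have := le_lt_trans (cmod_Re (w - z)) wz.
rewrite !raddfB !ltr_norml => /andP[a1 a2] /andP[b1 b2].
by split; apply/andP; move: d1 d2 d3 d4 a1 a2 b1 b2; clear; split; lra.
Qed.

Lemma open_box_seg p q s : open_box p -> open_box q -> 0 <= s <= 1 -> open_box (p + s%:C * (q - p)).
Proof.
move=> [/andP[p1 p2] /andP[p3 p4]] [/andP[q1 q2] /andP[q3 q4]] /andP[s0 s1].
rewrite /open_box /= Re_seg Im_seg.
have conv (x y a b : R) : a < x -> x < b -> a < y -> y < b -> a < x + s * (y - x) /\ x + s * (y - x) < b.
  have [xy|yx] := leP x y.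
    have := mulr_ge0 s0 (_ : 0 <= y - x); rewrite subr_ge0 => /(_ xy).
    have := ler_piMl (_ : 0 <= y - x) s1; rewrite subr_ge0 => /(_ xy).
    by move: (s * _) => u; clear; split; lra.
  have := mulr_ge0 s0 (_ : 0 <= x - y); rewrite subr_ge0 => /(_ (ltW yx)).
  have := ler_piMl (_ : 0 <= x - y) s1; rewrite subr_ge0 => /(_ (ltW yx)).
  rewrite -opprB mulrN; by move: (s * _) => u; clear; split; lra.
have [h1 h2] := conv _ _ _ _ p1 p2 q1 q2; have [h3 h4] := conv _ _ _ _ p3 p4 q3 q4.
by rewrite h1 h2 h3 h4.
Qed.

(** The loop is pulled back to the convex set S by the continuous left inverse k, contracted along
    segments to its base point and mapped forward by f. *)
Lemma straight_homotopy S f k (gam : R -> C) :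
  (forall p q s, S p -> S q -> 0 <= s <= 1 -> S (p + s%:C * (q - p))) ->
  (forall z, S z -> ccont f z) -> (forall z, S z -> ccont k (f z) /\ k (f z) = z) ->
  {within `[0, 1], continuous gam} -> (forall t, 0 <= t <= 1 -> (f @` S) (gam t)) ->
  gam 0 = gam 1 -> null_homotopic (f @` S) gam.
Proof.
move=> cvx cf ck cg Sg g01.
pose u t := k (gam t).
have Su t : 0 <= t <= 1 -> S (u t) /\ f (u t) = gam t.
  by move=> /Sg[y Sy fy]; rewrite /u -fy (ck y Sy).2.
have i0 : 0 <= (0 : R) <= 1 by apply/andP; split; [exact: lexx|exact: ler01].
have i1 : 0 <= (1 : R) <= 1 by apply/andP; split; [exact: ler01|exact: lexx].
have cu t : 0 <= t <= 1 -> forall e, 0 < e -> exists2 d : R, 0 < d &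
    forall t', 0 <= t' <= 1 -> `|t' - t| < d -> cmod (u t' - u t) <= e.
  move=> t01 e e0; have [y Sy fy] := Sg t t01; have [ckt _] := ck y Sy; rewrite fy in ckt.
  have [d d0 Hd] := ckt e e0.
  have := (@subspace_continuousP _ _ _ gam).1 cg t; rewrite /= in_itv /= => /(_ t01).
  move=> /(_ [set w | cmod (w - gam t) < d])[|p p0 Hp]; first by apply/nbhs_cmod; exists d.
  exists p => // t' t'01 tt; apply: Hd; apply: Hp; last by rewrite /= in_itv.
  by rewrite /= distrC.
exists (fun x : R * R => f (u x.2 + (x.1)%:C * (u 0 - u x.2))); split.
- apply/subspace_continuousP => -[s t] [/=]; rewrite !in_itv /= => s01 t01.
  apply/(@cvgrPdist_le C C _ _ _ (fun x : R * R => f (u x.2 + (x.1)%:C * (u 0 - u x.2))) (f (u t + s%:C * (u 0 - u t)))) => e e0.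
  have [-> e0'] := gt0_complex e0.
  have [||d d0 Hd] := cf (u t + s%:C * (u 0 - u t)) _ (complex.Re e) => //.
    by apply: cvx => //; [exact: (Su t t01).1|exact: (Su 0 i0).1].
  have d40 : 0 < d / 4 by move: d0; clear; lra.
  have [d1 d10 Hd1] := cu t t01 _ d40.
  pose B := cmod (u 0 - u t) + 1; have B0 : 0 < B by rewrite /B; have := cmod_ge0 (u 0 - u t); clear; lra.
  have d2 : 0 < d / 4 / B by rewrite divr_gt0.
  exists (ball s (d / 4 / B), ball t d1); first by split; apply: nbhsx_ballx.
  move=> [s' t'] [/=]; rewrite /ball /= => ss tt []; rewrite /= !in_itv /= => s'01 t'01.
  rewrite normcmodE lecR cmodC; apply: Hd.
  have h1 := Hd1 t' t'01; rewrite distrC in h1; have {}h1 := h1 tt.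
  rewrite (_ : _ - _ = (1 - s')%:C * (u t' - u t) + (s' - s)%:C * (u 0 - u t)); last by rewrite !rmorphB rmorph1; ring.
  have h2 := cmodD ((1 - s')%:C * (u t' - u t)) ((s' - s)%:C * (u 0 - u t)).
  have [s'0 s'1] := andP s'01.
  rewrite !cmodM !cmodR ger0_norm ?subr_ge0// (distrC s') in h2.
  have h3 : (1 - s') * cmod (u t' - u t) <= cmod (u t' - u t).
    by rewrite ler_piMl ?cmod_ge0//; move: s'0; clear; lra.
  have h4 : `|s - s'| * cmod (u 0 - u t) <= d / 4.
    apply: (@le_trans _ _ (d / 4 / B * B)); last by rewrite divfK// gt_eqF.
    by apply: ler_pM; rewrite ?cmod_ge0 ?(ltW ss)// /B; clear; lra.
  by move: h1 h2 h3 h4 d0; clear; lra.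
- move=> s t s01 t01; exists (u t + s%:C * (u 0 - u t)) => //=.
  by apply: cvx => //; [exact: (Su t t01).1|exact: (Su 0 i0).1].
- by move=> t t01 /=; rewrite rmorph0 mul0r addr0 (Su t t01).2.
- by move=> t t01 /=; rewrite rmorph1 mul1r addrC subrK (Su 0 i0).2.
- have u01 : u 1 = u 0 by rewrite /u g01.
  by move=> s s01 /=; rewrite u01 subrr mulr0 addr0 (Su 0 i0).2.
Qed.

(** W is the image of the open box, psi the inverse of Q, and L the trace of A on the left side of
    the closed box. Horizontal invariance makes membership in A depend on the imaginary part alone,
    so the trace of A on the box is a product. *)
Lemma laminar_box A O Q : compact A -> univ [set z | cmod (z - 0) < 2] Q ->
  (forall z, cmod (z - 0) < 2 -> O (Q z)) -> A (Q 0) ->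
  (forall z, closed_box z -> (A (Q z) <-> A (Q ((Im z)%:C * 'i%C)))) ->
  exists2 W : set C, W `<=` O /\ simply_connected_domain W &
    exists (L : set C) psi, [/\ L !=set0, compact L, L `<=` [set z | Re z = 0],
      exists N : set C, [/\ open N, closure W `<=` N & univalent_on N psi] &
      psi @` (closure W `&` A) = [set x%:C + y | x in `[0, 1]%classic & y in L]].
Proof.
move=> cA uQ OQ A0 inv.
pose D := [set z : C | cmod (z - 0) < 2].
have oD : isopen D by exact: isopen_disc.
have bD z : closed_box z -> D z by move=> /closed_box_disc; rewrite /D /= subr0; clear; lra.
have cQ z : D z -> ccont Q z by move=> /uQ.1[l]; exact: cdiff_ccont.
have ex u : exists y, (Q @` D) u -> D y /\ Q y = u.
  by have [[y Dy yu]|no] := pselect ((Q @` D) u); [exists y|exists 0 => /no].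
have [k Hk] := choice ex.
have kQ z : D z -> k (Q z) = z.
  move=> Dz; have [|h1 h2] := Hk (Q z); first by exists z.
  exact: uQ.2 h2.
have openQ S : isopen S -> S `<=` D -> isopen (Q @` S).
  move=> oS SD _ [z Sz <-]; have [d d0 Hd] := oS z Sz.
  have [p p0 Hp] := univ_open oD uQ (SD z Sz) d0.
  by exists p => // u /Hp[y [/Hd Sy _ <-]]; exists y.
have dk u : (Q @` D) u -> exists l, cdiff k u l.
  move=> Nu; have [Dk Qk] := Hk u Nu.
  have := univ_inv oD uQ Dk (g := k); rewrite Qk => H; eexists; apply: H => //.
  by have [d d0 Hd] := openQ D oD (fun z h => h) u Nu; exists d => // v /Hd/Hk.
have box_half : open_box ((1/2)%:C : C) by split => /=; apply/andP; split; clear; lra.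
have obD z : open_box z -> D z by move=> /open_box_closed/bD.
have cvx p q s : open_box p -> open_box q -> 0 <= s <= 1 -> open_box (p + s%:C * (q - p)) by exact: open_box_seg.
have clW : closure (Q @` open_box) = Q @` closed_box.
  rewrite eqEsubset; split=> v.
    move=> /closure_cmod cv; apply: compact_closedE (image_compact closed_box_compact _) _.
      by move=> z /bD/cQ.
    by move=> d /cv[_ [z /open_box_closed bz <-] zv]; exists (Q z) => //; exists z.
  move=> [z bz <-]; apply/closure_cmod => d d0.
  have d20 : 0 < d / 2 by move: d0; clear; lra.
  have [p p0 Hp] := cQ z (bD z bz) _ d20.
  (* A short move towards the centre 1 / 2 of the box takes a boundary point inside. *)
  pose e := Num.min 1 p / 4.
  have e1 : 0 < e < 1.
    have := ge_min 1 1 p; rewrite lexx /= => h.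
    have : 0 < Num.min 1 p by rewrite lt_min p0 ltr01.
    by rewrite /e; move: h; move: (Num.min 1 p) => m ? ?; apply/andP; split; lra.
  have ep : e * 4 <= p by rewrite /e divfK// ge_min lexx orbT.
  pose w := z + e%:C * ((1/2)%:C - z).
  have bw : open_box w.
    move: bz => [/andP[z1 z2] /andP[z3 z4]]; have [e0 e1'] := andP e1.
    rewrite /open_box /= Re_seg Im_seg /=.
    by split; apply/andP; split; nra.
  exists (Q w); first by exists w.
  apply: le_lt_trans (_ : _ <= d / 2) _; last by move: d0; clear; lra.
  apply: Hp; rewrite /w addKB cmodM cmodR; have [e0 e1'] := andP e1; rewrite gtr0_norm//.
  have h1 : cmod ((1/2)%:C - z) <= 2.
    apply: le_trans (cmodB _ _) _; rewrite cmodR ger0_norm; last by clear; lra.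
    by have := closed_box_disc bz; clear; lra.
  have h2 : e * cmod ((1/2)%:C - z) <= e * 2 by rewrite ler_pM2l.
  by move: h2 ep e0; clear; lra.
exists (Q @` open_box).
  split; first by move=> _ [z /obD Dz <-]; exact: OQ.
  split; last first.
    move=> gam cg Wg g01; apply: (straight_homotopy (k := k) cvx) => //.
      by move=> z /obD/cQ.
    move=> z /obD Dz; split; last exact: kQ.
    by have [|l dl] := dk (Q z); [exists z|exact: cdiff_ccont dl].
  split.
  - by apply/isopenP; apply: openQ obD; exact: open_box_open.
  - by apply: (convex_connected box_half cvx) => z /obD/cQ.
  - by exists (Q (1/2)%:C); exists (1/2)%:C.
exists [set z | Re z = 0 /\ closed_box z /\ A (Q z)], k; split.
- exists 0; split=> //; split=> //; split=> /=; apply/andP; split; clear; lra.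
- apply: (subclosed_compact _ closed_box_compact); last by move=> z [_ []].
  apply: closed_eps => z H.
  have bz : closed_box z.
    split.
      by apply: box_limit => d /H[w [_ [[w1 w2] _]] wz]; exists w.
    by apply: box_limit_Im => d /H[w [_ [[w1 w2] _]] wz]; exists w.
  split; last split=> //.
    have /andP[h1 h2] : 0 <= Re z <= 0.
      by apply: box_limit => d /H[w [w0 _] wz]; exists w => //; rewrite w0 lexx.
    by apply/eqP; rewrite eq_le h1 h2.
  apply: compact_closedE cA _ => d d0.
  have d20 : 0 < d / 2 by move: d0; clear; lra.
  have [p p0 Hp] := cQ z (bD z bz) _ d20; have [w [_ [_ Aw]] wz] := H p p0.
  by exists (Q w) => //; have := Hp w wz; move: d0; clear; lra.
- by move=> z [].
- exists (Q @` D); split.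
  + by apply/isopenP; exact: openQ.
  + by rewrite clW => _ [z /bD Dz <-]; exists z.
  + split; first by move=> u /dk[l /cdiff_is_derive[]].
    by move=> u v; rewrite !inE => Nu Nv E; rewrite -(Hk u Nu).2 -(Hk v Nv).2 E.
- rewrite clW eqEsubset; split=> [_ [_ [[z bz <-] Az] <-]|_ [x x01 [y [y0 [by_ Ay]] <-]]].
    rewrite kQ; last exact: bD.
    have [/andP[z1 z2] z34] := bz.
    exists (Re z); first by rewrite /= in_itv /= z1.
    exists ((Im z)%:C * 'i%C); last by rewrite [_%:C * _]mulrC -complexE.
    have E := imag_axisE (Im z).
    split; first by rewrite E.
    split; last by apply/(inv z bz).
    by split; rewrite E//= lexx ler01.
  move: x01; rewrite /= in_itv /= => x01.
  have bz : closed_box (x%:C + y) by split; rewrite !raddfD /= ?y0 ?addr0 ?add0r//; case: by_.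
  have yE : (Im (x%:C + y))%:C * 'i%C = y.
    by rewrite imag_axisE; case: y y0 {by_ Ay bz} => a b /= ->; rewrite add0r.
  exists (Q (x%:C + y)); last by rewrite kQ//; exact: bD.
  by split; [exists (x%:C + y)|apply/(inv _ bz); rewrite yE].
Qed.

End Laminations.

(** * Transport of the chart over A *)

Section Symmetry.
Context {R : realType}.
Local Notation C := R[i].
Implicit Types (a b p q x y z w : C) (f h psi P : C -> C) (A D Fa Om U : set C) (r s tau : R).

(** The charts are f (P (c z)), where f carries a disc about P 0 close to a given point of A.
    Membership in A passes through f at points of [Fa], so horizontal invariance is preserved. *)
Lemma chart_laminar A Fa P tau rr : compact A -> 0 < rr ->
  (forall p a d, A p -> A a -> 0 < d -> exists f, [/\ univ [set z | cmod (z - p) < rr] f,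
     forall z, cmod (z - p) < rr -> cmod (f z - a) < d & forall x, Fa x -> (A x <-> A (f x))]) ->
  0 < tau -> univ [set z | cmod (z - 0) < tau] P -> A (P 0) ->
  (forall z, cmod (z - 0) < tau -> Fa (P z)) ->
  (forall z (t : R), cmod z + `|t| < tau -> (A (P z) <-> A (P (z + t%:C)))) ->
  forall D, laminar A D.
Proof.
move=> cA rr0 fs tau0 uP A0 FP inv D O oO _ [a [Oa Aa]].
have /isopenP/(_ a Oa)[d d0 Hd] := oO.
have [f [uf fa fA]] := fs _ _ _ A0 Aa d0.
have [|l dl] := uP.1 0; first by rewrite /= subrr cmod0.
have rr2 : 0 < rr / 2 by move: rr0; clear; lra.
have [d1 d10 Hd1] := cdiff_ccont dl rr2.
(* After this scaling the disc of radius 2 lands where P is defined and stays within rr / 2 of P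
   0. *)
pose c := Num.min tau d1 / 4.
have m0 : 0 < Num.min tau d1 by rewrite lt_min tau0.
have c0 : 0 < c by rewrite divr_gt0.
have ct : c * 4 <= tau by rewrite /c divfK// ge_min lexx.
have cd : c * 4 <= d1 by rewrite /c divfK// ge_min lexx orbT.
clearbody c.
have cz z : cmod (z - 0) < 2 -> cmod (c%:C * z) < c * 2.
  by rewrite subr0 cmodM cmodR gtr0_norm// ltr_pM2l.
have Dt z : cmod (z - 0) < 2 -> cmod (c%:C * z - 0) < tau.
  by move=> /cz; rewrite subr0; move: ct c0; clear; lra.
have Dr z : cmod (z - 0) < 2 -> cmod (P (c%:C * z) - P 0) < rr.
  move=> /cz h; have h1 : cmod (c%:C * z - 0) < d1 by rewrite subr0; move: h cd c0; clear; lra.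
  by have := Hd1 _ h1; move: rr0; clear; lra.
have invf z (t : R) : cmod z + `|t| < tau -> (A (f (P z)) <-> A (f (P (z + t%:C)))).
  move=> zt.
  have t1 := cmodD z t%:C; rewrite cmodR in t1; have t0 := normr_ge0 t.
  have F1 : Fa (P z) by apply: FP; rewrite subr0; move: zt t0; clear; lra.
  have F2 : Fa (P (z + t%:C)) by apply: FP; rewrite subr0; move: zt t1; clear; lra.
  have i1 := inv z t zt; have i2 := fA _ F1; have i3 := fA _ F2; tauto.
apply: (@laminar_box R A O (fun z => f (P (c%:C * z))) cA).
- split=> [z z2|z w z2 w2 E].
    have [l1 dl1] := uP.1 _ (Dt z z2); have [l2 dl2] := uf.1 _ (Dr z z2).
    have := cdiff_comp (cdiffZ c%:C (cdiff_id z)) dl1; move=> /cdiff_comp/(_ dl2).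
    by move=> h; eexists; exact: h.
  have := uP.2 _ _ (Dt z z2) (Dt w w2) (uf.2 _ _ (Dr z z2) (Dr w w2) E).
  by apply: mulfI; rewrite -cmod_eq0 cmodR gtr0_norm// gt_eqF.
- by move=> z /Dr/fa; exact: Hd.
- have F0 : Fa (P 0) by apply: FP; rewrite subrr cmod0.
  by rewrite mulr0; exact: (fA _ F0).1.
- move=> z [/andP[z1 z2] /andP[z3 z4]].
  pose y := c%:C * ((complex.Im z)%:C * 'i%C).
  have E : c%:C * z = y + (c * complex.Re z)%:C.
    by rewrite {1}[z]complexE (_ : (c * _)%:C = c%:C * (complex.Re z)%:C) ?[LHS]rmorphM// /y; ring.
  have h : cmod y + `|c * complex.Re z| < tau.
    rewrite /y !cmodM !cmodR cmodI mulr1 normrM gtr0_norm// (ger0_norm z1).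
    have : `|complex.Im z| <= 1/2 by rewrite ler_norml z3 z4.
    move=> h; have h1 : c * `|complex.Im z| <= c * (1/2) by rewrite ler_pM2l.
    have h2 : c * complex.Re z <= c * 1 by rewrite ler_pM2l.
    by move: h1 h2 ct c0; clear; lra.
  by rewrite E; have := invf y _ h; tauto.
Qed.

End Symmetry.

(** * Rigidity for the system G_* *)

Section Rigidity.
Context {R : realType}.
Local Notation C := R[i].
Implicit Types (a b p q x y z : C) (f h psi P : C -> C) (A D Fa Om U : set C) (r s tau M eta : R).

(** The points at which the image under any word detects membership in A. Quantifying over all words
    makes the set stable under words, which a condition on single letters would not ensure. *)
Definition faithful_set Om A n (g : 'I_n -> C -> C) :=
  [set x | Om x /\ forall w, A (word g w x) -> A x].

Lemma faithful_word Om A n (g : 'I_n -> C -> C) w x : ifs_on Om A g ->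
  faithful_set Om A g x -> faithful_set Om A g (word g w x) /\ (A x <-> A (word g w x)).
Proof.
move=> G [Ox Ax]; split; last by split; [exact: (word_fwd G)|exact: Ax].
split; first exact: (word_stable G).
by move=> v; rewrite -word_cat => /Ax; exact: (word_fwd G).
Qed.

(** r is a Koebe radius, fixed before rho; only the word length m, and with it the lower bound l^m,
    depends on rho. This lets families with different rho share one r. The second part codes a by a
    long word: such a word maps discs about points of A to small sets near a. *)
Lemma star_family Om A n (g : 'I_n -> C -> C) M eta : ifs_on Om A g ->
  connected Om -> compact A -> A !=set0 -> 0 < eta -> (forall z, Om z -> cmod z <= M) ->
  (forall i x y, Om x -> cmod (y - g i x) < eta -> Om y) ->
  exists2 r, 0 < r &
  (forall rho, 0 < rho -> exists H lam, contracting_family A (faithful_set Om A g) H r lam rho) /\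
  (forall p a d, A p -> A a -> 0 < d -> exists w,
     univ [set z | cmod (z - p) < r] (word g w) /\ forall z, cmod (z - p) < r -> cmod (word g w z - a) < d).
Proof.
move=> G cO cA A0 eta0 OM Oeta.
have [rw rw0 [discs _ contr diams [l /andP[l0 l1] lower]]] := words_contract G cO cA A0 eta0 OM Oeta.
have [k /andP[k0 k1] Hk] := @koebe R.
have r0 : 0 < k * rw by rewrite mulr_gt0.
have rrw : k * rw <= rw by rewrite ler_piMl// ltW.
have inO a z : A a -> cmod (z - a) < rw -> Om z.
  by move=> Aa za; apply: discs Aa _; move: za rw0; clear; lra.
exists (k * rw) => //; split.
- move=> rho rho0; pose e := Num.min 1 (rho / (k * rw)).
  have e0 : 0 < e by rewrite lt_min ltr01 divr_gt0.
  have e1 : e <= 1 by rewrite ge_min lexx.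
  have e2 : e * (k * rw) <= rho by rewrite -ler_pdivlMr// ge_min lexx orbT.
  have [m Hm] := contr e e0.
  have lip w q x y : size w = m -> A q -> cmod (x - q) < k * rw -> cmod (y - q) < k * rw ->
      cmod (word g w x - word g w y) <= e * cmod (x - y).
    by move=> sw Aq xq yq; apply: (Hm w _ q) => //; [rewrite sw|exact: lt_le_trans xq rrw|exact: lt_le_trans yq rrw].
  exists [set word g w | w in [set w | size w = m]], (l ^+ m); split => //.
  + by rewrite exprn_gt0//= exprn_ile1// ltW.
  + by move=> _ x [w _ <-]; exact: (word_fwd G).
  + move=> x /(word_bwd G m)[w [q [sw Aq wq]]].
    by exists (word g w), q; split=> //; exists w.
  + by move=> _ x [w _ <-] /(faithful_word w G)[Fx [_ ?]].
  + move=> _ q [w _ <-] Aq z zq; apply: (word_univ G w).1; apply: inO Aq _.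
    exact: lt_le_trans zq rrw.
  + move=> _ q [w sw <-] Aq; exists (cder (word g w) q); first by rewrite -sw; exact: lower.
    have uw : univ [set z | cmod (z - q) < rw] (word g w).
      by apply: univ_sub (word_univ G w) => z; exact: inO.
    apply: nearlin_of_der; last by move=> z zq; exact: (Hk _ _ _ rw0 uw z zq).
    by move=> z zq; apply: uw.1; exact: lt_le_trans zq rrw.
  + move=> _ q x y [w sw <-] Aq xq yq; apply: le_trans (lip w q x y sw Aq xq yq) _.
    by rewrite ler_piMl// cmod_ge0.
  + move=> _ q x [w sw <-] Aq xq.
    apply: le_lt_trans (lip w q x q sw Aq xq _) _; first by rewrite subrr cmod0.
    by apply: lt_le_trans e2; rewrite ltr_pM2l.
- move=> p a d Ap Aa d0; have d20 : 0 < d / 2 by move: d0; clear; lra.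
  have e0 : 0 < d / 2 / (k * rw) by rewrite divr_gt0.
  have [m1 H1] := contr _ e0; have [m2 H2] := diams _ d20.
  have [w [x [sw Ax wx]]] := word_bwd G (maxn m1 m2) Aa; exists w.
  split; first by apply: univ_sub (word_univ G w) => z zp; apply: inO Ap _; exact: lt_le_trans zp rrw.
  move=> z zp.
  have zp' := lt_le_trans zp rrw.
  have h1 := H1 w _ p Ap z p zp' _; rewrite sw leq_maxl subrr cmod0 in h1; have {}h1 := h1 isT rw0.
  have h2 := H2 w _ p x Ap Ax; rewrite sw leq_maxr wx in h2; have {}h2 := h2 isT.
  have h3 : d / 2 / (k * rw) * cmod (z - p) <= d / 2.
    by rewrite mulrAC ler_pdivrMr// ler_pM2l// ltW.
  have := cmod_tri (word g w p) (word g w z) a.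
  by move: h1 h2 h3; clear; lra.
Qed.

(** Germs are given on discs of a radius s unrelated to r. One pull back by the family with rho = s
    brings them to radius r / 2; [doubling], with the family for r / 8, then makes the displacement
    near the centre comparable to its bound, as [symmetric_chart] demands. *)
Lemma star_rigidity Om A n (g : 'I_n -> C -> C) M eta : ifs_on Om A g ->
  connected Om -> compact A -> 0 < eta -> (forall z, Om z -> cmod z <= M) ->
  (forall i x y, Om x -> cmod (y - g i x) < eta -> Om y) ->
  (forall a, A a -> forall d, 0 < d -> exists b, [/\ A b, b != a & cmod (b - a) < d]) ->
  forall b d s, A b -> 0 < d -> (forall z, cmod (z - b) < d -> faithful_set Om A g z) -> 0 < s ->
  (forall e0 : R, 0 < e0 -> exists psi p (e : R),
     [/\ germ A (faithful_set Om A g) psi p s e, 0 < e < e0 & psi p != p]) ->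
  forall D, laminar A D.
Proof.
move=> G cO cA eta0 OM Oeta Aperf b d s Ab d0 Fb s0 germs.
have A0 : A !=set0 by exists b.
have [r r0 [fam small]] := star_family G cO cA A0 eta0 OM Oeta.
(* A quarter of the germ radius r / 2: the s / 4 of [symmetric_chart]. *)
have rho0 : 0 < r / 2 / 4 by move: r0; clear; lra.
have [H [lam CF]] := fam _ rho0; have [Hs [lams CFs]] := fam _ s0.
have [lam0 _] := andP (cf_lam01 CF); have [lams0 lams1] := andP (cf_lam01 CFs).
have r20 : 0 < r / 2 by move: r0; clear; lra.
have [|||P [tau [tau0 uP AP FP inv]]] :=
    @symmetric_chart R A (faithful_set Om A g) (r / 2) (lam / 4) cA Aperf _ r20.
- move=> a Aa d1 d10.
  have [w [uw wa]] := small _ _ _ Ab Aa d10.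
  have bb : cmod (b - b) < r by rewrite subrr cmod0.
  exists (word g w b); split; [exact: (word_fwd G)|exact: wa|].
  have [p p0 Hp] := univ_open (@isopen_disc R b r) uw bb d0.
  exists p => // z /Hp[y [yb _ <-]].
  by have [] := faithful_word w G (Fb y yb).
- by rewrite divr_gt0.
(* After the pull back the bound 2 / lams * d1 has to be below r / 2 and e0; the entry lams * r / 16
   gives d1 < lams / 4 * (r / 2), the condition of [germ_pull]. *)
- move=> e0 e00; pose d1 := lams / 2 * Num.min (lams * r / 16) (Num.min (r / 4) (e0 / 2)).
  have m0 : 0 < Num.min (lams * r / 16) (Num.min (r / 4) (e0 / 2)).
    by rewrite !lt_min !divr_gt0// mulr_gt0.
  have d10 : 0 < d1 by rewrite mulr_gt0// divr_gt0.
  have E : 2 / lams * d1 = Num.min (lams * r / 16) (Num.min (r / 4) (e0 / 2)).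
    by rewrite /d1; field; rewrite gt_eqF.
  have e1 : 2 / lams * d1 <= lams * r / 16 by rewrite E ge_min lexx.
  have e2 : 2 / lams * d1 <= r / 4 by rewrite E !ge_min lexx !orbT.
  have e3 : 2 / lams * d1 <= e0 / 2 by rewrite E !ge_min lexx !orbT.
  have e40 : 0 < 2 / lams * d1 by rewrite E.
  have dl : d1 < lams / 4 * (r / 2).
    have h : d1 <= lams / 2 * (lams * r / 16) by rewrite /d1 ler_pM2l ?divr_gt0// ge_min lexx.
    apply: le_lt_trans h _; rewrite (_ : lams / 4 * (r / 2) = lams / 2 * (r / 4)); last by field.
    rewrite ltr_pM2l ?divr_gt0//; have : lams * r <= r by rewrite ler_piMl// ltW.
    by move: r0; clear; move: (lams * r) => *; lra.
  have [psi [p [e [Gp /andP[ep ed] pp]]]] := germs d1 d10.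
  have Ap : A p by case: Gp.
  have [h [q [Hh Aq hq]]] := cf_bwd CFs Ap.
  have Gp' : germ A (faithful_set Om A g) psi (h q) s e by rewrite hq.
  have [|psi' [G' pq]] := germ_pull CFs Hh Aq Gp' (d := d1) _ dl.
    by rewrite hq => x xp; case: Gp => _ _ /(_ x xp) h1 _; move: h1 ed; clear; lra.
  rewrite hq in pq.
  have [||psi2 [q2 [e' [G2 /andP[e'0 e'd] X]]]] := doubling CF erefl G'.
  + by rewrite -subr_eq0 -cmod_gt0; apply: lt_le_trans pq; rewrite cmod_gt0 subr_eq0.
  + by rewrite e40; move: e2 r0; clear; lra.
  exists psi2, q2, e'; split=> //.
  by rewrite e'0; move: e'd e3 e00; clear; lra.
apply: (chart_laminar cA r0 _ tau0 uP AP FP inv) => p a d1 Ap Aa d10.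
have [w [uw wa]] := small _ _ _ Ap Aa d10; exists (word g w); split=> // x Fx.
by have [] := faithful_word w G Fx.
Qed.

End Rigidity.

(** * Finiteness *)

Section Finiteness.
Context {R : realType}.
Local Notation C := R[i].
Implicit Types (a b p q x y z : C) (f g h psi : C -> C) (A D Fa U V : set C) (r s : R).

(** The system is forgotten: only A, U and V remain, which are common to the whole collection, so
    that maps of different systems can be compared. *)
Record faithful_map A U V g : Prop := FaithfulMap {
  fm_univ : univ V g;
  fm_fwd : forall x, A x -> A (g x);
  fm_bwd : forall x, U x -> A (g x) -> A x }.

Lemma infinite_seq T (S : set T) : ~ finite_set S ->
  exists u : nat -> T, (forall n, S (u n)) /\ forall n m, u n = u m -> n = m.
Proof.
move=> /infiniteP/card_leP[f].
exists (fun n => set_val (f (exist _ n (mem_setT n)))); split; first by move=> n; apply: set_valP.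
move=> n m /val_inj E; have := @inj _ _ _ f; move=> /(_ (exist _ n (mem_setT n)) (exist _ m (mem_setT m))).
by rewrite !in_setT => /(_ isT isT E) [].
Qed.

(* The germ is g2^-1 \o g1. *)
Lemma close_germ A Fa U V a r g1 g2 e : isopen V -> connected V -> U `<=` V -> 0 < r ->
  (forall z, cmod (z - a) < r -> U z) -> A a ->
  (forall d, 0 < d -> exists b, [/\ A b, b != a & cmod (b - a) < d]) ->
  faithful_map A U V g1 -> faithful_map A U V g2 -> (exists2 z, V z & g1 z <> g2 z) ->
  nearlin g2 a r (cder g2 a) -> 0 < e ->
  (forall z, cmod (z - a) < r -> cmod (g1 z - g2 z) <= e) -> e < cmod (cder g2 a) / 4 * (r / 2) ->
  exists psi p, germ A Fa psi p (r / 4) (2 / cmod (cder g2 a) * e) /\ psi p != p.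
Proof.
move=> oV cV UV r0 aU Aa Aperf F1 F2 [z1 Vz1 neq] nl e0 ge el.
have aV z : cmod (z - a) < r -> V z by move=> /aU/UV.
have l0 : cder g2 a != 0.
  by apply: univ_der_neq0 oV (fm_univ F2) _; apply: aV; rewrite subrr cmod0.
have l1 : 0 < cmod (cder g2 a) by rewrite cmod_gt0.
have h1 : holoD g1 a r by move=> z /aV; exact: (fm_univ F1).1.
have h2 : holoD g2 a r by move=> z /aV; exact: (fm_univ F2).1.
have r2 : r / 2 < r by move: r0; clear; lra.
have [||phi [hphi phiE phid]] := @lift_nearlin R g2 g1 a r (cder g2 a) r0 l0 h2 nl.
- by apply: holoD_sub h1 _; rewrite subrr cmod0 add0r ltW.
- by move=> x xr; apply: le_lt_trans el; apply: ge; exact: lt_trans r2.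
(* If phi fixed all points of A near a, then g1 = g2 on a set accumulating at a, hence on V. *)
have [p [Ap pa pp]] : exists p, [/\ A p, cmod (p - a) < r / 4 & phi p <> p].
  apply: contrapT => no; apply: neq.
  have fixp p : A p -> cmod (p - a) < r / 4 -> g1 p = g2 p.
    move=> Ap pa; rewrite -(phiE p); last by move: pa r0; clear; lra.
    congr g2; apply: contrapT => pp; apply: no; by exists p.
  have r40 : 0 < r / 4 by move: r0; clear; lra.
  apply/eqP; rewrite -subr_eq0; apply/eqP.
  apply: (@identity_thm R V (fun z => g1 z - g2 z) cV _ _ a) => //.
  + exact/isopenP.
  + move=> z Vz; have [k dk] := (fm_univ F1).1 z Vz; have [k' dk'] := (fm_univ F2).1 z Vz.
    by eexists; exact: cdiffB dk dk'.
  + by apply: aV; rewrite subrr cmod0.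
  have hd : holoD (fun z => g1 z - g2 z) a r.
    move=> z zr; have [k dk] := h1 z zr; have [k' dk'] := h2 z zr.
    by eexists; exact: cdiffB dk dk'.
  have [//|[d d0 nz]] := zeros_isolated r0 hd.
  have [|b [Ab ba bd]] := Aperf (Num.min d (r / 4)); first by rewrite lt_min d0.
  move: bd; rewrite lt_min => /andP[bd br].
  by have := nz b bd ba; rewrite (fixp b Ab br) subrr eqxx.
have inr x : cmod (x - p) < r / 4 -> cmod (x - a) < r / 2.
  by move=> xp; have := cmod_tri p x a; move: xp pa; clear; lra.
exists phi, p; split; last exact/eqP.
split=> //.
- by move=> x /inr; exact: hphi.
- move=> x /inr xr; have [k1 _] := phid x xr.
  have := le_trans k1 (ge x (lt_trans xr r2)).
  by rewrite -ler_pdivlMl ?divr_gt0// invf_div.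
- move=> x /inr xr _ _; have [_ k2] := phid x xr.
  have E := phiE x xr; split=> [Ax|Apx].
    by apply: (fm_bwd F2 (aU _ k2)); rewrite E; exact: (fm_fwd F1).
  by apply: (fm_bwd F1 (aU _ (lt_trans xr r2))); rewrite -E; exact: (fm_fwd F2).
Qed.

(** Infinitely many such maps would give a bounded sequence on a disc about a. Along an ultrafilter
    containing the tails, two different ones are as close as desired, and [close_germ] turns them
    into germs of arbitrarily small displacement; dl makes its constant uniform. *)
Lemma finite_big A Fa U V a r0 (B dl : R) : isopen V -> connected V -> U `<=` V -> 0 < r0 ->
  (forall z, cmod (z - a) < r0 -> U z) -> A a -> (forall x, A x -> cmod x <= B) ->
  (forall d, 0 < d -> exists b, [/\ A b, b != a & cmod (b - a) < d]) ->
  (forall s, 0 < s -> ~ forall e0 : R, 0 < e0 -> exists psi p (e : R),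
     [/\ germ A Fa psi p s e, 0 < e < e0 & psi p != p]) ->
  0 < dl ->
  finite_set [set h : V -> C | exists g, [/\ faithful_map A U V g, dl <= cmod (cder g a) & h = sigL V g]].
Proof.
move=> oV cV UV r00 aU Aa AB Aperf rigid dl0; apply: contrapT => /infinite_seq[u [uS uinj]].
have [g gE] := choice uS.
have F n : faithful_map A U V (g n) by have [] := gE n.
have gdl n : dl <= cmod (cder (g n) a) by have [] := gE n.
have neq n m : n <> m -> exists2 z, V z & g n z <> g m z.
  move=> nm; apply: contrapT => no; apply: nm; apply: uinj.
  have [_ _ ->] := gE n; have [_ _ ->] := gE m; apply/funext => z /=.
  by apply: contrapT => h; apply: no; exists (set_val z) => //; exact: set_valP.
clear u uS uinj gE.
have [k /andP[k0 k1] Hk] := @koebe R.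
pose r := k * r0; have rp : 0 < r by rewrite mulr_gt0.
have rr : r <= r0 by rewrite ler_piMl// ltW.
have aV z : cmod (z - a) < r0 -> V z by move=> /aU/UV.
have ug n : univ [set z | cmod (z - a) < r0] (g n) by apply: univ_sub (fm_univ (F n)) => z; exact: aV.
have hg n : holoD (g n) a r by move=> z zr; apply: (ug n).1; exact: lt_le_trans zr rr.
have nl n : nearlin (g n) a r (cder (g n) a).
  by apply: nearlin_of_der (hg n) _ => z zr; exact: (Hk _ _ _ r00 (ug n) z zr).
have ar : cmod (a - a) < r by rewrite subrr cmod0.
have [b [Ab ba br]] := Aperf r rp.
have B0 : 0 <= B by apply: le_trans (AB a Aa); exact: cmod_ge0.
(* g a and g b lie in the bounded set A, which bounds the derivative at a; through [nearlin] this
   bounds g on the disc. *)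
have gB n : cmod (cder (g n) a) * cmod (b - a) <= 4 * B.
  have := nearlin_lower (nl n) ar br.
  have := cmodB (g n b) (g n a); have := AB _ (fm_fwd (F n) Ab); have := AB _ (fm_fwd (F n) Aa).
  by move: (cmod (cder _ _)) (cmod (b - a)) => u v; clear; lra.
have b0 : 0 < cmod (b - a) by rewrite cmod_gt0 subr_eq0.
pose M := B + 6 * B / cmod (b - a) * r.
have gM n z : cmod (z - a) < r -> cmod (g n z) <= M.
  move=> zr; have := nearlin_upper (nl n) ar zr.
  have : cmod (cder (g n) a) <= 4 * B / cmod (b - a) by rewrite ler_pdivlMr.
  move=> h1 h2; have := cmod_tri (g n a) (g n z) 0; rewrite !subr0.
  have := AB _ (fm_fwd (F n) Aa).
  have h3 : 3 / 2 * cmod (cder (g n) a) * cmod (z - a) <= 3 / 2 * (4 * B / cmod (b - a)) * r.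
    by apply: ler_pM; rewrite ?mulr_ge0 ?cmod_ge0 ?(ltW zr)// ler_pM2l.
  have E : 6 * B / cmod (b - a) * r = 3 / 2 * (4 * B / cmod (b - a)) * r by field; rewrite gt_eqF.
  by move: h2 h3; rewrite /M E; clear; lra.
have [UF [FU Foo]] := ultraFilterLemma (F := \oo) _.
have [v [_ _ Hv]] := ultra_holo FU rp hg gM.
have PF : ProperFilter UF by exact: ultra_proper.
pose s := r / 2; have s0 : 0 < s by rewrite divr_gt0.
have sr : s < r by rewrite /s; move: rp; clear; lra.
apply: (rigid (s / 4)) => [|e0 e00]; first by rewrite divr_gt0.
(* dl / 16 * s is below the dl / 4 * (s / 2) required by [close_germ], and the second entry makes
   the displacement at most e0 / 2. *)
pose e := Num.min (dl / 16 * s) (dl / 4 * e0).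
have ep : 0 < e by rewrite lt_min !mulr_gt0 ?divr_gt0.
have e1 : e <= dl / 16 * s by rewrite ge_min lexx.
have e2 : e <= dl / 4 * e0 by rewrite ge_min lexx orbT.
have e20 : 0 < e / 2 by rewrite divr_gt0.
have FS := Hv s sr _ e20.
have [n n1] := filter_ex FS.
have Fn : UF [set m | (n < m)%N] by apply: Foo; exists n.+1.
have [m [m1 nm]] := filter_ex (filterI FS Fn).
have mn : m <> n by move=> E; move: nm; rewrite E /= ltnn.
have clo z : cmod (z - a) < s -> cmod (g m z - g n z) <= e.
  move=> /ltW zs; have := n1 z zs; have := m1 z zs; have := cmod_tri (v z) (g m z) (g n z).
  by rewrite (cmodC (v z)); clear; lra.
have nls : nearlin (g n) a s (cder (g n) a).
  by move=> z w zs ws; apply: nl; [exact: lt_trans zs sr|exact: lt_trans ws sr].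
have sU z : cmod (z - a) < s -> U z.
  by move=> zs; apply: aU; apply: lt_le_trans rr; exact: lt_trans zs sr.
have ld := gdl n; have lp := lt_le_trans dl0 ld.
have [|psi [p [G pp]]] := @close_germ A Fa U V a s (g m) (g n) e oV cV UV s0 sU Aa Aperf (F m) (F n) (neq m n mn) nls ep clo.
  apply: le_lt_trans e1 _.
  have : dl * s <= cmod (cder (g n) a) * s by rewrite ler_pM2r.
  have := mulr_gt0 dl0 s0.
  by clear; lra.
exists psi, p, (2 / cmod (cder (g n) a) * e); split=> //.
rewrite mulr_gt0 ?divr_gt0//= mulrAC ltr_pdivrMr//.
have : dl * e0 <= e0 * cmod (cder (g n) a) by rewrite mulrC ler_pM2l.
have := mulr_gt0 dl0 e00.
by move: e2; clear; lra.
Qed.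

End Finiteness.

(** * Excluding systems with shrinking maps *)

Section Counting.
Context {R : realType}.
Local Notation C := R[i].
Implicit Types (a b p q w x y z : C) (f h psi : C -> C) (A D U V : set C) (r s : R).

Lemma ultra_finite T (S : set T) (u : nat -> T) (F : set_system nat) : UltraFilter F ->
  finite_set S -> F [set n | S (u n)] -> exists v : T, F [set n | u n = v].
Proof.
move=> FU /finite_setP[m]; rewrite card_eq_le => /andP[/pcard_leP[f] _] FS.
have PF : ProperFilter F by exact: ultra_proper.
have fm (x : T) : S x -> (f x < m)%N by move=> Sx; have := @funS _ _ _ _ f x Sx; rewrite /= => /=.
have fi (x y : T) : S x -> S y -> f x = f y -> x = y by move=> Sx Sy; apply: (@inj _ _ _ f); rewrite inE.
have [i Fi] : exists i : 'I_m, F [set n | f (u n) = i].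
  apply: contrapT => no.
  have H (i : 'I_m) : F [set n | f (u n) <> i].
    by have [h|//] := @in_ultra_setVsetC _ F [set n | f (u n) = i] FU; case: no; exists i.
  have [n [Sn Hn]] := filter_ex (filterI FS (filter_forall _ H)).
  exact: (Hn (Ordinal (fm _ Sn))).
have [n0 [Sn0 fn0]] := filter_ex (filterI FS Fi).
exists (u n0); apply: filterS (filterI FS Fi) => n [Sn fn].
by apply: fi => //; rewrite fn fn0.
Qed.

Lemma perfect_points A x0 (d : R) m : 0 < d ->
  (forall d, 0 < d -> exists b, [/\ A b, b != x0 & cmod (b - x0) < d]) ->
  exists x : nat -> C, [/\ forall j, A (x j), forall j, cmod (x j - x0) < d &
    forall j k, (j < m)%N -> (k < m)%N -> x j = x k -> j = k].
Proof.
move=> d0 perf.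
have H y : exists b, y != x0 -> [/\ A b, b != x0, cmod (b - x0) < d & cmod (b - x0) < cmod (y - x0)].
  have [yx|yx] := eqVneq y x0; first by exists 0.
  have [|b [Ab bx]] := perf (Num.min d (cmod (y - x0))).
    by rewrite lt_min d0 cmod_gt0 subr_eq0.
  by rewrite lt_min => /andP[b1 b2]; exists b.
have [f Hf] := choice H.
have [b [Ab bx bd]] := perf d d0.
pose x j := iter j f b.
have xx j : [/\ A (x j), x j != x0 & cmod (x j - x0) < d].
  by elim: j => [|j [_ /Hf[h1 h2 h3 _] _]].
have dec j k : (j < k)%N -> cmod (x k - x0) < cmod (x j - x0).
  elim: k => // k IH; have [_ /Hf[_ _ _ h] _] := xx k.
  by rewrite ltnS leq_eqVlt => /predU1P[->//|/IH]; exact: lt_trans.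
exists x; split=> [j|j|j k _ _ E]; [by case: (xx j)|by case: (xx j)|].
by case: (ltngtP j k) => // /dec; rewrite E ltxx.
Qed.

(* Along an ultrafilter the maps whose derivative stays away from 0 are constant,
   and the images of A under the other ones shrink to points; by perfectness the
   constant maps already cover A, and then disjointness leaves no other map. *)
Lemma no_shrinking A U V a N (c : nat -> nat) (g : nat -> nat -> C -> C) :
  isopen V -> connected V -> isopen U -> U `<=` V -> A `<=` V -> compact A -> A a -> U a ->
  (forall x, A x -> forall d, 0 < d -> exists b, [/\ A b, b != x & cmod (b - x) < d]) ->
  (forall x, A x -> forall d, 0 < d -> exists2 u, U u & cmod (u - x) < d) ->
  (forall d : R, 0 < d -> finite_set [set h : V -> C | exists f,
     [/\ faithful_map A U V f, d <= cmod (cder f a) & h = sigL V f]]) ->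
  (forall n, (c n <= N)%N) ->
  (forall n i, (i < c n)%N -> faithful_map A U V (g n i)) ->
  (forall n x, A x -> exists i w, [/\ (i < c n)%N, A w & g n i w = x]) ->
  (forall n i j u v, (i < c n)%N -> (j < c n)%N -> U u -> U v -> g n i u = g n j v -> i = j) ->
  ~ forall n, exists2 i, (i < c n)%N & cmod (cder (g n i) a) < n.+1%:R^-1.
Proof.
move=> oV cV oU UV AV cA Aa Ua Aperf AU fin cN gF gA gU small.
have [K K0 HK] := comparable_compact oV cV cA AV (AV a Aa).
have [F [FU Foo]] := ultraFilterLemma (F := \oo) _.
have PF : ProperFilter F by exact: ultra_proper.
(* An index is big if its derivative at a stays away from 0 along F. By finiteness the map of that
   index is then, along F, constantly equal to the first component of [hd i] on V. *)
pose big i := exists2 d : R, 0 < d & F [set n | (i < c n)%N /\ d <= cmod (cder (g n i) a)].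
have Hbig i : exists hd : (C -> C) * R, big i -> [/\ 0 < hd.2, faithful_map A U V hd.1 &
    F [set n | [/\ (i < c n)%N, hd.2 <= cmod (cder (g n i) a) & forall z, V z -> g n i z = hd.1 z]]].
  have [[d d0 Fd]|no] := pselect (big i); last by exists (id, 0).
  have [|h0 Fh] := ultra_finite FU (fin d d0) (u := fun n => sigL V (g n i)).
    by apply: filterS Fd => n [ic dn]; exists (g n i); split=> //; exact: gF.
  have [n0 [[ic0 _] hn0]] := filter_ex (filterI Fd Fh).
  exists (g n0 i, d) => _; split=> //=; first exact: gF.
  apply: filterS (filterI Fd Fh) => n [[ic dn] hn]; split=> // z Vz.
  have E : sigL V (g n i) = sigL V (g n0 i) := etrans hn (esym hn0).
  by have := congr1 (@^~ (exist _ z (mem_set Vz))) E; rewrite /sigL.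
have [hd Hhd] := choice Hbig.
have nbig i : ~ big i -> forall d : R, 0 < d -> F [set n | (i < c n)%N -> cmod (cder (g n i) a) < d].
  move=> nb d d0.
  have [h|h] := @in_ultra_setVsetC _ F [set n | (i < c n)%N /\ d <= cmod (cder (g n i) a)] FU.
    by case: nb; exists d.
  by apply: filterS h => n /= h ic; rewrite ltNge; apply/negP => dn; apply: h.
(* If the constant maps of big indices cover A, take a system with a map i0 of tiny derivative: its
   value at a is hit by a big map i, and [overlap] with disjointness forces i0 = i. *)
have [AE|] := pselect (forall x, A x -> exists i w, [/\ (i < N)%N, big i, A w & (hd i).1 w = x]).
  have H (i : 'I_N) : F [set n | big i -> [/\ (i < c n)%N, (hd i).2 <= cmod (cder (g n i) a),
      forall z, V z -> g n i z = (hd i).1 z & n.+1%:R^-1 < (hd i).2]].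
    have [bi|nb] := pselect (big i); last by apply: filterS (filterT) => n _ /nb.
    have [d0 _ Fi] := Hhd i bi.
    have Fe : F [set n | n.+1%:R^-1 < (hd i).2].
      apply: Foo; exists (Num.trunc (hd i).2^-1).+1 => // n /= Hn.
      rewrite invf_plt ?posrE ?ltr0n//; apply: lt_le_trans (Num.Theory.truncnS_gt _) _.
      by rewrite ler_nat leqW.
    by apply: filterS (filterI Fi Fe) => n [[h1 h2 h3] h4].
  have [n Hn] := filter_ex (filter_forall _ H).
  have [i0 ic0 s0] := small n.
  have [i [w [iN bi Aw hw]]] := AE _ (fm_fwd (gF n i0 ic0) Aa).
  have [ic dn hn ne] := Hn (Ordinal iN) bi.
  have [l dl] := (fm_univ (gF n i ic)).1 w (AV w Aw).
  have uU : univ U (g n i0) by apply: univ_sub (fm_univ (gF n i0 ic0)).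
  have [|u [v [Uu Uv uv]]] := overlap oU uU Ua (h := g n i) _ (cdiff_ccont dl) (AU w Aw).
    by rewrite (hn w (AV w Aw)) hw.
  have E := gU n i0 i u v ic0 ic Uu Uv uv.
  by move: s0 dn ne; rewrite E /=; move: (_^-1) (cmod _) (hd i).2 => x1 x2 x3; clear; lra.
(* Otherwise some x0 in A has positive distance from the images of A under all big maps. Of N + 1
   distinct points of A near x0, two lie in the image of A under one and the same small map, which
   is too small to contain both. *)
apply; move=> x0 Ax0; apply: contrapT => nE.
have Hd (i : 'I_N) : exists d : R, 0 < d /\ (big i -> forall w, A w -> d <= cmod ((hd i).1 w - x0)).
  have [bi|nb] := pselect (big i); last by exists 1.
  have [_ Fi _] := Hhd i bi; apply: contrapT => no; apply: nE.
  have [y Ay hy] : ((hd i).1 @` A) x0.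
    apply: compact_closedE (image_compact cA _) _ => [z /AV|d d0].
      by move=> /(fm_univ Fi).1[l]; exact: cdiff_ccont.
    apply: contrapT => no2; apply: no; exists d; split=> // _ w Aw.
    rewrite leNgt; apply/negP => wd; apply: no2.
    by exists ((hd i).1 w) => //; exists w.
  by exists i, y; split.
have [dd Hdd] := choice Hd.
have [//|l /andP[l0 _] Hl] := @finite_min R N dd; first by move=> i; exact: (Hdd i).1.
have [x [Ax xl xinj]] := perfect_points N.+1 l0 (Aperf x0 Ax0).
have H1 (i : 'I_N) : F [set n | big i -> forall z, V z -> g n i z = (hd i).1 z].
  have [bi|nb] := pselect (big i); last by apply: filterS (filterT) => n _ /nb.
  by have [_ _ Fi] := Hhd i bi; apply: filterS Fi => n [_ _ h] _; exact: h.
(* The factor 2 K arises because two points of A are each mapped within K |g'(a)| of g a. *)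
have H2 (i : 'I_N) : F [set n | forall j k : 'I_N.+1, ~ big i -> j <> k -> (i < c n)%N ->
    cmod (cder (g n i) a) < cmod (x j - x k) / (2 * K)].
  apply: (filter_forall _) => j; apply: (filter_forall _) => k.
  have [bi|nb] := pselect (big i); first by apply: filterS (filterT) => n _ /(_ bi).
  have [jk|jk] := eqVneq j k; first by apply: filterS (filterT) => n _ _ /(_ jk).
  have := nbig i nb (cmod (x j - x k) / (2 * K)); rewrite divr_gt0 ?mulr_gt0//; last first.
    rewrite cmod_gt0 subr_eq0; apply: contra_neq jk => /(xinj _ _ (ltn_ord j) (ltn_ord k)).
    exact: val_inj.
  by move=> /(_ isT); apply: filterS => n Hn _ _.
have [n [Hn1 Hn2]] := filter_ex (filterI (filter_forall _ H1) (filter_forall _ H2)).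
have Hi (j : 'I_N.+1) : exists i : 'I_N, exists w, [/\ (i < c n)%N, A w & g n i w = x j].
  have [i [w [ic Aw gw]]] := gA n _ (Ax j).
  by exists (Ordinal (leq_trans ic (cN n))), w.
have [e He] := choice Hi.
have nb j : ~ big (e j).
  move=> bj; have [w [ic Aw gw]] := He j.
  have := (Hdd (e j)).2 bj w Aw; rewrite -(Hn1 (e j) bj _ (AV w Aw)) gw.
  have := Hl (e j); have := xl j; clear; lra.
have : ~ injective e by move=> /leq_card; rewrite !card_ord ltnn.
apply=> j k ejk; apply: contrapT => jk.
have [w [ic Aw gw]] := He j; have [w' [_ Aw' gw']] := He k; rewrite -ejk in gw'.
have := Hn2 (e j) j k (nb j) jk ic; rewrite ltr_pdivlMr ?mulr_gt0// -gw -gw'.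
have [_ _ h1] := HK w Aw _ (fm_univ (gF n _ ic)); have [_ _ h2] := HK w' Aw' _ (fm_univ (gF n _ ic)).
have := cmod_tri (g n (e j) a) (g n (e j) w) (g n (e j) w'); rewrite (cmodC (g n (e j) a)).
by move: h1 h2; clear; move: (cmod (cder _ _)) => u; lra.
Qed.

End Counting.

(** * Holomorphic systems: attractors, margins and faithful points *)

Section Bridge.
Context {R : realType}.
Local Notation C := R[i].
Implicit Types (a b x y z : C) (A U V Om : set C) (r s M eta : R).

Lemma univalent_univ Om (f : C -> C) : univalent_on Om f -> univ Om f.
Proof.
move=> [hf inj]; split=> [z Oz|z w Oz Ow]; last by apply: inj; rewrite inE.
by exists ('D_1 f z); apply/cdiff_is_derive; split=> //; exact: hf.
Qed.

Lemma holo_ifs_on (G : holo_ifs R) A : ifs_attractor G = A ->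
  [/\ ifs_on (ifs_dom G) A G, connected (ifs_dom G) & compact A].
Proof.
move=> GA; have [oO cO _] := ifs_dom_domain G.
have [A0 cA AO AE] : invariant_compact (ifs_dom G) G A.
  (* Without an invariant compact set [attractor] would be the default set0, but it contains
     points. *)
  rewrite -GA /ifs_attractor /attractor; case: xgetP => // H.
  have [z [w []]] := ifs_attractor_nontrivial G; rewrite /attractor.
  by case: xgetP H => [? -> Px /(_ _ Px)|_ _ []].
split=> //; split.
- exact/isopenP.
- by move=> i; exact/univalent_univ/ifs_map_univalent.
- by move=> i z; exact: ifs_map_dom.
- exact: AO.
- by move=> i z Az; rewrite AE; exists i => //; exists z.
- by move=> z; rewrite {1}AE => -[i _ [w Aw wz]]; exists i, w.
Qed.

(** The closure of each image is a compact subset of the open domain, and there are finitely many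
    maps. The margin eta is what the Earle-Hamilton trick consumes. *)
Lemma holo_ifs_margin (G : holo_ifs R) : exists M eta : R, [/\ 0 < eta,
  forall z, ifs_dom G z -> cmod z <= M &
  forall i x y, ifs_dom G x -> cmod (y - G i x) < eta -> ifs_dom G y].
Proof.
have [oO _ _] := ifs_dom_domain G; have /isopenP iO := oO.
have [M HM] : exists M : R, forall z, ifs_dom G z -> cmod z <= M.
  have [M0 [M0r HM]] := ifs_dom_bounded G.
  (* [bounded_set] provides bounds in R[i] above M0 only; since the norm is real, the real part of
     such a bound is a bound. *)
  exists (complex.Re (M0 + 1)) => z Oz.
  have h1 : M0 < M0 + 1 by rewrite ltrDl ltr01.
  have h2 : (cmod z)%:C <= M0 + 1 := HM (M0 + 1) h1 z Oz.
  by move: h2; rewrite lecE => /andP[].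
have H i : exists r : R, 0 < r /\ forall x y, ifs_dom G x -> cmod (y - G i x) < r -> ifs_dom G y.
  have [|r r0 Hr] := @compact_margin R (closure (G i @` ifs_dom G)) _ _ iO (ifs_map_closure (i := i)).
    apply: (subclosed_compact _ (@closed_disc_compact R 0 M)); first exact: closed_closure.
    rewrite closureE; apply: smallest_sub; first exact: closed_disc_closed.
    by move=> _ [z Oz <-] /=; rewrite subr0; apply: HM; exact: ifs_map_dom.
  exists r; split=> // x y Ox; apply: Hr; apply: subset_closure; by exists x.
have [r Hr] := choice H.
have [|l /andP[l0 _] Hl] := @finite_min R _ r; first by move=> i; exact: (Hr i).1.
exists M, l; split=> // i x y Ox yx; apply: (Hr i).2 Ox _; exact: lt_le_trans (Hl i).
Qed.

Lemma isolated_perfect A : isolated A = set0 ->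
  forall x, A x -> forall d, 0 < d -> exists b, [/\ A b, b != x & cmod (b - x) < d].
Proof.
move=> A0 x Ax d d0; apply: contrapT => no.
have : isolated A x.
  split; first by rewrite inE.
  exists [set z | cmod (z - x) < d]; first by apply/nbhs_cmod; exists d.
  rewrite eqEsubset; split=> z.
    move=> [/= zd Az]; apply: contrapT => zx; apply: no; exists z; split=> //; exact/eqP.
  by move=> ->; split=> //=; rewrite subrr cmod0.
by rewrite A0.
Qed.

(** Second alternative of hypothesis (3): the orbit of x never leaves U, so the letters of a word
    are peeled off one at a time. *)
Lemma forward_faithful Om A n (g : 'I_n -> C -> C) U : ifs_on Om A g -> U `<=` Om ->
  (forall i x, U x -> U (g i x)) -> (forall i x, U x -> A (g i x) -> A x) ->
  U `<=` faithful_set Om A g.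
Proof.
move=> G UO Uf Ub x Ux; split; first exact: UO.
have Uw w : U (word g w x) by elim: w => //= i w; exact: Uf.
by elim=> //= i w IH /(Ub i _ (Uw w)).
Qed.

(** First alternative of hypothesis (3). Different pieces g i (A) are at least del apart, so if a
    point close to A has its image under g i in A, this image lies in g i (A). A Lipschitz bound
    uniform over all words keeps the orbit of a point near a close to A, and letters are peeled off
    one at a time. *)
Lemma separated_faithful Om A n (g : 'I_n -> C -> C) M eta : ifs_on Om A g ->
  connected Om -> compact A -> 0 < eta -> (forall z, Om z -> cmod z <= M) ->
  (forall i x y, Om x -> cmod (y - g i x) < eta -> Om y) ->
  trivIset setT (fun i => g i @` A) ->
  forall a, A a -> exists2 d, 0 < d & forall z, cmod (z - a) < d -> faithful_set Om A g z.
Proof.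
move=> G cO cA eta0 OM Oeta sep a Aa.
have A0 : A !=set0 by exists a.
have [r r0 [discs [L L0 lip] _ _ _]] := words_contract G cO cA A0 eta0 OM Oeta.
have cgA i : compact (g i @` A).
  apply: image_compact => // z /(ifs_sub G) Oz.
  by have [l] := (ifs_univ G i).1 z Oz; exact: cdiff_ccont.
have Hij i j : exists d : R, 0 < d /\ (i <> j -> forall x y, A x -> A y -> d <= cmod (g i x - g j y)).
  have [ij|ij] := pselect (i = j); first by exists 1.
  have [||d d0 Hd] := @compact_margin R (g i @` A) (~` (g j @` A)) (cgA i).
  - move=> z nz; apply: contrapT => no; apply: nz; apply: compact_closedE (cgA j) _ => d d0.
    apply: contrapT => nd; apply: no; exists d => // w wz Aw; apply: nd; by exists w.
  - by move=> z Az Bz; apply: ij; apply: (sep i j I I); exists z.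
  exists d; split=> // _ x y Ax Ay; rewrite leNgt; apply/negP => h.
  have Ai : (g i @` A) (g i x) by exists x.
  by apply: (Hd _ Ai (g j y)); [rewrite cmodC|exists y].
have Hi i : exists d : R, 0 < d /\ forall j, i <> j -> forall x y, A x -> A y -> d <= cmod (g i x - g j y).
  have [dd Hdd] := choice (Hij i).
  have [|l /andP[l0 _] Hl] := @finite_min R _ dd; first by move=> j; exact: (Hdd j).1.
  exists l; split=> // j ij x y Ax Ay; apply: le_trans (Hl j) _; exact: (Hdd j).2.
have [dd Hdd] := choice Hi.
have [|del /andP[del0 _] Hdel] := @finite_min R _ dd; first by move=> j; exact: (Hdd j).1.
(* A point within rho of A is mapped by g i to within less than del of g i (A); the final radius
   involves rho / L because words are L-Lipschitz near A. *)
pose rho := Num.min r (del / L).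
have rho0 : 0 < rho by rewrite lt_min r0 divr_gt0.
have rr : rho <= r by rewrite ge_min lexx.
have rL : L * rho <= del by rewrite mulrC -ler_pdivlMr// ge_min lexx orbT.
have step i b y : A b -> cmod (y - b) < rho -> A (g i y) -> A y.
  move=> Ab yb Agy; have [j [c [Ac cj]]] := ifs_bwd G Agy.
  have yr := lt_le_trans yb rr.
  have Oy : Om y by apply: discs Ab _; move: yr r0; clear; lra.
  have [ij|ij] := pselect (i = j).
    rewrite (_ : y = c)//; apply: (ifs_univ G i).2 => //; first exact: (ifs_sub G).
    by rewrite -cj ij.
  have h1 := (Hdd i).2 j ij b c Ab Ac; rewrite cj in h1.
  have h2 := lip [:: i] b Ab y b yr; rewrite subrr cmod0 /= cmodC in h2.
  have h3 : L * cmod (y - b) < L * rho by rewrite ltr_pM2l.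
  by have := Hdel i; move: h1 (h2 r0) h3 rL; clear; lra.
exists (Num.min r (rho / L)); first by rewrite lt_min r0 divr_gt0.
move=> x; rewrite lt_min ltr_pdivlMr// => /andP[xr xrho].
split; first by apply: discs Aa _; move: xr r0; clear; lra.
elim=> //= i w IH /(step i (word g w a) _ (word_fwd G w Aa)) H; apply: IH; apply: H.
have := lip w a Aa x a xr; rewrite subrr cmod0 => /(_ r0) h.
by apply: le_lt_trans h _; rewrite mulrC.
Qed.

End Bridge.

Theorem theorem3p4 (R : realType) (A V U : set R[i])
    (A_compact : compact A) (A_perfect : isolated A = set0)
    (V_open : open V) (V_connected : connected V) (AV : A `<=` V)
    (U_open : open U) (AU : A `<=` closure U) (UV : closure U `<=` V)
    (AU_meet : A `&` U !=set0)
    (A_not_laminar :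
       exists D : set R[i], [/\ components U D, D `&` A !=set0 & ~ laminar A D])
    (GG : set (holo_ifs R))
    (GG_card : exists N : nat, forall G, GG G -> (ifs_card G <= N)%N)
    (GG_attractor : forall G, GG G -> ifs_attractor G = A /\ V `<=` ifs_dom G)
    (GG_disjoint : forall G, GG G -> trivIset setT (fun i => G i @` U))
    (GG_star : exists2 G, GG G &
       strong_separation G \/ \bigcup_i (G i @` U) `<=` U) :
  finite_set [set h : V -> R[i] |
    exists2 G, GG G & exists i, h = sigL V (G i)].
Proof.
have [N HN] := GG_card; have [a [Aa Ua]] := AU_meet.
have [D [_ _ nlam]] := A_not_laminar.
have UV' : U `<=` V by move=> z Uz; apply: UV; exact: subset_closure.
have oU : isopen U by exact/isopenP.
have oV : isopen V by exact/isopenP.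
have Aperf := isolated_perfect A_perfect.
have AUd : forall x, A x -> forall d, 0 < d -> exists2 u, U u & cmod (u - x) < d.
  by move=> x /AU/closure_cmod.
have on G : GG G -> ifs_on (ifs_dom G) A G by move=> /GG_attractor[/holo_ifs_on[]].
have UO G : GG G -> U `<=` ifs_dom G by move=> /GG_attractor[_ VO] z /UV'/VO.
have dis G : GG G -> forall i j u v, U u -> U v -> G i u = G j v -> i = j.
  move=> HG i j u v Uu Uv uv; apply: (GG_disjoint G HG i j I I).
  by exists (G i u); split; [exists u|exists v].
have faith G : GG G -> forall i x, U x -> A (G i x) -> A x.
  by move=> HG; exact: faithful (on G HG) oU (UO G HG) AUd (dis G HG).
have FM G i : GG G -> faithful_map A U V (G i).
  move=> HG; split.
  - by apply: univ_sub (ifs_univ (on G HG) i); exact: (GG_attractor G HG).2.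
  - by move=> x; exact: (ifs_fwd (on G HG)).
  - exact: faith.
have [G0 HG0 star] := GG_star.
have [on0 cO cA] := holo_ifs_on (GG_attractor G0 HG0).1.
have [M [eta [eta0 OM Oeta]]] := holo_ifs_margin G0.
(* Both alternatives of hypothesis (3) serve to produce a disc of faithful points about a point of
   A. *)
have [b [d [Ab d0 Fb]]] : exists b (d : R), [/\ A b, 0 < d &
    forall z, cmod (z - b) < d -> faithful_set (ifs_dom G0) A G0 z].
  case: star => [sep|fwd].
    have sepA : trivIset setT (fun i => G0 i @` A).
      by move: sep; rewrite /strong_separation (GG_attractor G0 HG0).1.
    by have [d d0 Hd] := separated_faithful on0 cO cA eta0 OM Oeta sepA Aa; exists a, d.
  have [d d0 Hd] := oU a Ua; exists a, d; split=> // z /Hd.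
  apply: (forward_faithful on0 (UO G0 HG0)); last exact: faith.
  by move=> i x Ux; apply: fwd; exists i => //; exists x.
have [r0 r00 Ur0] := oU a Ua.
have fin (dl : R) : 0 < dl -> finite_set [set h : V -> R[i] |
    exists g, [/\ faithful_map A U V g, dl <= cmod (cder g a) & h = sigL V g]].
  apply: (@finite_big R A (faithful_set (ifs_dom G0) A G0) U V a r0 M dl oV V_connected UV' r00 Ur0 Aa _ (Aperf a Aa)).
    by move=> x /(ifs_sub on0); exact: OM.
  move=> s s0 germs; apply: nlam.
  exact: star_rigidity on0 cO cA eta0 OM Oeta Aperf _ _ _ Ab d0 Fb s0 germs _.
(* Either one bound dl serves all maps and [fin] concludes, or there are systems with maps of
   arbitrarily small derivative at a, which [no_shrinking] excludes. *)
have [[dl dl0 Hdl]|no] := pselect (exists2 dl : R, 0 < dl &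
    forall G, GG G -> forall i, dl <= cmod (cder (G i) a)).
  apply: sub_finite_set (fin dl dl0) => h [G HG [i ->]].
  by exists (G i); split; [exact: FM|exact: Hdl|].
have H n : exists G, GG G /\ exists i, cmod (cder (G i) a) < n.+1%:R^-1.
  apply: contrapT => nG; apply: no; exists n.+1%:R^-1; first by rewrite invr_gt0 ltr0n.
  move=> G HG i; rewrite leNgt; apply/negP => h; apply: nG.
  by exists G; split=> //; exists i.
have [Gs HGs] := choice H.
(* The number of maps varies with n; indexing by natural numbers, with the identity as default
   beyond the last map, gives all systems one type. *)
pose g n k := if insub k is Some i then Gs n i else id.
have gE n (i : 'I_(ifs_card (Gs n))) : g n i = Gs n i by rewrite /g valK.
have gE' n k (kc : (k < ifs_card (Gs n))%N) : g n k = Gs n (Ordinal kc) by rewrite -gE.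
exfalso; apply: (@no_shrinking R A U V a N (fun n => ifs_card (Gs n)) g) => //.
- by move=> n; exact: HN _ (HGs n).1.
- by move=> n i ic; rewrite gE'; exact: FM _ _ (HGs n).1.
- move=> n x Ax; have [i [w [Aw wx]]] := ifs_bwd (on _ (HGs n).1) Ax.
  by exists i, w; rewrite gE; split.
- move=> n i j u v ic jc; rewrite !gE' => Uu Uv uv.
  by have := dis _ (HGs n).1 _ _ u v Uu Uv uv; case.
- by move=> n; have [_ [i Hi]] := HGs n; exists i => //; rewrite gE.
Qed.
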